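(* Let $G_p$ be a multi energy parity game (resp. a multi mean-payoff parity game with rational threshold vector $v\in\mathbb Q^k$). Algorithm CpreFP is a symbolic and incremental algorithm that synthesizes a winning strategy of $\mathcal P_1$ in $G_p$ with at most exponential-size memory (together with a winning initial credit in the energy case) if a winning (resp. a finite-memory winning) strategy of $\mathcal P_1$ exists. In the worst case, algorithm CpreFP takes exponential time. (Here ''exponential'' means bounded by $2^{P(n)}$ for a fixed polynomial $P$, where $n$ is the size of the input, and memory size is the number of states of the Moore machine.)
   Context: A multi-weighted two-player game structure is $G=(S_1,S_2,s_{init},E,k,w)$, where $S_1,S_2$ are finite disjoint sets (states of player 1, $\mathcal P_1$, and player 2, $\mathcal P_2$), $S=S_1\cup S_2$, $s_{init}\in S$, $E\subseteq S\times S$ is such that every state has a successor, $k\in\mathbb N$, $w:E\to\mathbb Z^k$. $G_p$ is $G$ with a priority function $p:S\to\mathbb N$. A play is an infinite path $\pi=s_0s_1\dots$ with $s_0=s_{init}$; $\pi(n)=s_0\dots s_n$; $\mathsf{EL}(s_0\dots s_n)=\sum_{i<n}w(s_i,s_{i+1})$; $\mathsf{MP}(\pi)=\liminf_n\frac1n\mathsf{EL}(\pi(n))$ componentwise; $\mathsf{Par}(\pi)$ is the least priority seen infinitely often. A pure strategy of $\mathcal P_1$ maps finite prefixes ending in $S_1$ to a successor of the last state; it is finite-memory if encoded by a Moore machine $(M,m_0,\alpha_u:M\times S\to M,\alpha_n:M\times S_1\to S)$. In a multi energy parity game a strategy is winning for initial credit $v_0\in\mathbb N^k$ if all consistent plays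 satisfy $v_0+\mathsf{EL}(\pi(n))\in\mathbb N^k$ for all $n\ge0$ and have $\mathsf{Par}(\pi)$ even; it is winning if this holds for some $v_0$, which is part of what is synthesized. In a multi mean-payoff parity game with threshold $v$, it is winning if all consistent plays satisfy $\mathsf{MP}(\pi)\ge v$ and $\mathsf{Par}(\pi)$ even. The input size is that of the explicit encoding with weight vectors listed for each edge and numbers in binary. Algorithm CpreFP on a multi energy game (no parity): for a constant $\mathbb C\in\mathbb N$ let $U(\mathbb C)=S\times\{0,\dots,\mathbb C\}^k$ and for $V\subseteq U(\mathbb C)$ let $\mathsf{Cpre}_{\mathbb C}(V)$ be the set of $(s,e)\in U(\mathbb C)$ such that either $s\in S_1$ and there are $(s,s')\in E$ and $(s',e')\in V$ with $e'\le e+w(s,s')$, or $s\in S_2$ and for all $(s,s')\in E$ there is $(s',e')\in V$ with $e'\le e+w(s,s')$. CpreFP computes the greatest fixed point $\mathsf{Cpre}^*_{\mathbb C}$ as the limit of the descending chain $U_0=U(\mathbb C)$, $U_{i+1}=\mathsf{Cpre}_{\mathbb C}(U_i)$. Symbolic: the sets, which are upward closed for the order $(s,e)\preceq(s',e')$ iff $s=s'$ and $e\le e'$, are represented by the antichains of their minimal elements. Incremental: $\mathbb C$ is increased from small values until some $(s_{init},c)$ is in the fixed point (then a winning strategy for initial credit $c$ is extracted from it, as a Moore machine whose states are minimal elements of the fixed point) or $\mathbb C$ reaches $2\cdot l\cdot W$, where $W$ is the largest absolute weight, $l=2^{(d-1)|S|}(W|S|+1)^{ck^2}$, $d$ is the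 maximal out-degree and $c$ is a universal constant. A parity condition with priorities in $\{0,\dots,2m\}$ is first removed by adding $m$ energy dimensions, one per odd priority, decreased by $1$ each time that odd priority is visited and increased by $l$ each time a smaller even priority is visited. A mean-payoff threshold $v$ is first reduced to the energy objective by replacing $w$ by $b\cdot(w-v)$, $b$ a common denominator of the entries of $v$.
   Formalization: In l, W and k are replaced by max(1,W) and max(1,k), since for W=0 and out-degree 1 the literal l=1 is too small to remove parity; energy dimensions are added only for odd priorities that occur, since with binary priorities unused ones would break the exponential time bound. *)

(* Defs.v *)
From HB Require Import structures.
From mathcomp Require Import all_boot all_order all_algebra.
From mathcomp Require Import reals ereal sequences.

Set Implicit Arguments.
Unset Strict Implicit.
Unset Printing Implicit Defensive.

Import Order.TTheory GRing.Theory Num.Theory.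

(* S_1 is [pl1] and S_2 its complement; [weight] only matters on edges. *)
Record game := Game {
  state :> finType;
  pl1 : {set state};
  init : state;
  edge : rel state;
  edge_total : forall s, exists s', edge s s';
  wdim : nat;
  weight : state -> state -> 'rV[int]_wdim }.

Record pgame := PGame {
  arena :> game;
  prio : arena -> nat }.

Section Plays.
Variable G : game.

Definition is_play (pi : nat -> G) : Prop :=
  pi 0 = init G /\ forall n, edge (pi n) (pi n.+1).

Definition prefix_of (pi : nat -> G) (n : nat) : seq G := mkseq pi n.+1.

Definition EL (pi : nat -> G) (n : nat) : 'rV[int]_(wdim G) :=
  (\sum_(i < n) weight (pi i) (pi i.+1))%R.

Definition MP (R : realType) (pi : nat -> G) (j : 'I_(wdim G)) : \bar R :=
  limn_einf (fun n => (((EL pi n 0 j)%:~R / n%:R)%R)%:E).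

(* Strategies of player 1 are total functions on sequences of states; only
   their values on the finite prefixes ending in S_1 are meaningful. *)
Definition is_strategy (sigma : seq G -> G) : Prop :=
  forall rho : seq G, path (@edge G) (init G) rho ->
    last (init G) rho \in pl1 G ->
    edge (last (init G) rho) (sigma (init G :: rho)).

Definition consistent (sigma : seq G -> G) (pi : nat -> G) : Prop :=
  is_play pi /\
  forall n, pi n \in pl1 G -> pi n.+1 = sigma (prefix_of pi n).

Definition energy_safe (v0 : 'rV[nat]_(wdim G)) (pi : nat -> G) : Prop :=
  forall n j, (0 <= (v0 0 j)%:Z + EL pi n 0 j :> int)%R.

(* [mupd] reads a state when the play enters it: [m0] is the memory at s_init,
   m_(i+1) = mupd m_i s_(i+1), and at s_i in S_1 the move is mnext m_i s_i. *)
Record moore := Moore {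
  mstate : finType;
  m0 : mstate;
  mupd : mstate -> G -> mstate;
  mnext : mstate -> G -> G }.

Definition moore_strategy (M : moore) (rho : seq G) : G :=
  mnext (foldl (@mupd M) (m0 M) (behead rho)) (last (init G) rho).

End Plays.

Section ParityObjectives.
Variable G : pgame.

Definition inf_often (pi : nat -> G) (q : nat) : Prop :=
  forall N, exists2 n, N <= n & prio (pi n) = q.

Definition is_Par (pi : nat -> G) (q : nat) : Prop :=
  inf_often pi q /\ forall q', inf_often pi q' -> q <= q'.

Definition Par_even (pi : nat -> G) : Prop := exists2 q, is_Par pi q & ~~ odd q.

Definition energy_parity_winning (sigma : seq G -> G) (v0 : 'rV[nat]_(wdim G)) :
    Prop :=
  is_strategy sigma /\
  forall pi, consistent sigma pi -> energy_safe v0 pi /\ Par_even pi.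

Definition mp_parity_winning (R : realType) (v : 'rV[rat]_(wdim G))
    (sigma : seq G -> G) : Prop :=
  is_strategy sigma /\
  forall pi, consistent sigma pi ->
    (forall j, ((ratr (v 0%R j))%:E <= MP R pi j)%E) /\ Par_even pi.

End ParityObjectives.

Definition bits (n : nat) : nat := (trunc_log 2 n).+1.
Definition zbits (z : int) : nat := (bits `|z|%N).+1.
Definition name_bits (T : finType) : nat := bits #|T|.

Definition game_size (G : game) : nat :=
  bits (wdim G) + name_bits G + \sum_(s : G) (name_bits G).+1 +
  \sum_(a : G * G | edge a.1 a.2)
    (2 * name_bits G + \sum_(j < wdim G) zbits (weight a.1 a.2 0%R j)).

Definition energy_parity_size (G : pgame) : nat :=
  game_size G + \sum_(s : G) (name_bits G + bits (prio s)).

Definition mp_parity_size (G : pgame) (v : 'rV[rat]_(wdim G)) : nat :=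
  energy_parity_size G +
  \sum_(j < wdim G) (zbits (numq (v 0%R j)) + zbits (denq (v 0%R j))).

Section Cpre.
Variables (G : game) (C : nat).

(* U(C). *)
Definition config : finType := (G * {ffun 'I_(wdim G) -> 'I_C.+1})%type.

Definition covers (x y : config) : bool :=
  [forall j, ((y.2 j : nat)%:Z
              <= (x.2 j : nat)%:Z + weight x.1 y.1 0 j :> int)%R].

Definition Cpre (V : {set config}) : {set config} :=
  [set x : config |
    if x.1 \in pl1 G then [exists y in V, edge x.1 y.1 && covers x y]
    else [forall s', edge x.1 s' ==>
            [exists y in V, (y.1 == s') && covers x y]]].

Definition Cpre_star : {set config} := cofixset Cpre.

Definition config_le (x y : config) : bool :=
  (x.1 == y.1) && [forall j, x.2 j <= y.2 j].

Definition minimal_in (V : {set config}) (x : config) : bool :=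
  (x \in V) && [forall y in V, config_le y x ==> (y == x)].

Definition listing (x : config) : G * seq nat :=
  (x.1, [seq (x.2 j : nat) | j <- enum 'I_(wdim G)]).

End Cpre.

(* A value with the time spent computing it: arithmetic is charged by the
   schoolbook bit complexity of its operands, a comparison of states by the
   length of a state name, and every list traversal or construction one unit
   per cell in addition to the cost of the work done on the cell. *)
Definition timed (A : Type) : Type := (A * nat)%type.
Definition tick (A : Type) (n : nat) (a : A) : timed A := (a, n).
Definition ret (A : Type) (a : A) : timed A := tick 0 a.
Definition bind (A B : Type) (x : timed A) (f : A -> timed B) : timed B :=
  ((f x.1).1, x.2 + (f x.1).2).
Notation "'let!' x ':=' m 'in' f" := (bind m (fun x => f))
  (at level 200, x name, m at level 200, f at level 200).

Definition nadd (x y : nat) : timed nat := tick (bits x + bits y) (x + y).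
Definition nmul (x y : nat) : timed nat := tick (bits x * bits y) (x * y).
Definition npred (x : nat) : timed nat := tick (bits x) x.-1.
Definition nmax (x y : nat) : timed nat := tick (bits x + bits y) (maxn x y).
Definition nleq (x y : nat) : timed bool := tick (bits x + bits y) (x <= y).
Definition neq (x y : nat) : timed bool := tick (bits x + bits y) (x == y).
Definition zadd (x y : int) : timed int := tick (zbits x + zbits y) (x + y)%R.
Definition zsub (x y : int) : timed int := tick (zbits x + zbits y) (x - y)%R.
Definition zmul (x y : int) : timed int := tick (zbits x * zbits y) (x * y)%R.
Definition zdiv (x y : int) : timed int := tick (zbits x * zbits y) (x %/ y)%Z.
Definition zleq (x y : int) : timed bool := tick (zbits x + zbits y) (x <= y)%R.

Fixpoint npow (x n : nat) : timed nat :=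
  if n is n'.+1 then
    let! m := npred n in let! y := npow x n' in nmul x y
  else tick 1 1.

Section Lists.
Variables A B D : Type.

Fixpoint mapM (f : A -> timed B) (s : seq A) : timed (seq B) :=
  if s is x :: s' then
    let! y := f x in let! ys := mapM f s' in tick 1 (y :: ys)
  else tick 1 [::].

Fixpoint zipM (f : A -> B -> timed D) (u : seq A) (v : seq B) :
    timed (seq D) :=
  match u, v with
  | x :: u', y :: v' =>
      let! z := f x y in let! zs := zipM f u' v' in tick 1 (z :: zs)
  | _, _ => tick 1 [::]
  end.

Fixpoint filterM (p : A -> timed bool) (s : seq A) : timed (seq A) :=
  if s is x :: s' then
    let! b := p x in let! ys := filterM p s' in
    tick 1 (if b then x :: ys else ys)
  else tick 1 [::].

Fixpoint findM (p : A -> timed bool) (s : seq A) : timed (option A) :=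
  if s is x :: s' then
    let! b := p x in
    if b then tick 1 (Some x)
    else (let! r := findM p s' in tick 1 r)
  else tick 1 None.

Fixpoint foldM (f : B -> A -> timed B) (b : B) (s : seq A) : timed B :=
  if s is x :: s' then
    let! b' := f b x in let! r := foldM f b' s' in tick 1 r
  else tick 1 b.

Definition lengthM (s : seq A) : timed nat :=
  tick ((size s).+1 * bits (size s)) (size s).

Definition flattenM (ss : seq (seq A)) : timed (seq A) :=
  tick (size ss + size (flatten ss)).+1 (flatten ss).

Definition catM (u v : seq A) : timed (seq A) := tick (size u).+1 (u ++ v).

End Lists.

Definition hasM (A : Type) (p : A -> timed bool) (s : seq A) : timed bool :=
  let! r := findM p s in ret (isSome r).

Definition negM (b : timed bool) : timed bool := let! x := b in ret (~~ x).

Definition allM (A : Type) (p : A -> timed bool) (s : seq A) : timed bool :=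
  negM (hasM (fun x => negM (p x)) s).

Definition zeroM (k : nat) : timed (seq nat) := tick k.+1 (nseq k 0).

Definition vall2 (A B : Type) (r : A -> B -> timed bool) (u : seq A)
    (v : seq B) : timed bool :=
  let! bs := zipM r u v in allM (fun b => ret b) bs.

Definition vleq : seq nat -> seq nat -> timed bool := vall2 nleq.
Definition veq : seq nat -> seq nat -> timed bool := vall2 neq.
Definition vmax : seq nat -> seq nat -> timed (seq nat) := zipM nmax.

(* e' <= e + w. *)
Definition affordable (e' e : seq nat) (w : seq int) : timed bool :=
  let! f := zipM (fun x y => zadd (Posz x) y) e w in
  vall2 (fun x y => zleq (Posz x) y) e' f.

(* The least e in N^k with e' <= e + w. *)
Definition least_before (e' : seq nat) (w : seq int) : timed (seq nat) :=
  zipM (fun x y => let! z := zsub (Posz x) y in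
                   tick (zbits z) `|Num.max 0%R z|%N) e' w.

(* Adds the upward closure of [e] to the upward closure of an antichain. *)
Definition add_minimal (X : seq (seq nat)) (e : seq nat) :
    timed (seq (seq nat)) :=
  let! dominated := hasM (fun x => vleq x e) X in
  if dominated then ret X
  else (let! X' := filterM (fun x => negM (vleq e x)) X in tick 1 (e :: X')).

Definition minimalM (X : seq (seq nat)) : timed (seq (seq nat)) :=
  foldM add_minimal [::] X.

Section Algorithm.
Variable T : finType.

(* The input of the algorithm: states with their owner ([true] for player 1),
   initial state, dimension, weighted edges. *)
Record table := Table {
  tstates : seq (T * bool);
  tinit : T;
  tdim : nat;
  tedges : seq (T * T * seq int) }.

(* An upward closed set of pairs (s, e), given by its minimal elements. *)
Notation elt := (T * seq nat)%type.
Notation antichain := (seq elt).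

Definition eq_state (s s' : T) : timed bool := tick (2 * name_bits T) (s == s').

Definition eq_elt (x y : elt) : timed bool :=
  let! b := eq_state x.1 y.1 in
  if b then veq x.2 y.2 else ret false.

Definition out_edges (t : table) (s : T) : timed (seq (T * T * seq int)) :=
  filterM (fun a => eq_state a.1.1 s) (tedges t).

(* Minimal predecessors in U(C) of the elements of V through the edge a. *)
Definition pre_edge (C : nat) (V : antichain) (a : T * T * seq int) :
    timed (seq (seq nat)) :=
  let! X := filterM (fun x => eq_state x.1 a.1.2) V in
  let! Y := mapM (fun x : elt => least_before x.2 a.2) X in
  filterM (allM (fun n => nleq n C)) Y.

(* Intersection of two upward closed sets of vectors. *)
Definition meetM (X Y : seq (seq nat)) : timed (seq (seq nat)) :=
  let! Z := mapM (fun x => mapM (vmax x) Y) X in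
  let! Z' := flattenM Z in
  minimalM Z'.

Definition cpre_state (t : table) (C : nat) (V : antichain) (sb : T * bool) :
    timed antichain :=
  let! A := out_edges t sb.1 in
  let! Xs := mapM (pre_edge C V) A in
  let! es :=
    if sb.2 then (let! X := flattenM Xs in minimalM X)
    else (let! o := zeroM (tdim t) in foldM meetM [:: o] Xs) in
  mapM (fun e => ret (sb.1, e)) es.

Definition cpreM (t : table) (C : nat) (V : antichain) : timed antichain :=
  let! Vs := mapM (cpre_state t C V) (tstates t) in flattenM Vs.

Definition full_antichain (t : table) : timed antichain :=
  mapM (fun sb => let! o := zeroM (tdim t) in ret (sb.1, o)) (tstates t).

Definition same_antichain (V V' : antichain) : timed bool :=
  let! b := allM (fun x => hasM (eq_elt x) V') V in
  if b then allM (fun x => hasM (eq_elt x) V) V' else ret false.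

(* The chain U_0, U_1, ... until U_(i+1) = U_i.  [fuel] is not part of the
   computation: it only makes the recursion structural, and the chain
   stabilizes before the value given in [cpre_fixpoint], which exceeds the
   cardinality of U(C), is used up. *)
Fixpoint descend (fuel : nat) (t : table) (C : nat) (V : antichain) :
    timed antichain :=
  if fuel is fuel'.+1 then
    let! V' := cpreM t C V in
    let! stable := same_antichain V V' in
    if stable then ret V else descend fuel' t C V'
  else ret V.

Definition cpre_fixpoint (t : table) (C : nat) : timed antichain :=
  let! V0 := full_antichain t in
  descend (size (tstates t) * C.+1 ^ tdim t).+1 t C V0.

(* A Moore machine given by finite tables; its states are elements of the
   antichain. *)
Record machine := Machine {
  x_states : antichain;
  x_start : elt;
  x_upd : seq ((elt * T) * elt);
  x_next : seq ((elt * T) * T) }.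

Definition supports (a : T * T * seq int) (e : seq nat) (y : elt) :
    timed bool :=
  let! b := eq_state y.1 a.1.2 in
  if b then affordable y.2 e a.2 else ret false.

(* On entering s' from the memory state (s, e): some (s', e') in V with
   e' <= e + w(s, s'); the memory is kept when there is none. *)
Definition upd_entry (t : table) (V : antichain) (x : elt) (s' : T) :
    timed elt :=
  let! oa := findM (fun a : T * T * seq int =>
                      let! b := eq_state a.1.1 x.1 in
                      if b then eq_state a.1.2 s' else ret false)
                   (tedges t) in
  if oa is Some a then
    let! oy := findM (supports a x.2) V in ret (odflt x oy)
  else ret x.

(* At s' with memory state (s', e): the target of an edge (s', s'') such that
   some (s'', e'') in V has e'' <= e + w(s', s'').  Any successor will do when
   the memory state does not match s', which happens on no consistent prefix. *)
Definition next_entry (t : table) (V : antichain) (x : elt) (s' : T) :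
    timed T :=
  let! A := out_edges t s' in
  let! b := eq_state x.1 s' in
  let! oa := if b then findM (fun a => hasM (supports a x.2) V) A
             else ret None in
  if oa is Some a then ret a.1.2
  else (let! oa' := findM (fun _ => ret true) A in
        ret (if oa' is Some a then a.1.2 else s')).

Definition tabulate (B : Type) (f : elt -> T -> timed B) (V : antichain)
    (Q : seq (T * bool)) : timed (seq ((elt * T) * B)) :=
  let! rows := mapM (fun x => mapM (fun sb : T * bool =>
                 let! y := f x sb.1 in ret ((x, sb.1), y)) Q) V in
  flattenM rows.

Definition extract (t : table) (V : antichain) (x : elt) : timed machine :=
  let! u := tabulate (upd_entry t V) V (tstates t) in
  let! Q1 := filterM (fun sb : T * bool => ret sb.2) (tstates t) in
  let! n := tabulate (next_entry t V) V Q1 in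
  ret (Machine V x u n).

(* Tries the [n] values C, C + 1, ..., C + n - 1 in turn. *)
Fixpoint search (n : nat) (t : table) (C : nat) : timed (option machine) :=
  if n is n'.+1 then
    let! V := cpre_fixpoint t C in
    let! ox := findM (fun x : elt => eq_state x.1 (tinit t)) V in
    if ox is Some x then let! m := extract t V x in ret (Some m)
    else (let! C' := nadd C 1 in let! m := npred n in search n' t C')
  else ret None.

Definition max_weight (t : table) : timed nat :=
  foldM (fun r (a : T * T * seq int) =>
           foldM (fun r' z => nmax r' `|z|%N) r a.2) 0 (tedges t).

Definition max_outdegree (t : table) : timed nat :=
  foldM (fun r (sb : T * bool) =>
           let! A := out_edges t sb.1 in
           let! d := lengthM A in nmax r d) 0 (tstates t).

(* 2 ^ ((d - 1) |S|) * (W |S| + 1) ^ (c k ^ 2), where W and k are replaced by 1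
   when they are 0: without this the bound is 1 for W = 0 or k = 0 in a game
   of out-degree 1, which is too small for the removal of the parity
   condition. *)
Definition depth_bound (c : nat) (t : table) : timed nat :=
  let! n := lengthM (tstates t) in
  let! d := max_outdegree t in
  let! W := max_weight t in
  let! W1 := nmax 1 W in
  let! k := nmax 1 (tdim t) in
  let! d1 := npred d in
  let! x := nmul d1 n in
  let! p := npow 2 x in
  let! y := nmul W1 n in
  let! y1 := nadd y 1 in
  let! kk := nmul k k in
  let! z := nmul c kk in
  let! q := npow y1 z in
  nmul p q.

Definition CpreFP_energy (c : nat) (t : table) : timed (option machine) :=
  let! l := depth_bound c t in
  let! W := max_weight t in
  let! ll := nmul 2 l in
  let! Cmax := nmul ll W in
  search Cmax.+1 t 0.

Definition lookup_prio (ps : seq (T * nat)) (s : T) : timed nat :=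
  let! op := findM (fun x : T * nat => eq_state x.1 s) ps in
  ret (if op is Some x then x.2 else 0).

(* The odd priorities in use, without repetition. *)
Definition odd_priorities (ps : seq (T * nat)) : timed (seq nat) :=
  foldM (fun qs (x : T * nat) =>
           if odd x.2 then
             (let! b := hasM (neq x.2) qs in
              if b then ret qs else tick 1 (x.2 :: qs))
           else tick 1 qs) [::] ps.

(* Weight, in the dimension of the odd priority q, of an edge leaving a state
   of priority p. *)
Definition parity_weight (l p q : nat) : timed int :=
  let! b := neq p q in
  let! b' := nleq p q in
  tick (bits l) (if b then (-1)%R
                 else if b' && ~~ odd p then Posz l else 0%R).

Definition remove_parity (c : nat) (t : table) (ps : seq (T * nat)) :
    timed table :=
  let! l := depth_bound c t in
  let! qs := odd_priorities ps in
  let! m := lengthM qs in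
  let! k := nadd (tdim t) m in
  let! E := mapM (fun a : T * T * seq int =>
              let! p := lookup_prio ps a.1.1 in
              let! u := mapM (parity_weight l p) qs in
              let! w := catM a.2 u in
              ret (a.1, w)) (tedges t) in
  ret (Table (tstates t) (tinit t) k E).

Definition CpreFP_energy_parity (c : nat) (t : table) (ps : seq (T * nat)) :
    timed (option machine) :=
  let! t' := remove_parity c t ps in CpreFP_energy c t'.

(* w is replaced by b (w - v), b the product of the denominators of v; a
   rational is the pair of its numerator and denominator. *)
Definition remove_threshold (t : table) (v : seq (int * int)) : timed table :=
  let! b := foldM (fun r (x : int * int) => zmul r x.2) 1%R v in
  let! bv := mapM (fun x : int * int =>
               let! y := zmul x.1 b in zdiv y x.2) v in
  let! E := mapM (fun a : T * T * seq int =>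
              let! w := zipM (fun x y => let! z := zmul b x in zsub z y)
                             a.2 bv in
              ret (a.1, w)) (tedges t) in
  ret (Table (tstates t) (tinit t) (tdim t) E).

Definition CpreFP_mp_parity (c : nat) (t : table) (ps : seq (T * nat))
    (v : seq (int * int)) : timed (option machine) :=
  let! t' := remove_threshold t v in CpreFP_energy_parity c t' ps.

End Algorithm.

Definition encode (G : game) : table G :=
  Table [seq (s, s \in pl1 G) | s <- enum G] (init G) (wdim G)
    [seq (a.1, a.2, [seq weight a.1 a.2 0%R j | j <- enum 'I_(wdim G)])
       | a : G * G <- enum {: G * G} & edge a.1 a.2].

Definition encode_prio (G : pgame) : seq (G * nat) :=
  [seq (s, prio s) | s <- enum G].

Definition encode_rat (k : nat) (v : 'rV[rat]_k) : seq (int * int) :=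
  [seq (numq (v 0%R j), denq (v 0%R j)) | j <- enum 'I_k].

Definition assoc (A : eqType) (B : Type) (d : B) (s : seq (A * B)) (x : A) : B :=
  nth d (unzip2 s) (index x (unzip1 s)).

Section Decode.
Variables (G : game) (m : machine G).

(* The start state is listed in [x_states m] by the algorithm; consing it only
   makes the type inhabited. *)
Definition decoded_mem : finType := seq_sub (x_start m :: x_states m).

Definition decoded_start : decoded_mem := SeqSub (mem_head _ _).

Definition decode_machine : moore G :=
  Moore decoded_start
    (fun (x : decoded_mem) s =>
       insubd decoded_start (assoc (x_start m) (x_upd m) (ssval x, s)))
    (fun (x : decoded_mem) s => assoc s (x_next m) (ssval x, s)).

(* The coordinates of the original dimensions; those added for the odd
   priorities are dropped. *)
Definition decode_credit : 'rV[nat]_(wdim G) :=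
  \row_(j < wdim G) nth 0 (x_start m).2 j.

End Decode.

(* Main.v *)
(** If player 1 wins with a strategy sigma, let X be the set of states visited by
    plays consistent with sigma. Against every positional choice of player 2,
    sigma yields from each state of X a path inside X that reaches a closed
    walk of nonnegative weight whose least priority is even: by Dickson's
    lemma when sigma is an energy strategy, by periodicity when it is finite-
    memory. Such a closed walk splits into a short closed walk through the
    same states and simple cycles; the theorems of Caratheodory and Cramer
    replace the multiplicities of the cycles by small ones, so that the closed
    walk may be taken of length at most (W |S| + 1) ^ (8 k ^ 2). It then
    visits no odd priority more than l times and remains nonnegative in the
    dimensions added for the odd priorities. Player 1 combines the strategies
    against the different positional choices of player 2 by playing them in an
    interleaved way, which adds up the energies they need; as there are at
    most 2 ^ ((d - 1) |S|) choices, all energies stay below 2 l W, and s_init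
    is in the fixed point for that constant.

    Conversely, a play of the extracted machine keeps its energy above that of the
    memory element. Being bounded below in the dimension of an odd priority q,
    it sees q infinitely often only if it sees smaller even priorities
    infinitely often; being bounded below in the scaled weights, it has a mean
    payoff above the threshold. *)

Require Import Defs.
From HB Require Import structures.
From mathcomp Require Import all_boot all_order all_algebra.
From mathcomp Require Import perm boolp reals ereal sequences.
From mathcomp Require classical_sets topology.
From mathcomp Require Import zify ring lra.
Set Implicit Arguments.
Unset Strict Implicit.
Unset Printing Implicit Defensive.
Import Order.TTheory GRing.Theory Num.Theory.

(** * Small conic combinations *)

(** Removing the parity condition threatens to be circular: the reward [l] becomes a weight of the
    extended game, yet [l] must be at least the length of the closed walks on which it is earned. So
    closed walks are shortened for the original weights alone. Parity is taken care of by their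
    start, a state of least priority: its reward is collected before any odd priority is paid for.
    The extended weights enter only afterwards, to measure the energies along the walks. Hence the
    reward is the depth bound of the original game, while the constant ranges up to the bound of the
    extended game.

    Opponents may be taken positional because a state where player 2 has several moves can be split
    in two, at the price of adding up the energies of both halves. The nesting depth of the splits
    is at most the sum of the surplus out-degrees, which gives the factor 2 ^ ((d - 1) |S|). The
    constant 8 in the other exponent comes from absorbing the determinants of Cramer's rule into
    powers of W |S| + 1. *)

Section LinearAlgebra.
Local Open Scope ring_scope.

Lemma absz_det_le (r a : nat) (A : 'M[int]_r) :
  (forall i j, `|A i j | <= a%:Z) -> `|\det A| <= (r`! * a ^ r)%N%:Z.
Proof.
move=> hA; apply: le_trans (ler_norm_sum _ _ _) _.
have -> : (r`! * a ^ r)%N%:Z = \sum_(s : 'S_r) \prod_(i < r) a%:Z.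
  by rewrite sumr_const prodr_const card_Sn card_ord -!natz natrM natrX mulr_natl.
apply: ler_sum => s _; rewrite normrM normrX normrN1 expr1n mul1r normr_prod.
by apply: ler_prod => i _; rewrite normr_ge0 hA.
Qed.

(** Caratheodory's theorem for cones: as long as the rows in the support are dependent, the solution
    can be moved along a dependency [mu] until one of its entries vanishes, which shrinks the
    support. *)
Lemma cone_support (n k : nat) (V : 'M[rat]_(n, k)) (b : 'rV[rat]_k)
    (x : 'rV[rat]_n) :
  (forall i, 0 <= x 0 i) -> x *m V = b ->
  exists y : 'rV[rat]_n, [/\ (forall i, 0 <= y 0 i), y *m V = b
    & row_free (rowsub (@enum_val _ (mem [set i | y 0 i != 0])) V)].
Proof.
move: {2}(#|[set i | x 0 i != 0]|.+1) (ltnSn #|[set i | x 0 i != 0]|) => m.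
elim: m x => // m IH x; rewrite ltnS => hm x0 xV.
have [hfree|] := boolP (row_free (rowsub (@enum_val _ (mem [set i | x 0 i != 0]))
  V)); first by exists x.
set I := [set i | x 0 i != 0] in hm *.
rewrite -kermx_eq0 => /rowV0Pn[v /sub_kermxP vV v0].
pose mu := v *m rowsub (@enum_val _ (mem I)) 1%:M.
have muV : mu *m V = 0 by rewrite -mulmxA -rowsubE.
have muE l : mu 0 (enum_val l) = v 0 l.
  rewrite mxE (bigD1 l) //= big1 => [|j jl]; rewrite !mxE ?eqxx ?addr0 ?mulr1//.
  by rewrite (inj_eq enum_val_inj) (negPf jl) mulr0.
have muI i : i \notin I -> mu 0 i = 0.
  move=> iI; rewrite mxE big1// => j _; rewrite !mxE; case: eqP => [e|];
    last by rewrite mulr0.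
  by move: (enum_valP j); rewrite e (negPf iI).
have [l vl] : exists l, v 0 l != 0 by apply/rV0Pn.
clearbody mu.
(* One of [mu] and [- mu] has a positive entry, so that the minimum below ranges over a nonempty
   set. *)
have {v vV v0 l vl mu muV muE muI} [mu [muV muI [i1 mu1]]] : exists mu : 'rV[rat]_n,
    [/\ mu *m V = 0, forall i, i \notin I -> mu 0 i = 0 & exists i, 0 < mu 0 i].
  have [vp|vn|vz] := ltgtP 0 (v 0 l).
  - by exists mu; split => //; exists (enum_val l); rewrite muE.
  - exists (- mu); split.
    + by rewrite mulNmx muV oppr0.
    + by move=> i /muI; rewrite mxE => ->; rewrite oppr0.
    + by exists (enum_val l); rewrite mxE muE oppr_gt0.
  - by rewrite -vz eqxx in vl.
(* The ratio test of the simplex method: [t] is the largest step for which [x - t *: mu] stays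
   nonnegative, and it cancels the entry [i0]. *)
pose i0 := [arg min_(i < i1 | 0 < mu 0 i) (x 0 i / mu 0 i)]%O.
have [mu0 hmin] : 0 < mu 0 i0 /\ forall i, 0 < mu 0 i ->
  x 0 i0 / mu 0 i0 <= x 0 i / mu 0 i.
  by rewrite /i0; case: arg_minP => // i ? ?.
set t := x 0 i0 / mu 0 i0 in hmin.
have t0 : 0 <= t by rewrite divr_ge0 // ltW.
apply: (IH (x - t *: mu)).
- apply: leq_trans hm; apply: proper_card; apply/properP; split.
    apply/subsetP => i; rewrite !inE !mxE; apply: contraNneq => xi.
    by rewrite xi muI ?inE ?xi ?eqxx// mulr0 subr0.
  have i0I : i0 \in I by apply: contraTT mu0 => /muI ->; rewrite ltxx.
  exists i0 => //; by rewrite !inE !mxE negbK divfK ?subrr ?eqxx // gt_eqF.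
- move=> i; rewrite !mxE subr_ge0; have [mup|mun] := ltP 0 (mu 0 i).
    by rewrite -ler_pdivlMr// hmin.
  by apply: le_trans (x0 i); rewrite mulr_ge0_le0.
- by rewrite mulmxBl -scalemxAl muV scaler0 subr0.
Qed.

(* Caratheodory (cone_support) leaves linearly independent generators, whose
   coefficients are quotients of determinants by Cramer's rule; D is the common
   denominator. *)
Lemma small_cone_combination (n k : nat) (V : 'M[int]_(n, k)) (b : 'rV[int]_k)
    (a bt : nat) (x : 'I_n -> nat) :
  (0 < a)%N -> (forall i j, `|V i j| <= a%:Z) -> (forall j, `|b 0 j| <= bt%:Z) ->
  (forall j, \sum_i (x i)%:Z * V i j = b 0 j) ->
  exists (D : nat) (y : 'I_n -> nat),
    [/\ (0 < D <= k`! * a ^ k)%N, (\sum_i y i <= k * (k`! * a ^ k * bt))%N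
      & forall j, \sum_i (y i)%:Z * V i j = D%:Z * b 0 j].
Proof.
move=> a0 hV hb hx.
pose VQ : 'M[rat]_(n, k) := map_mx intr V.
have [||y [y0 yV]] := @cone_support n k VQ (map_mx intr b) (\row_i (x i)%:R).
- by move=> i; rewrite mxE ler0n.
- apply/rowP => j; rewrite !mxE -hx rmorph_sum; apply: eq_bigr => i _.
  by rewrite !mxE rmorphM.
set I := [set i | y 0 i != 0]; set M := rowsub _ _ => Mfree.
have rk : (#|I| <= k)%N by move: Mfree; rewrite /row_free => /eqP <-;
  apply: rank_leq_col.
have Mfull : row_full M^T by rewrite /row_full mxrank_tr.
(* [f] selects linearly independent columns, which leaves a square invertible system for the nonzero
   coefficients. *)
pose f := fullrankfun Mfull.
pose B : 'M[int]_#|I| := \matrix_(p, q) V (enum_val q) (f p).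
have BE : map_mx intr B = rowsub f M^T by apply/matrixP => p q; rewrite !mxE.
have Bunit : \det B != 0.
  have := fullrowsub_unit Mfull.
  by rewrite -/f -BE unitmxE det_map_mx unitfE intr_eq0.
pose c : 'cV[int]_#|I| := \col_p b 0 (f p).
pose z := \adj B *m c.
have zE l : (z l 0)%:~R = (\det B)%:~R * y 0 (enum_val l) :> rat.
  have e1 : map_mx intr B *m (\col_l y 0 (enum_val l)) = map_mx intr c.
    apply/colP => p; rewrite !mxE.
    have := congr1 (fun u : 'rV_k => u 0 (f p)) yV; rewrite !mxE => <-.
    rewrite (bigID (fun i => i \in I)) /= [X in _ = _ + X]big1 ?addr0; last first.
      by move=> i; rewrite inE negbK => /eqP ->; rewrite mul0r.
    by rewrite [RHS]big_enum_val; apply: eq_bigr => q _; rewrite !mxE mulrC.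
  have := congr1 (mulmx (\adj (map_mx intr B))) e1.
  rewrite mulmxA mul_adj_mx -map_mx_adj -map_mxM /= -/z mul_scalar_mx det_map_mx.
  by move=> /colP /(_ l); rewrite !mxE => <-.
have zle l : (`|z l 0| <= (k`! * a ^ k * bt)%N%:Z).
  (* The index [l] shows that the support is nonempty. The sum over the cofactors has #|I| terms,
     which turns the factorial of the predecessor into that of #|I|. *)
  have rE : (#|I|).-1.+1 = #|I| by rewrite prednK //; case: (#|I|) l => [[]|].
  have -> : z l 0 = \sum_p \adj B l p * c p 0 by rewrite mxE.
  apply: le_trans (ler_norm_sum _ _ _) _.
  apply: (@le_trans _ _ (\sum_(p < #|I|) (((#|I|).-1)`! * a ^ (#|I|).-1 * bt)%N%:Z)).
    apply: ler_sum => p _; rewrite normrM PoszM; apply: ler_pM => //.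
      rewrite mxE normrM normrX normrN1 expr1n mul1r.
      by apply: absz_det_le => i j; rewrite !mxE hV.
    by rewrite mxE.
  rewrite sumr_const card_ord -mulr_natr natz -PoszM lez_nat mulnC !mulnA.
  rewrite -{1}rE -factS rE; apply: leq_mul => //; apply: leq_mul.
    exact: leq_fact.
  by apply: leq_pexp2l => //; apply: leq_trans rk; apply: leq_pred.
pose D := `|\det B|%N.
have hy i : exists m : nat, m%:R = D%:R * y 0 i /\
    (m <= (i \in I) * (k`! * a ^ k * bt))%N.
  have [iI|] := boolP (i \in I); last first.
    by rewrite inE negbK => /eqP ->; exists 0%N; rewrite mulr0.
  exists `|z (enum_rank_in iI i) ord0|%N; rewrite mul1n -lez_nat abszE zle; split => //.
  have := zE (enum_rank_in iI i); rewrite enum_rankK_in // => e.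
  rewrite [LHS]pmulrn abszE [D%:R]pmulrn abszE.
  by rewrite !intr_norm e normrM [`|y 0 i|]ger0_norm.
have [m hm] := fin_all_exists hy.
exists D, m; split.
- rewrite lt0n absz_eq0 Bunit -lez_nat abszE /=.
  apply: le_trans (absz_det_le (a := a) _) _; first by move=> i j; rewrite mxE.
  rewrite lez_nat; apply: leq_mul; first exact: leq_fact.
  exact: leq_pexp2l.
- apply: (@leq_trans (\sum_i (if i \in I then k`! * a ^ k * bt else 0)%N)).
    apply: leq_sum => i _; have [_] := hm i.
    by case: (i \in I); rewrite ?mul1n ?mul0n.
  by rewrite -big_mkcond sum_nat_const leq_mul2r rk orbT.
- move=> j; apply: (@intr_inj rat); rewrite rmorphM /=.
  have := congr1 (fun u : 'rV_k => u 0 j) yV; rewrite !mxE => <-.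
  rewrite mulr_sumr rmorph_sum; apply: eq_bigr => i _.
  by rewrite rmorphM !mxE /= mulrA; congr (_ * _); rewrite -!pmulrn;
    have [-> _] := hm i.
Qed.

End LinearAlgebra.

(** * Short closed walks of nonnegative weight *)

Section Walks.
Variables (S : finType) (E : rel S).

Section Weight.
Variables (k : nat) (w : S -> S -> 'rV[int]_k).

Fixpoint walk_weight (x : S) (p : seq S) : 'rV[int]_k :=
  if p is y :: p' then (w x y + walk_weight y p')%R else 0%R.

Lemma walk_weight_cat x p q :
  (walk_weight x (p ++ q) = walk_weight x p + walk_weight (last x p) q)%R.
Proof. by elim: p x => [|y p IH] x /=; rewrite ?add0r // IH addrA. Qed.

Lemma walk_weight_rcons x p y :
  (walk_weight x (rcons p y) = walk_weight x p + w (last x p) y)%R.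
Proof. by rewrite -cats1 walk_weight_cat /= addr0. Qed.

Lemma walk_weight_le W x p : (forall s s' j, path E s [:: s'] ->
  `|w s s' 0 j| <= W%:Z)%R ->
  path E x p -> forall j, (`|walk_weight x p 0 j| <= (size p * W)%N%:Z)%R.
Proof.
move=> hw; elim: p x => [|y p IH] x /=; first by move=> _ j; rewrite mxE normr0.
move=> /andP[xy yp] j; rewrite mxE mulSn PoszD; apply: le_trans (ler_normD _ _) _.
by apply: lerD; [apply: hw; rewrite /= xy | apply: IH].
Qed.

Definition closed_walk (c : S * seq S) : bool :=
  path E c.1 c.2 && (last c.1 c.2 == c.1).

Definition closed_walk_weight (c : S * seq S) := walk_weight c.1 c.2.

(** Cycles are split off only from the tail after the last first visit, so the remaining walk still
    meets every state: it can later be repeated, and each cycle can be inserted into it any number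
    of times. Between two first visits it is simple, whence at most |S| steps for each state. *)
Lemma walk_decomposition x y p : path E x (y :: p) ->
  exists (a : seq S) (cs : seq (S * seq S)),
    [/\ [/\ a != [::], path E x a, last x a = last y p, x :: a =i x :: y :: p
        & size a <= #|S| * #|S|],
      {in cs, forall c, [/\ closed_walk c, c.1 \in x :: a,
         {subset c.2 <= x :: y :: p} & size c.2 <= #|S|]}
    & (walk_weight x (y :: p) =
        walk_weight x a + \sum_(c <- cs) closed_walk_weight c)%R].
Proof.
(* Invariant: [a] ends with the last first visit of a state, and the walk [b]
   that follows it is simple. *)
move=> xyp; suff: exists (a b : seq S) (cs : seq (S * seq S)),
    [/\ [/\ a != [::], path E x (a ++ b), last x (a ++ b) = last y p
         & x :: a =i x :: y :: p],
      [/\ uniq (last x a :: b), {subset b <= x :: a}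
        & size a + #|S| <= #|S| * #|x :: a| + 1],
      {in cs, forall c, [/\ closed_walk c, c.1 \in x :: a,
         {subset c.2 <= x :: y :: p} & size c.2 <= #|S|]}
    & (walk_weight x (y :: p) =
        walk_weight x (a ++ b) + \sum_(c <- cs) closed_walk_weight c)%R].
  case=> a [b [cs [[a0 pa la sa] [ub sb za] hcs e]]]; exists (a ++ b), cs; split=> //.
    split=> //.
    - by case: (a) a0.
    - move=> z; rewrite -sa -cat_cons mem_cat; case: (boolP (z \in b)) => [/sb ->|];
        by rewrite ?orbF.
    - have := uniq_leq_size ub (fun z _ => mem_enum S z); rewrite -cardT size_cat /=.
      have := max_card (mem (x :: a)); move: za; set n := #|S|; set m := #|_|; nia.
  move=> c /hcs[? ca ? ?]; split=> //; by rewrite -cat_cons mem_cat ca.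
elim/last_ind: p xyp => [|p z IH].
  move=> xy; exists [:: y], [::], [::]; split=> //; last by rewrite big_nil addr0.
  split=> //; have : 0 < #|[:: x; y]|.
    by apply/card_gt0P; exists x; rewrite mem_head.
  by set m := #|_| => ? /=; nia.
rewrite -rcons_cons rcons_path =>
  /andP[/IH[a [b [cs [[a0 pa la sa] [ub sb za] hcs e]]]]].
rewrite -[last x _]la => Ez.
have sS : size b < #|S|.
  by have := uniq_leq_size ub (fun z _ => mem_enum S z); rewrite -cardT.
have ncs (a' : seq S) : {subset x :: a <= x :: a'} -> {in cs, forall c,
   [/\ closed_walk c, c.1 \in x :: a', {subset c.2 <= x :: rcons (y :: p) z} &
     size c.2 <= #|S|]}.
  move=> sa' c /hcs[? ca h ?]; split=> //; first exact: sa'.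
  by move=> t /h; rewrite -!rcons_cons mem_rcons inE => ->; rewrite orbT.
(* A new state: [b] and [z] become part of [a], which grows by at most |S| steps for the state
   gained. *)
have [zn|zn] := boolP (z \in x :: a); last first.
  exists (a ++ rcons b z), [::], cs.
  have mE t : (t \in x :: (a ++ rcons b z)) = (t == z) || (t \in x :: a).
    rewrite -cat_cons mem_cat mem_rcons inE orbCA;
      case: (boolP (t \in b)) => [/sb ->|_].
      by rewrite !orbT.
    by rewrite orbF.
  split.
  - split; first by case: (a) a0.
    + by rewrite cats0 -rcons_cat rcons_path pa.
    + by rewrite cats0 -rcons_cat !last_rcons.
    + by move=> t; rewrite mE sa -rcons_cons mem_rcons.
  - split=> //; rewrite size_cat size_rcons.
    have -> : #|x :: (a ++ rcons b z)| = (#|x :: a|).+1.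
      rewrite -[RHS]add1n -[1]/(nat_of_bool true) -zn -cardU1.
      by apply: eq_card => t; rewrite mE.
    by rewrite mulnS; lia.
  - by apply: ncs => t; rewrite mE => ->; rewrite orbT.
  - by rewrite cats0 -rcons_cat !walk_weight_rcons e la addrAC.
have sE : x :: a =i x :: rcons (y :: p) z.
  move=> t; rewrite -rcons_cons mem_rcons inE -sa; by case: eqP => // ->; rewrite zn.
(* An old state that is not on the tail prolongs it; one on the tail closes a simple cycle, which is
   cut off. *)
have [zb|zb] := boolP (z \in last x a :: b); last first.
  exists a, (rcons b z), cs; split=> //.
  - split=> //; first by rewrite -rcons_cat rcons_path pa.
    by rewrite -rcons_cat !last_rcons.
  - split=> //; first by rewrite -rcons_cons rcons_uniq zb ub.
    by move=> t; rewrite mem_rcons inE => /orP[/eqP->//|/sb].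
  - by apply: ncs.
  - by rewrite -rcons_cat !walk_weight_rcons e la addrAC.
have [b1 [b2 [lz eb]]] : exists b1 b2, last (last x a) b1 = z /\ b = b1 ++ b2.
  by case/splitPl: zb => b1 b2 lz; exists b1, b2.
rewrite eb in ub sb pa la e Ez sS.
have pz : path E z b2 by move: pa; rewrite !cat_path lz => /and3P[].
have lz2 : last z b2 = last y p by rewrite -la !last_cat lz.
exists a, b1, ((z, rcons b2 z) :: cs); split=> //.
- split=> //; first by move: pa; rewrite !cat_path => /and3P[-> ->].
  by rewrite last_cat lz last_rcons.
- split=> //; first by move: ub; rewrite -cat_cons cat_uniq => /andP[].
  by move=> t tb; apply: sb; rewrite mem_cat tb.
- move=> c; rewrite inE => /orP[/eqP->|/(ncs a (fun t h => h))//]; split=> //=.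
  + by rewrite /closed_walk /= rcons_path pz last_rcons eqxx lz2 -la Ez.
  + move=> t; rewrite mem_rcons inE => /orP[/eqP->|tb]; rewrite -sE //.
    by apply: sb; rewrite mem_cat tb orbT.
  + by rewrite size_rcons; apply: leq_ltn_trans sS; rewrite size_cat leq_addl.
- rewrite big_cons walk_weight_rcons e /closed_walk_weight /= walk_weight_rcons.
  by rewrite catA walk_weight_cat last_cat lz lz2 -!addrA; do 2 congr (_ + _)%R;
    rewrite addrC.
Qed.

End Weight.
End Walks.

Section ShortWalks.
Variables (S : finType) (E : rel S) (k : nat) (w : S -> S -> 'rV[int]_k).

Local Notation closed_walk := (closed_walk E).
Local Notation weightc := (closed_walk_weight w).

(** Each closed walk is spliced in at a visit of its first state. All states visited before stay
    visited, so the next closed walk finds its place too. *)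
Lemma insert_closed_walks x p (cs : seq (S * seq S)) : closed_walk (x, p) ->
  {in cs, forall c, closed_walk c /\ c.1 \in x :: p} ->
  exists q, [/\ closed_walk (x, q), {subset p <= q},
    {subset q <= flatten (p :: [seq c.2 | c <- cs])},
    size q = size p + \sum_(c <- cs) size c.2
    & (walk_weight w x q = walk_weight w x p + \sum_(c <- cs) weightc c)%R].
Proof.
elim: cs p => [|c cs IH] p cp hcs.
  exists p; rewrite !big_nil addn0 addr0 /= cats0; split=> //.
have [/andP[pc /eqP lc] cp1] := hcs _ (mem_head _ _).
have [p1 [p2 [l1 ep]]] : exists p1 p2, last x p1 = c.1 /\ p = p1 ++ p2.
  by case/splitPl: cp1 => p1 p2 h; exists p1, p2.
pose p' := p1 ++ c.2 ++ p2.
have sub : {subset p <= p'}.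
  by move=> t; rewrite ep !mem_cat => /orP[] ->; rewrite ?orbT.
have /andP[] := cp; rewrite /= ep cat_path last_cat l1 => /andP[pp1 pp2] lp.
have [||q [cq s1 s2 sz e]] := IH p'.
- by rewrite /closed_walk /= /p' !cat_path !last_cat l1 lc pp1 pc pp2.
- move=> c' h; have [] := hcs c'; first by rewrite inE h orbT.
  by move=> -> ci; split=> //; move: ci; rewrite !inE => /orP[->//|h2];
    rewrite (sub _ h2) orbT.
exists q; split=> //.
- by move=> t tp; apply: s1; apply: sub; rewrite ep.
- by move=> t /s2; rewrite /p' /= !mem_cat -!orbA => /or4P[] ->; rewrite ?orbT.
- by rewrite sz big_cons /p' !size_cat; lia.
- rewrite e big_cons /p' !walk_weight_cat l1 lc {2}/closed_walk_weight -!addrA.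
  by congr (_ + _)%R; rewrite addrCA.
Qed.

(** The first summand counts [D] copies of a walk of at most n * n steps, the second the cycles, of
    at most n steps each. The other factors are the bounds of [small_cone_combination] for
    generators bounded by n * W and a right-hand side bounded by n * n * W. *)
Definition walk_bound (n W : nat) : nat :=
  k`! * (n * W) ^ k * (n * n) + n * (k * (k`! * (n * W) ^ k * (n * n * W))).

(** With the total weight as slack, the decomposition into a walk [a] and cycles is a conic
    equation: the cycles minus the slack give the negative of the weight of [a]. A small solution
    repeats [a] [D] times and inserts the cycles with small multiplicities; the weight of the result
    is the new slack, hence nonnegative. *)
Lemma short_closed_walk W x p : 0 < W ->
  (forall s s' j, E s s' -> (`|w s s' 0 j| <= W%:Z)%R) ->
  p != [::] -> closed_walk (x, p) -> (forall j, (0 <= walk_weight w x p 0 j)%R) ->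
  exists q, [/\ q != [::], closed_walk (x, q), (forall j,
    (0 <= walk_weight w x q 0 j)%R),
    {subset q <= x :: p} & size q <= walk_bound #|S| W].
Proof.
move=> W0 hW; case: p => // y p _ /andP[/= xyp /eqP lp] hp; set n := #|S|.
have [a [cs [[a0 pa la sa za] hcs e]]] := walk_decomposition w (p := p) (y := y) xyp.
rewrite lp in la; pose N := size cs.
have cin (i : 'I_N) : tnth (in_tuple cs) i \in cs by apply: mem_tnth.
have n0 : 0 < n by apply/card_gt0P; exists x.
pose V : 'M[int]_(N + k, k) :=
  col_mx (\matrix_(i < N, j < k) weightc (tnth (in_tuple cs) i) 0%R j) (- 1%:M)%R.
have wle s s' j : path E s [:: s'] -> (`|w s s' 0 j| <= W%:Z)%R.
  by rewrite /= andbT => /hW.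
(* The given solution: every cycle once, and as slack, generated by the last [k] rows of [V], the
   weight of the whole walk. *)
pose xs (i : 'I_(N + k)) : nat :=
  match split i with inl _ => 1 | inr j => `|walk_weight w x (y :: p) 0%R j|%N end.
have [||||D [ys [/andP[D0 hD] hys Dy]]] :=
  @small_cone_combination _ _ V (- walk_weight w x a)%R (n * W) (n * n * W) xs.
- by rewrite muln_gt0 n0.
- move=> i j; rewrite /V mxE; case: splitP => i' _; rewrite !mxE.
    have [/andP[pc _] _ _ sz] := hcs _ (cin i').
    apply: le_trans (walk_weight_le wle pc j) _.
    by rewrite lez_nat leq_mul2r sz orbT.
  rewrite normrN normr_nat; case: eqP => _; rewrite lez_nat //= muln_gt0 n0 //.
- move=> j; rewrite mxE normrN; apply: le_trans (walk_weight_le wle pa j) _.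
  by rewrite lez_nat leq_mul2r za orbT.
- move=> j; rewrite big_split_ord /=.
  under eq_bigr do rewrite /xs (unsplitK (inl _)) mul1r /V col_mxEu mxE.
  under [X in (_ + X)%R]eq_bigr => l _ do
    rewrite /xs (unsplitK (inr _)) gez0_abs // /V col_mxEd !mxE mulrN.
  rewrite sumrN (bigD1 j) //= eqxx mulr1 [X in (_ + - (_ + X))%R]big1 => [|l lj].
    rewrite addr0 mxE -(big_tnth _ _ _ xpredT (fun c => weightc c 0%R j)).
    move: (congr1 (fun u : 'rV_k => u 0%R j) e); rewrite !mxE summxE => ->.
    by rewrite opprD addrCA subrr addr0.
  by rewrite (negPf lj) mulr0.
pose ds := flatten [seq nseq (ys (lshift k i)) (tnth (in_tuple cs) i) | i <- enum 'I_N].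
pose aa := flatten (nseq D a).
have dsin c : c \in ds -> c \in cs.
  by case/flatten_mapP => i _; rewrite mem_nseq => /andP[_ /eqP ->]; apply: cin.
have sumds (A : nmodType) (F : S * seq S -> A) :
    (\sum_(c <- ds) F c = \sum_(i < N) F (tnth (in_tuple cs) i) *+ ys (lshift k i))%R.
  rewrite big_flatten /= big_map big_enum /=; apply: eq_bigr => i _.
  by rewrite big_nseq iter_addr_0.
have [caa saa waa zaa] : [/\ closed_walk (x, aa), aa =i a,
    walk_weight w x aa = (walk_weight w x a *+ D)%R & size aa = D * size a].
  rewrite {sumds ds dsin hys Dy hD} /aa /closed_walk /=;
    elim: D D0 => // -[_|D IH] _ /=.
    by rewrite cats0 pa la eqxx mulr1n mul1n; split=> // t; rewrite cats0.
  have [//|/andP[h1 h2] h3 h4 h5] := IH.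
  rewrite cat_path last_cat walk_weight_cat size_cat la pa h1 h2 h4 h5 -mulrS;
    split=> //.
  by move=> t; rewrite mem_cat h3 orbb.
have [||q [cq s1 s2 sz ew]] := @insert_closed_walks x aa ds => //.
  move=> c /dsin /hcs[? ca _ _]; split=> //; move: ca; by rewrite !inE saa.
exists q; split=> //.
- apply: contraNneq a0 => q0; case: (a) saa => // z a' saa.
  by have := s1 z; rewrite q0 saa mem_head => /(_ isT).
- move=> j; rewrite ew mxE waa sumds summxE.
  move: (Dy j); rewrite big_split_ord /= !mxE mulmxnE mulrN.
  under eq_bigr do rewrite /V col_mxEu mxE.
  under [X in (_ + X)%R]eq_bigr => l _ do rewrite /V col_mxEd !mxE mulrN.
  rewrite sumrN => /eqP; rewrite -subr_eq0 opprK => /eqP eq0.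
  under eq_bigr do rewrite mulmxnE -mulr_natl natz.
  rewrite -mulr_natl natz.
  move: eq0; set s1' := (\sum_(i < N) _)%R; set s2' := (\sum_(i < k) _)%R => eq0.
  have : (0 <= s2')%R by apply: sumr_ge0 => l _; rewrite mulr_ge0 // ler0n.
  move=> s20; suff -> : (D%:Z * walk_weight w x a 0 j + s1' = s2')%R by [].
  by apply/eqP; rewrite -subr_eq0 -eq0 [(_ + s1')%R]addrC addrAC.
- move=> t /s2; rewrite /= mem_cat saa =>
    /orP[h|/flattenP[/= l /mapP[c /dsin /hcs[_ _ sc _] ->] /sc]].
    by rewrite -sa inE h orbT.
  by [].
- rewrite sz zaa sumds /walk_bound; apply: leq_add.
    by apply: leq_mul => //.
  apply: (@leq_trans (\sum_(i < N) n * ys (lshift k i))).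
    apply: leq_sum => i _; have [_ _ _ zc] := hcs _ (cin i).
    by rewrite -mulr_natr natn; apply: leq_mul.
  rewrite -big_distrr leq_mul2l /=; apply/orP; right; apply: leq_trans hys.
  by rewrite big_split_ord leq_addr.
Qed.

End ShortWalks.

(** * Player 1 against positional opponents *)

Section Secured.
Variables (S : finType) (pl X : {set S}) (k : nat) (w : S -> S -> 'rV[int]_k).
Implicit Types (E : rel S) (V : S -> ('I_k -> nat) -> Prop).

Definition reaches V (e : 'I_k -> nat) (s s' : S) : Prop :=
  exists2 e', V s' e' & forall j, ((e' j)%:Z <= (e j)%:Z + w s s' 0 j)%R.

(* V is a set of pairs (s, e) that is contained in its own controllable
   predecessors, with energies bounded by C. *)
Definition postfixed E C V : Prop :=
  forall s e, V s e -> [/\ s \in X, forall j, e j <= C &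
    if s \in pl then exists2 s', E s s' & reaches V e s s'
    else forall s', E s s' -> reaches V e s s'].

Definition secured E C : Prop :=
  exists2 V, postfixed E C V & forall s, s \in X -> exists e, V s e.

(** The constant relations only serve to write the inclusion of sets of successors of [s] with
    [subrel]. *)
Lemma secured_mono E E' C C' : C <= C' ->
  {in X, forall s, s \in pl -> subrel (fun _ : S => E s) (fun _ => E' s)} ->
  {in X, forall s, s \notin pl -> subrel (fun _ : S => E' s) (fun _ => E s)} ->
  secured E C -> secured E' C'.
Proof.
move=> CC EE' E'E [V hV fV]; exists V => // s e /hV[sX eC h]; split=> //.
  by move=> j; apply: leq_trans CC.
case: ifPn h => [sp [s' Ess' r]|sp h s' /(E'E _ sX sp s)]; last exact: h.
by exists s' => //; apply: (EE' _ sX sp s).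
Qed.

(* Player 1 keeps one play for each half of the moves available at [s]: the
   moves of a half advance the corresponding play while the other one waits at
   [s], so that the energies of the two plays add up. *)
Lemma secured_split E (s : S) (A B : pred S) C1 C2 :
  s \in X -> s \notin pl -> (forall t, E s t -> A t || B t) ->
  secured [rel x y | E x y && ((x != s) || A y)] C1 ->
  secured [rel x y | E x y && ((x != s) || B y)] C2 ->
  secured E (C1 + C2).
Proof.
move=> sX sp AB [V1 h1 f1] [V2 h2 f2].
(* A pair of plays, one of which waits at [s]; the state [t] is that of the other one. *)
pose V t e := exists e1 e2, (forall j, e j = e1 j + e2 j) /\
  (V1 t e1 /\ V2 s e2 \/ V1 s e1 /\ V2 t e2).
have r1 e1 e2 e t t' : (forall j, e j = e1 j + e2 j) -> V2 s e2 ->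
    reaches V1 e1 t t' -> reaches V e t t'.
  move=> he v2 [e1' v1 le1]; exists (fun j => e1' j + e2 j).
    by exists e1', e2; split=> //; left.
  by move=> j; have := le1 j; rewrite he; lia.
have r2 e1 e2 e t t' : (forall j, e j = e1 j + e2 j) -> V1 s e1 ->
    reaches V2 e2 t t' -> reaches V e t t'.
  move=> he v1 [e2' v2 le2]; exists (fun j => e1 j + e2' j).
    by exists e1, e2'; split=> //; right.
  by move=> j; have := le2 j; rewrite he; lia.
(* When both plays are at [s], the move of player 2 decides which of them goes on. *)
have both e1 e2 e t : (forall j, e j = e1 j + e2 j) -> V1 s e1 -> V2 s e2 -> E s t ->
    reaches V e s t.
  move=> he v1 v2 Est.
  have /orP[At|Bt] := AB _ Est.
    have [_ _] := h1 _ _ v1; rewrite (negPf sp) => /(_ t).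
    by rewrite /= Est At orbT => /(_ isT); apply: (r1 _ e2).
  have [_ _] := h2 _ _ v2; rewrite (negPf sp) => /(_ t).
  by rewrite /= Est Bt orbT => /(_ isT); apply: r2 v1.
exists V; last first.
  move=> t tX; have [e1 v1] := f1 _ tX; have [e2 v2] := f2 _ sX.
  by exists (fun j => e1 j + e2 j), e1, e2; split=> //; left.
move=> t e [e1 [e2 [he [[v1 v2]|[v1 v2]]]]];
  have [X1 C1j m1] := h1 _ _ v1; have [X2 C2j m2] := h2 _ _ v2; split=> //.
- by move=> j; rewrite he leq_add.
- case: ifPn m1 => [_ [t' /andP[Et _] m1]|tp m1 t' Et].
    by exists t' => //; apply: r1 m1.
  have [ts|ts] := eqVneq t s; last by apply: r1 he v2 (m1 _ _); rewrite /= Et ts.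
  by rewrite ts in v1 Et *; apply: both he v1 v2 _.
- by move=> j; rewrite he leq_add.
- case: ifPn m2 => [_ [t' /andP[Et _] m2]|tp m2 t' Et].
    by exists t' => //; apply: r2 m2.
  have [ts|ts] := eqVneq t s; last by apply: r2 he v1 (m2 _ _); rewrite /= Et ts.
  by rewrite ts in v2 Et *; apply: both he v1 v2 _.
Qed.

Definition positional E (tau : S -> S) : rel S :=
  [rel x y | E x y && ((x \in pl) || (y == tau x))].

(** Splitting a state of player 2 with at least two moves lowers the number of surplus moves in both
    halves and doubles the constant; induction on that number gives the power of 2. *)
Lemma secured_positional E C :
  {in X, forall s, s \notin pl -> exists s', E s s'} ->
  (forall tau : S -> S, {in X, forall s, s \notin pl -> E s (tau s)} ->
     secured (positional E tau) C) ->
  secured E (2 ^ (\sum_(s in X :\: pl) (#|E s|.-1)) * C).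
Proof.
have [N] := ubnP (\sum_(s in X :\: pl) (#|E s|.-1)).
elim: N E => // N IH E; rewrite ltnS => hN tot H.
have card0 s : s \in X -> s \notin pl -> 0 < #|E s|.
  by move=> sX sp; have [s' h] := tot _ sX sp; apply/card_gt0P; exists s'.
case: (pickP [pred s | (s \in X :\: pl) && (1 < #|E s|)]) => [s /andP[]|none].
  rewrite inE => /andP[sp sX] c1.
  have [t Est] := tot _ sX sp.
  (* In one half player 2 never plays [t] at [s], in the other half always. *)
  pose EA := [rel x y | E x y && ((x != s) || (y != t))].
  pose EB := [rel x y | E x y && ((x != s) || (y == t))].
  have cA : #|E s| = #|EA s|.+1.
    rewrite (cardD1 t) -topredE /= Est add1n; congr _.+1; apply: eq_card => y.
    by rewrite !inE /= eqxx /= andbC.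
  have cB : #|EB s| = 1.
    rewrite -(card1 t); apply: eq_card => y; rewrite !inE /= eqxx /=.
    by case: eqP => [->|]; rewrite ?andbF // [E s t]Est.
  have cne x : x != s -> #|EA x| = #|E x| /\ #|EB x| = #|E x|.
    by move=> xs; split; apply: eq_card => y; rewrite -!topredE /= xs andbT.
  have split_sum (F : rel S) : (forall x, x != s -> #|F x| = #|E x|) ->
     \sum_(x in X :\: pl) #|F x|.-1 = #|F s|.-1 + \sum_(x in X :\: pl | x != s) #|E
       x|.-1.
    move=> hF; rewrite (bigD1 s) /=; last by rewrite inE sp.
    by congr addn; apply: eq_bigr => x /andP[_ /hF ->].
  have sE := split_sum E (fun _ _ => erefl).
  have sA := split_sum EA (fun x h => (cne x h).1).
  have sB := split_sum EB (fun x h => (cne x h).2).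
  set M := (\sum_(x in _) #|E x|.-1) in sE hN *.
  have step (F : rel S) : (forall x y, F x y -> E x y) ->
     (forall x y, x != s -> F x y = E x y) ->
     \sum_(x in X :\: pl) #|F x|.-1 < M -> (exists y, F s y) ->
       secured F (2 ^ M.-1 * C).
    move=> FE FE' lt [y0 Fy].
    have : secured F (2 ^ (\sum_(x in X :\: pl) #|F x|.-1) * C).
      apply: IH.
      - exact: leq_trans hN.
      - move=> x xX xp; have [->|xs] := eqVneq x s; first by exists y0.
        by have [x' Ex] := tot _ xX xp; exists x'; rewrite FE'.
      - move=> tau htau.
        have htau' : {in X, forall s, s \notin pl -> E s (tau s)}.
          by move=> x xX xp; apply: FE; apply: htau.
        apply: secured_mono (H tau htau') => // x xX xp _ y /=.
          rewrite /positional /= xp /= !andbT FE' //.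
          by apply: contraNneq sp => <-.
        by rewrite /positional /= => /andP[/FE ->].
    apply: secured_mono => [|x _ _ y z //|x _ _ y z //].
    rewrite leq_mul2r leq_pexp2l ?orbT // -ltnS prednK //.
    exact: leq_ltn_trans lt.
  have eM : 2 ^ M * C = 2 ^ M.-1 * C + 2 ^ M.-1 * C.
    by rewrite -mulnDl addnn -mul2n -expnS prednK // sE; lia.
  rewrite eM; apply: (@secured_split E s (fun y => y != t) (fun y => y == t)) => //.
  - by move=> y _; case: eqP.
  - apply: step.
    + by move=> x y /andP[].
    + by move=> x y xs /=; rewrite xs andbT.
    + by rewrite sA sE ltn_add2r cA ltn_predL -ltnS -cA.
    + have /card_gt0P[y] : 0 < #|EA s| by rewrite -ltnS -cA.
      by exists y.
  - apply: step.
    + by move=> x y /andP[].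
    + by move=> x y xs /=; rewrite xs andbT.
    + by rewrite sB sE ltn_add2r cB ltn_predRL.
    + by exists t; rewrite /= Est !eqxx orbT.
(* No choice is left to player 2 on [X], so the game agrees there with the one restricted to
   [tau]. *)
have c1 s : s \in X -> s \notin pl -> #|E s| = 1.
  move=> sX sp; apply/eqP; rewrite eqn_leq card0 // andbT leqNgt.
  by have := none s; rewrite /= !inE sX sp /= => ->.
rewrite big1 => [|s]; last by rewrite inE => /andP[sp sX]; rewrite c1.
rewrite mul1n; pose tau s := odflt s [pick y | E s y].
have tauP s : s \in X -> s \notin pl -> E s (tau s).
  move=> sX sp; rewrite /tau; case: pickP => //= no.
  by have [s'] := tot _ sX sp; rewrite no.
apply: secured_mono (H tau tauP) => // s sX sp _ y /=.
  by rewrite /positional /= => /andP[].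
move=> Esy; rewrite /positional /= Esy (negPf sp) /=.
have /card_le1P/(_ (tau s) (tauP _ sX sp)) : #|E s| <= 1 by rewrite c1.
by move=> /(_ y); rewrite !inE => <-.
Qed.

End Secured.

Section Lassos.
Variables (S : finType) (pl X : {set S}) (k : nat) (w : S -> S -> 'rV[int]_k).

Definition lasso (E : rel S) D s := exists p c : seq S,
  [/\ path E s p, closed_walk E (last s p, c) /\ c != [::],
      (forall j, (0 <= walk_weight w (last s p) c 0 j)%R),
      {subset s :: p ++ c <= X} & size p + size c <= D].

(** Started with D * W, the energy along a lasso stays between 0 and twice that value, and a turn of
    the cycle does not lower it. Since player 2 has no choice, player 1 can stay on the lasso
    selected at the start. *)
Lemma secured_lassos (E : rel S) W D (tau : S -> S) :
  (forall s s' j, E s s' -> (`|w s s' 0 j| <= W%:Z)%R) ->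
  (forall s s', s \notin pl -> E s s' -> s' = tau s) ->
  {in X, forall s, lasso E D s} -> secured pl X w E (2 * (D * W)).
Proof.
move=> hw det H.
pose en s q (j : 'I_k) := `|((D * W)%:Z + walk_weight w s q 0 j)%R|%N.
pose V t e := exists s p c i, [/\ [/\ path E s p, closed_walk E (last s p, c) &
  c != [::]],
      (forall j, (0 <= walk_weight w (last s p) c 0 j)%R),
      [/\ {subset s :: p ++ c <= X}, size p + size c <= D &
        i < size (p ++ c)], t = nth s (s :: p ++ c) i & e = en s (take i (p ++ c))].
exists V; last first.
  move=> s sX; have [p [c [pp [cc c0] wc pcX sz]]] := H _ sX.
  exists (en s (take 0 (p ++ c))), s, p, c, 0; split=> //.
  by split=> //; rewrite size_cat; case: (c) c0 => // ? ? _; rewrite /= addnS.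
move=> t e [s [p [c [i [[pp cc c0] wc [pcX sz hi] et ->]]]]].
set q := p ++ c in pcX hi et *.
have pq : path E s q.
  by move: cc; rewrite /q cat_path pp => /andP[/= ->].
have hw' s1 s2 j : path E s1 [:: s2] -> (`|w s1 s2 0 j| <= W%:Z)%R.
  by rewrite /= andbT; apply: hw.
have enE l j : Posz (en s (take l q) j) = ((D * W)%:Z + walk_weight w s (take l q) 0
  j)%R
     /\ en s (take l q) j <= 2 * (D * W).
  have := walk_weight_le hw' (@take_path _ _ _ _ l pq) j.
  have : size (take l q) * W <= D * W.
    rewrite leq_mul2r; apply/orP; right; apply: leq_trans sz.
    by rewrite size_take_min -size_cat geq_minr.
  rewrite /en; move: (walk_weight _ _ _ _ _) (size _ * W) (D * W) => z m d; lia.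
have tX : t \in X by apply: pcX; rewrite et; apply: mem_nth; rewrite /= ltnS ltnW.
have Et : E t (nth s q i) by rewrite et; apply: (pathP s pq).
have wt j : (walk_weight w s (take i.+1 q) 0 j =
             walk_weight w s (take i q) 0 j + w t (nth s q i) 0 j)%R.
  rewrite (take_nth s) // walk_weight_rcons mxE et; congr (_ + w _ _ _ _)%R.
  by rewrite (last_nth s) size_takel ?(ltnW hi) // -[s :: take i q]/(take i.+1 (s ::
    q)) nth_take.
have r : reaches w V (en s (take i q)) t (nth s q i).
  have [hi'|hi'] := ltnP i.+1 (size q).
    exists (en s (take i.+1 q)) => [|j]; last by rewrite !(enE _ _).1 wt addrA.
    by exists s, p, c, i.+1; do 2 split=> //.
  (* At its end the lasso returns to position [size p], whose energy is at most the one just reached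
     because the cycle has nonnegative weight. *)
  have ei : i.+1 = size q by apply/eqP; rewrite eqn_leq hi hi'.
  have lq : last s q = last s p by move: cc => /andP[_ /eqP]; rewrite /q last_cat.
  exists (en s (take (size p) q)) => [|j].
    exists s, p, c, (size p); split=> //.
      by split=> //; rewrite size_cat; case: (c) c0 => // ? ? _;
        rewrite /= addnS ltnS leq_addr.
    rewrite -[RHS](@nth_take (size p).+1) //= take_size_cat //.
    by rewrite -last_nth -lq -nth_last -ei.
  rewrite !(enE _ _).1 -addrA lerD2l -wt ei take_size take_size_cat // /q.
  by rewrite walk_weight_cat mxE lerDl.
split=> //; first by move=> j; have [] := enE i j.
case: ifPn => tp; first by exists (nth s q i).
by move=> s' /(det _ _ tp) ->; rewrite -(det _ _ tp Et).
Qed.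

End Lassos.

(** * Loops in infinite plays *)

Lemma increasing_le (g : nat -> nat) : (forall n, g n < g n.+1) ->
  forall i j, i < j -> g i < g j.
Proof.
move=> hg; apply: (@homo_ltn nat g (fun m n : nat => m < n)) => // y x z.
exact: ltn_trans.
Qed.

Lemma nondecreasing_subsequence (f : nat -> nat) :
  exists2 g : nat -> nat, (forall n, g n < g n.+1) &
    forall i j, i <= j -> f (g i) <= f (g j).
Proof.
have amin N : exists m, N <= m /\ forall m', N <= m' -> f m <= f m'.
  have ex : exists v, `[< exists2 m, N <= m & f m = v >] by exists (f N);
    apply/asboolP; exists N.
  case: (ex_minnP ex) => v /asboolP[m Nm fm] hv; exists m; split=> // m' Nm'.
  by rewrite fm; apply: hv; apply/asboolP; exists m'.
(* [nx N] is a position of the minimum of [f] over all positions from [N] on. *)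
pose nx N := projT1 (cid (amin N)).
have nxP N : N <= nx N /\ forall m', N <= m' -> f (nx N) <= f m' by rewrite /nx;
  case: cid.
pose g n := iter n (fun m => nx m.+1) (nx 0).
have g1 n : g n < g n.+1 by apply: (nxP (g n).+1).1.
exists g => //; apply: (@homo_leq nat (fun n => f (g n)) (fun m n : nat =>
  m <= n)) => [//|y x z|n].
  exact: leq_trans.
have [M hM] : exists M, g n = nx M by case: n => [|n]; [exists 0 | exists (g n).+1].
rewrite {1}hM; apply: (nxP M).2; apply: leq_trans (ltnW (g1 n)).
by rewrite hM; apply: (nxP M).1.
Qed.

(** The subsequence is refined for one coordinate after the other; coordinates that are already
    nondecreasing remain so. *)
Lemma dickson (k : nat) (f : nat -> 'I_k -> nat) :
  exists i j, i < j /\ forall l, f i l <= f j l.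
Proof.
suff H (s : seq 'I_k) : exists2 g : nat -> nat, (forall n, g n < g n.+1) &
    {in s, forall l i j, i <= j -> f (g i) l <= f (g j) l}.
  have [g g1 hg] := H (enum 'I_k); exists (g 0), (g 1); split=> // l.
  by apply: hg; rewrite ?mem_enum.
elim: s => [|l s [g g1 hg]]; first by exists id.
have [h h1 hh] := nondecreasing_subsequence (fun n => f (g n) l).
exists (g \o h) => [n|l']; first by apply: (increasing_le g1); apply: h1.
rewrite inE => /orP[/eqP->|ls] i j ij; first exact: hh.
apply: (hg l' ls (h i) (h j)); move: ij; rewrite leq_eqVlt => /orP[/eqP->//|].
by move=> /(increasing_le h1) /ltnW.
Qed.

Section Loops.
Variables (S : finType) (E : rel S) (k : nat) (w : S -> S -> 'rV[int]_k).
Variable prio : S -> nat.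

(** The loop begins at its least priority, so that the gain for it precedes all losses for odd
    priorities on the loop. *)
Definition even_loop (pi : nat -> S) (n : nat) : Prop := exists i j,
  [/\ n <= i < j, pi i = pi j,
      (forall l, (0 <= (\sum_(i <= t < j) w (pi t) (pi t.+1)) 0 l)%R),
      ~~ odd (prio (pi i)) & forall t, i <= t <= j -> prio (pi i) <= prio (pi t)].

Lemma recurrent_state (pi : nat -> S) (P : S -> Prop) :
  (forall N, exists2 n, N <= n & P (pi n)) ->
  exists s, P s /\ forall N, exists2 n, N <= n & pi n = s.
Proof.
move=> H; apply: contrapT => no.
have hN s : exists N, P s -> forall n, N <= n -> pi n <> s.
  have [Ps|nP] := pselect (P s); last by exists 0.
  apply: contrapT => nN; apply: no; exists s; split=> // N.
  apply: contrapT => nn; apply: nN; exists N => _ n Nn e; apply: nn; by exists n.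
have [N hN'] := fin_all_exists hN.
have [n Mn Pn] := H (\max_s N s).
apply: (hN' (pi n) Pn n) => //; apply: leq_trans Mn; exact: leq_bigmax.
Qed.

Lemma eventually_avoids (pi : nat -> S) (P : S -> Prop) :
  (forall s, P s -> exists N, forall n, N <= n -> pi n <> s) ->
  exists N, forall n, N <= n -> ~ P (pi n).
Proof.
move=> H; have hN s : exists N, P s -> forall n, N <= n -> pi n <> s.
  by have [/H[N hN]|nP] := pselect (P s); [exists N | exists 0].
have [N hN'] := fin_all_exists hN.
exists (\max_s N s) => n hn Pn; apply: (hN' (pi n) Pn n) => //.
by apply: leq_trans hn; apply: leq_bigmax.
Qed.

(** Past the last priority below [q], one state of priority [q] is visited infinitely often. Two of
    these visits have ordered energy vectors by [dickson], and the stretch between them is the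
    loop. *)
Lemma energy_even_loop (pi : nat -> S) (v0 : 'rV[nat]_k) (q n0 : nat) :
  (forall n l, (0 <= (v0 0 l)%:Z + (\sum_(0 <= t < n) w (pi t) (pi t.+1)) 0 l)%R) ->
  ~~ odd q -> (forall N, exists2 n, N <= n & prio (pi n) = q) ->
  (forall q', (forall N, exists2 n, N <= n & prio (pi n) = q') -> q <= q') ->
  even_loop pi n0.
Proof.
move=> safe evq infq minq.
have [s [ps infs]] := @recurrent_state pi (fun s => prio s = q) infq.
have [N hN] : exists N, forall n, N <= n -> ~ prio (pi n) < q.
  apply: (@eventually_avoids pi (fun s => prio s < q)) => s' lt.
  apply: contrapT => nN; have : q <= prio s'; last by rewrite leqNgt lt.
  apply: minq => M; apply: contrapT => nn; apply: nN; exists M => n Mn e.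
  by apply: nn; exists n; rewrite ?e.
have hnx M : exists n, M <= n /\ pi n = s by have [n ? ?] := infs M; exists n.
pose nx M := projT1 (cid (hnx M)).
have nxP M : M <= nx M /\ pi (nx M) = s by rewrite /nx; case: cid.
pose g n := iter n (fun m => nx m.+1) (nx (maxn n0 N)).
have g1 n : g n < g n.+1 by apply: (nxP (g n).+1).1.
have gs n : pi (g n) = s by case: n => [|n]; apply: (nxP _).2.
have g0 n : maxn n0 N <= g n.
  by elim: n => [|n IH]; [apply: (nxP _).1 | apply: leq_trans IH (ltnW (g1 n))].
pose en n (l : 'I_k) :=
  `|((v0 0 l)%:Z + (\sum_(0 <= t < g n) w (pi t) (pi t.+1)) 0 l)%R|%N.
have [i [j [ij hij]]] := dickson en.
exists (g i), (g j); split=> //.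
- by rewrite increasing_le // andbT; apply: leq_trans (g0 i); rewrite leq_maxl.
- by rewrite !gs.
- move=> l; have := hij l; rewrite -lez_nat /en !gez0_abs // lerD2l.
  by rewrite (big_cat_nat (n := g i) (p :=
    g j)) //= ?mxE ?lerDl // ltnW // increasing_le.
- by rewrite gs ps.
- move=> t /andP[it _]; rewrite gs ps leqNgt; apply/negP; apply: hN.
  by apply: leq_trans it; apply: leq_trans (g0 i); rewrite leq_maxr.
Qed.

Lemma walk_of_play (pi : nat -> S) i m : (forall n, E (pi n) (pi n.+1)) ->
  let p := [seq pi t | t <- iota i.+1 m] in
  [/\ path E (pi i) p, last (pi i) p = pi (i + m) &
      walk_weight w (pi i) p = (\sum_(i <= t < i + m) w (pi t) (pi t.+1))%R].
Proof.
move=> hE /=; elim: m i => [|m IH] i /=; first by rewrite addn0 big_geq.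
have [pp lp wp] := IH i.+1; rewrite hE pp lp wp addSnnS; split=> //.
by rewrite [RHS]big_ltn // addnS ltnS leq_addr.
Qed.

Variable X : {set S}.

Definition even_lasso D s := exists p c : seq S,
  [/\ path E s p, closed_walk E (last s p, c) /\ c != [::],
      (forall j, (0 <= walk_weight w (last s p) c 0 j)%R),
      {subset s :: p ++ c <= X} /\ (size p < #|S|) && (size c <= D) &
      ~~ odd (prio (last s p)) /\
      {in c, forall y, prio (last s p) <= prio y}].

(** Only the cycle carries a condition on weights, so the stem can be made simple without regard to
    its weight. The shortened cycle keeps its start and runs through states of the old one, hence
    keeps its least priority. *)
Lemma short_even_lasso (pi : nat -> S) W : 0 < W ->
  (forall s s' j, E s s' -> (`|w s s' 0 j| <= W%:Z)%R) ->
  (forall n, E (pi n) (pi n.+1)) -> (forall n, pi n \in X) ->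
  even_loop pi 0 -> even_lasso (walk_bound k #|S| W) (pi 0).
Proof.
move=> W0 hW hE hX [i [j [/andP[_ ij] eij w0 ev mi]]].
have [pp lp _] := walk_of_play 0 i hE.
have [pc lc wc] := walk_of_play i (j - i) hE.
rewrite subnKC 1?ltnW // in lc wc; rewrite add0n in lp.
set p := [seq pi t | t <- iota 1 i] in pp lp.
set c := [seq pi t | t <- iota i.+1 (j - i)] in pc lc wc.
have [|||c' [c'0 cc' wc' sc' zc']] := @short_closed_walk S E k w W (pi i) c W0 hW.
- by rewrite /c; case: (j - i) (subn_gt0 i j) => //; rewrite ij.
- by rewrite /closed_walk /= pc lc eij eqxx.
- by rewrite wc.
have cX : {in pi i :: c, forall y, y \in X /\ prio (pi i) <= prio y}.
  move=> y; rewrite inE => /orP[/eqP->|/mapP[t]]; first by split.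
  rewrite mem_iota => /andP[ti tj] ->; split=> //; apply: mi.
  by rewrite (ltnW ti) /=; move: tj; rewrite addSn subnKC // ltnW.
move: lp; case/shortenP: pp => p' pp' up' sp' lp'.
exists p', c'; rewrite lp'; split=> //.
- split.
    move=> y; rewrite -cat_cons mem_cat inE -orbA =>
      /or3P[/eqP->//|/sp'/mapP[t _ ->]//|/sc' /cX []//].
  rewrite zc' andbT -/(size (pi 0 :: p')).
  by have := uniq_leq_size up' (fun z _ => mem_enum S z); rewrite -cardT.
- by split=> // y /sc' /cX[].
Qed.

End Loops.

(** * Parity as energy *)

Section ParityWeights.
Variables (S : finType) (k : nat) (w : S -> S -> 'rV[int]_k) (prio : S -> nat).
Variables (l : nat) (qs : seq nat).

Definition parity_row (s : S) : 'rV[int]_(size qs) :=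
  (\row_j (parity_weight l (prio s) (nth 0 qs j)).1)%R.

Definition parity_ext (s s' : S) : 'rV[int]_(k + size qs) :=
  row_mx (w s s') (parity_row s).

Lemma walk_weight_row_mx x p : walk_weight parity_ext x p =
  row_mx (walk_weight w x p) (walk_weight (fun s _ => parity_row s) x p).
Proof.
by elim: p x => [|y p IH] x /=; rewrite ?row_mx0 // IH add_row_mx.
Qed.

Lemma parity_row_geN1 s j : (-1 <= parity_row s 0 j)%R.
Proof. by rewrite mxE /=; case: eqP => // _; case: ifP. Qed.

Lemma walk_parity_row_ge x p j :
  (- (size p)%:Z <= walk_weight (fun s _ => parity_row s) x p 0 j)%R.
Proof.
elim: p x => [|y p IH] x /=; first by rewrite mxE.
rewrite mxE -addn1 PoszD opprD addrC; by apply: lerD;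
  [exact: IH|exact: parity_row_geN1].
Qed.

Lemma walk_parity_row_ge0 x p (j : 'I_(size qs)) : {in x :: p, forall y,
  nth 0 qs j < prio y} ->
  (0 <= walk_weight (fun s _ => parity_row s) x p 0 j)%R.
Proof.
elim: p x => [|y p IH] x /= h; first by rewrite mxE.
rewrite mxE; apply: addr_ge0; last by apply: IH => z zp; apply: h; rewrite inE zp orbT.
by have lt := h x (mem_head _ _); rewrite mxE /= (gtn_eqF lt) leqNgt lt.
Qed.

Lemma parity_cycle_ge0 x c (j : 'I_(size qs)) : all odd qs -> c != [::] ->
  size c <= l ->
  ~~ odd (prio x) -> {in c, forall y, prio x <= prio y} ->
  (0 <= walk_weight (fun s _ => parity_row s) x c 0 j)%R.
Proof.
move=> oq c0 cl ev hc; have oj : odd (nth 0 qs j) by apply: (allP oq); rewrite mem_nth.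
have [lt|] := ltnP (nth 0 qs j) (prio x).
  apply: walk_parity_row_ge0 => y; rewrite inE => /orP[/eqP->//|/hc]; exact: leq_trans.
rewrite leq_eqVlt => /orP[/eqP e|lt]; first by rewrite e oj in ev.
case: c c0 cl hc => // y c _ /= cl _.
rewrite mxE {1}mxE /= ltn_eqF // (ltnW lt) ev /=.
by have := walk_parity_row_ge y c j; move: (walk_weight _ _ _ _ _); lia.
Qed.

End ParityWeights.

Section Completeness.
Variables (S : finType) (E : rel S) (pl X : {set S}) (k : nat).
Variables (w : S -> S -> 'rV[int]_k) (prio : S -> nat).

Lemma secured_parity (W W' l : nat) (qs : seq nat) : 0 < W -> all odd qs ->
  (forall s s' j, E s s' -> (`|w s s' 0 j| <= W%:Z)%R) ->
  (forall s s' j, E s s' -> (`|parity_ext w prio l qs s s' 0 j| <= W'%:Z)%R) ->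
  walk_bound k #|S| W <= l ->
  {in X, forall s, s \notin pl -> exists s', E s s'} ->
  (forall tau : S -> S, {in X, forall s, s \notin pl -> E s (tau s)} ->
     {in X, forall s, exists pi : nat -> S, [/\ pi 0 = s,
       forall n, positional pl E tau (pi n) (pi n.+1), forall n, pi n \in X
       & even_loop w prio pi 0]}) ->
  secured pl X (parity_ext w prio l qs) E
    (2 ^ (\sum_(s in X :\: pl) (#|E s|.-1)) * (2 * ((#|S| + walk_bound k #|S| W) *
      W'))).
Proof.
move=> W0 oq hW hW' hl tot H; apply: secured_positional => // tau htau.
have sub s s' : positional pl E tau s s' -> E s s' by case/andP.
apply: (@secured_lassos S pl X _ _ _ _ _ tau).
- by move=> s s' j /sub; apply: hW'.
- by move=> s s' sp /andP[_]; rewrite (negPf sp) /= => /eqP.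
move=> s sX; have [pi [<- hE hX lp]] := H _ htau _ sX.
have hWp s1 s2 j : positional pl E tau s1 s2 -> (`|w s1 s2 0 j| <= W%:Z)%R.
  by move/sub; apply: hW.
have [p [c [pp [cc c0] wc [pcX /andP[sp sc]] [ev hc]]]] :=
  short_even_lasso W0 hWp hE hX lp.
exists p, c; split=> //; last by rewrite leq_add // ltnW.
move=> j; rewrite walk_weight_row_mx mxE; case: splitP => j' _; first exact: wc.
by apply: parity_cycle_ge0 => //; apply: leq_trans hl.
Qed.

End Completeness.

(** * Values computed by the algorithm *)

(* The suffix 1 marks the value of a timed function. *)
Lemma bind1 (A B : Type) (m : timed A) (f : A -> timed B) : (bind m f).1 = (f m.1).1.
Proof. by []. Qed.

Section TimedLists.
Variables A B D : Type.

Lemma mapM1 (f : A -> timed B) s : (mapM f s).1 = [seq (f x).1 | x <- s].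
Proof. by elim: s => //= x s ->. Qed.

Lemma zipM1 (f : A -> B -> timed D) u v :
  (zipM f u v).1 = [seq (f p.1 p.2).1 | p <- zip u v].
Proof. by elim: u v => [|x u IH] [|y v] //=; rewrite IH. Qed.

Lemma filterM1 (p : A -> timed bool) s : (filterM p s).1 = [seq x <- s | (p x).1].
Proof. by elim: s => //= x s ->. Qed.

Lemma findM1 (p : A -> timed bool) s :
  (findM p s).1 = ohead [seq x <- s | (p x).1].
Proof. by elim: s => //= x s IH; case: (p x).1. Qed.

Lemma foldM1 (f : B -> A -> timed B) b s :
  (foldM f b s).1 = foldl (fun b x => (f b x).1) b s.
Proof. by elim: s b => //= x s IH b; rewrite IH. Qed.

Lemma hasM1 (p : A -> timed bool) s : (hasM p s).1 = has (fun x => (p x).1) s.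
Proof. by rewrite /= findM1; elim: s => //= x s IH; case: (p x).1. Qed.

Lemma allM1 (p : A -> timed bool) s : (allM p s).1 = all (fun x => (p x).1) s.
Proof. by rewrite /allM /negM [_.1]/= findM1; elim: s => //= x s IH; case: (p x).1. Qed.

End TimedLists.

Lemma vall21 (A B : Type) (r : A -> B -> timed bool) u v :
  (vall2 r u v).1 = all (fun p => (r p.1 p.2).1) (zip u v).
Proof. by rewrite -[LHS]/(allM (fun b =>
  ret b) (zipM r u v).1).1 allM1 zipM1 all_map. Qed.

Definition leqv (u v : seq nat) : bool := all (fun p => p.1 <= p.2) (zip u v).

Lemma vleq1 u v : (vleq u v).1 = leqv u v.
Proof. exact: vall21. Qed.

Lemma all_zipP (A B : Type) (a : A) (b : B) (r : A * B -> bool) k u v :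
  size u = k -> size v = k ->
  reflect (forall i, i < k -> r (nth a u i, nth b v i)) (all r (zip u v)).
Proof.
move=> su sv; have sz : size u = size v by rewrite su.
apply: (iffP (all_nthP (a, b))); rewrite size_zip su sv minnn => h i ik.
  by rewrite -nth_zip //; apply: h.
by rewrite nth_zip //; apply: h.
Qed.

Lemma leqvP k u v : size u = k -> size v = k ->
  reflect (forall i, i < k -> nth 0 u i <= nth 0 v i) (leqv u v).
Proof. exact: all_zipP. Qed.

Lemma eq_vec (k : nat) (u v : seq nat) : size u = k -> size v = k ->
  (forall i, i < k -> nth 0 u i = nth 0 v i) -> u = v.
Proof. by move=> su sv h; apply: (@eq_from_nth _ 0); rewrite su ?sv. Qed.

Lemma veq1 (u v : seq nat) : size u = size v -> (veq u v).1 = (u == v).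
Proof.
move=> sz; rewrite /veq vall21; apply/(all_zipP 0 0 _ sz erefl)/eqP => [h|-> i _] //=.
by apply: eq_vec sz erefl _ => i /h /eqP.
Qed.

Lemma leqv_refl u : leqv u u.
Proof. by apply/(leqvP (k := size u)). Qed.

Lemma leqv_trans u v t : size u = size v -> size v = size t ->
  leqv u v -> leqv v t -> leqv u t.
Proof.
move=> s1 s2 /(leqvP s1 erefl) h1 /(leqvP erefl (esym s2)) h2.
by apply/(leqvP s1 (esym s2)) => i ik; apply: leq_trans (h1 i ik) (h2 i ik).
Qed.

Lemma leqv_anti u v : size u = size v -> leqv u v -> leqv v u -> u = v.
Proof.
move=> s /(leqvP s erefl) h1 /(leqvP erefl s) h2; apply: eq_vec s erefl _ => i ik.
by apply/eqP; rewrite eqn_leq h1 ?h2.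
Qed.

Lemma vmax1 u v : (vmax u v).1 = [seq maxn p.1 p.2 | p <- zip u v].
Proof. exact: zipM1. Qed.

Lemma leqv_max u v t : size u = size t -> size v = size t ->
  leqv (vmax u v).1 t = leqv u t && leqv v t.
Proof.
move=> su sv; have s : size (vmax u v).1 = size t.
  by rewrite vmax1 size_map size_zip su sv minnn.
have nm i : i < size t -> nth 0 (vmax u v).1 i = maxn (nth 0 u i) (nth 0 v i).
  move=> it; rewrite vmax1 (nth_map (0, 0)) ?nth_zip ?su ?sv //=.
  by rewrite size_zip su sv minnn.
apply/(leqvP s erefl)/andP => [h|[/(leqvP su erefl) h1 /(leqvP sv erefl) h2] i it].
  by split; [apply/(leqvP su erefl)|apply/(leqvP sv erefl)] => i it; have := h i it;
    rewrite nm // geq_max => /andP[].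
by rewrite nm // geq_max h1 ?h2.
Qed.

Definition affords (e' e : seq nat) (w : seq int) : bool :=
  all (fun p => Posz p.1 <= p.2)%R
    (zip e' [seq (Posz p.1 + p.2)%R | p <- zip e w]).

Lemma affordable1 e' e w : (affordable e' e w).1 = affords e' e w.
Proof.
rewrite -[LHS]/(vall2 _ _ (zipM (fun x y => zadd (Posz x) y) e w).1).1.
by rewrite vall21 zipM1.
Qed.

Lemma affordsP k e' e w : size e' = k -> size e = k -> size w = k ->
  reflect (forall i, (i < k)%N ->
    Posz (nth 0%N e' i) <= Posz (nth 0%N e i) + nth 0 w i)%R
    (affords e' e w).
Proof.
move=> s1 s2 s3; have s : size [seq (Posz p.1 + p.2)%R | p <- zip e w] = k.
  by rewrite size_map size_zip s2 s3 minnn.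
have nm i : i < k -> nth 0%R [seq (Posz p.1 + p.2)%R | p <- zip e w] i =
    (Posz (nth 0%N e i) + nth 0 w i)%R.
  move=> ik; rewrite (nth_map (0, 0%R)) ?nth_zip ?s2 ?s3 //.
  by rewrite size_zip s2 s3 minnn.
by apply: (iffP (all_zipP 0 0%R _ s1 s)) => h i ik; have := h i ik; rewrite /= nm.
Qed.

Lemma affords_trans k e1 e2 e3 e4 w : size e1 = k -> size e2 = k -> size e3 = k ->
  size e4 = k -> size w = k ->
  leqv e1 e2 -> affords e2 e3 w -> leqv e3 e4 -> affords e1 e4 w.
Proof.
move=> s1 s2 s3 s4 sw /(leqvP s1 s2) h1 /(affordsP s2 s3 sw) h2 /(leqvP s3 s4) h3.
apply/(affordsP s1 s4 sw) => i ik; move: (h1 i ik) (h2 i ik) (h3 i ik); lia.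
Qed.

Lemma least_before1 e' w : (least_before e' w).1 =
  [seq `|Num.max 0%R (Posz p.1 - p.2)%R|%N | p <- zip e' w].
Proof. exact: zipM1. Qed.

Lemma size_least_before k e' w : size e' = k -> size w = k ->
  size (least_before e' w).1 = k.
Proof. by move=> s1 s2; rewrite least_before1 size_map size_zip s1 s2 minnn. Qed.

Lemma least_before_le k e' e w : size e' = k -> size e = k -> size w = k ->
  leqv (least_before e' w).1 e = affords e' e w.
Proof.
move=> s1 s2 s3; have s := size_least_before s1 s3.
have nm i : i < k -> nth 0 (least_before e' w).1 i =
    `|Num.max 0%R (Posz (nth 0%N e' i) - nth 0 w i)%R|%N.
  move=> ik; rewrite least_before1 (nth_map (0, 0%R)) ?nth_zip ?s1 ?s3 //.
  by rewrite size_zip s1 s3 minnn.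
apply/(leqvP s s2)/(affordsP s1 s2 s3) => h i ik; have := h i ik; rewrite nm //; lia.
Qed.

(** * Antichains of vectors and their upward closures *)

Section Minimal.
Variable k : nat.
Implicit Types X Y : seq (seq nat).

Definition sized X := all (fun x => size x == k) X.

Lemma sizedP X x : sized X -> x \in X -> size x = k.
Proof. by move=> /allP h /h /eqP. Qed.

Definition incomparable X := uniq X /\ {in X &, forall x y, leqv x y -> x = y}.

Definition upset X e := has (fun x => leqv x e) X.

Lemma add_minimal1 X e : (add_minimal X e).1 =
  if upset X e then X else e :: [seq x <- X | ~~ leqv e x].
Proof.
have e1 : (hasM (fun x => vleq x e) X).1 = upset X e.
  by rewrite hasM1; apply: eq_has => x; exact: vleq1.
rewrite /add_minimal bind1 e1; case: ifP => // _.
rewrite -[LHS]/(e :: (filterM (fun x => negM (vleq e x)) X).1) filterM1.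
by congr cons; apply: eq_filter => x; rewrite -vleq1.
Qed.

Lemma add_minimalP X e : sized X -> size e = k -> incomparable X ->
  let Y := (add_minimal X e).1 in
  [/\ sized Y, incomparable Y, {subset Y <= e :: X}
    & forall t, size t = k -> upset Y t = leqv e t || upset X t].
Proof.
move=> sX se [uX aX] Y; rewrite {}/Y add_minimal1; case: ifPn => [|nd].
  case/hasP => x xX xe; split=> //; first by move=> y; rewrite inE orbC => ->.
  move=> t st; apply/idP/orP => [->|[et|//]]; first by right.
  apply/hasP; exists x => //; apply: leqv_trans et => //; last by rewrite se.
  by rewrite se (sizedP sX).
have eX : e \notin X by apply: contra nd => h; apply/hasP; exists e; rewrite ?leqv_refl.
split.
- by rewrite /= se eqxx; apply/allP => x; rewrite mem_filter => /andP[_ /(allP sX)].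
- split; first by rewrite /= mem_filter (negPf eX) andbF filter_uniq.
  move=> x y; rewrite !inE !mem_filter.
  move=> /orP[/eqP->|/andP[ex xX]] /orP[/eqP->|/andP[ey yX]] //.
  + by rewrite (negPf ey).
  + by move=> xe; case/negP: nd; apply/hasP; exists x.
  + exact: aX.
- by move=> x; rewrite !inE mem_filter => /orP[->//|/andP[_ ->]]; rewrite orbT.
- move=> t st /=; case: (boolP (leqv e t)) => //= et; apply/hasP/hasP => -[x].
    by rewrite mem_filter => /andP[_ xX] xt; exists x.
  move=> xX xt; exists x => //; rewrite mem_filter xX andbT.
  apply: contra et => ex; apply: leqv_trans ex xt; first by rewrite se (sizedP sX).
  by rewrite (sizedP sX) // st.
Qed.

Lemma minimalMP X : sized X -> let Y := (minimalM X).1 in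
  [/\ sized Y, incomparable Y, {subset Y <= X}
    & forall t, size t = k -> upset Y t = upset X t].
Proof.
rewrite /minimalM foldM1 /=.
suff H Z : sized Z -> incomparable Z -> sized X ->
   let Y := foldl (fun b x => (add_minimal b x).1) Z X in
   [/\ sized Y, incomparable Y, {subset Y <= X ++ Z}
    & forall t, size t = k -> upset Y t = upset X t || upset Z t].
  move=> sX; have [] := H [::] => // h1 h2 h3 h4; split=> //.
    by move=> x /h3; rewrite cats0.
  by move=> t /h4 ->; rewrite orbF.
elim: X Z => [|x X IH] Z sZ iZ; first by split=> // t _.
move=> /= /andP[/eqP sx sX].
have [h1 h2 h3 h4] := add_minimalP sZ sx iZ.
have [g1 g2 g3 g4] := IH _ h1 h2 sX; split=> //.
  move=> y /g3; rewrite !inE !mem_cat => /orP[->|/h3]; first by rewrite orbT.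
  by rewrite inE => /orP[->//|->]; rewrite !orbT.
by move=> t st; rewrite g4 // h4 // orbCA orbA.
Qed.

(** The componentwise maximum is the join of two vectors, so the joins of all pairs generate the
    intersection. *)
Lemma meetMP X Y : sized X -> sized Y -> let Z := (meetM X Y).1 in
  [/\ sized Z, incomparable Z, {subset Z <= [seq (vmax x y).1 | x <- X, y <- Y]}
   & forall t, size t = k -> upset Z t = upset X t && upset Y t].
Proof.
move=> sX sY; rewrite -[(meetM X Y).1]/(minimalM (flatten (mapM (fun x =>
  mapM (vmax x) Y) X).1)).1 mapM1.
have -> : flatten [seq (mapM (vmax x) Y).1 | x <- X] = [seq (vmax x y).1 | x <- X,
  y <- Y].
  by congr flatten; apply: eq_map => x; rewrite mapM1.
have sz : sized [seq (vmax x y).1 | x <- X, y <- Y].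
  apply/allP => z /allpairsP[[x y] /= [xX yY ->]].
  by rewrite vmax1 size_map size_zip (sizedP sX) // (sizedP sY) // minnn.
have [h1 h2 h3 h4] := minimalMP sz; split=> //.
move=> t st; rewrite h4 //; apply/hasP/andP.
  move=> [z /allpairsP[[x y] /= [xX yY ->]]].
  rewrite leqv_max ?st ?(sizedP sX xX) ?(sizedP sY yY) // => /andP[xt yt].
  by split; apply/hasP; [exists x | exists y].
move=> [/hasP[x xX xt] /hasP[y yY yt]]; exists (vmax x y).1.
  by apply/allpairsP; exists (x, y).
by rewrite leqv_max ?xt ?yt // st ?(sizedP sX xX) ?(sizedP sY yY).
Qed.

Lemma fold_meetMP X Ys : sized X -> incomparable X -> all sized Ys ->
  let Z := (foldM meetM X Ys).1 in
  [/\ sized Z, incomparable Z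
   & forall t, size t = k -> upset Z t = upset X t && all (fun Y => upset Y t) Ys].
Proof.
rewrite foldM1; elim: Ys X => [|Y Ys IH] X sX iX /=.
  by split=> // t _; rewrite andbT.
move=> /andP[sY sYs]; have [h1 h2 _ h4] := meetMP sX sY.
have [g1 g2 g3] := IH _ h1 h2 sYs; split=> // t st.
by rewrite g3 // h4 // andbA.
Qed.

End Minimal.

Definition bounded C (X : seq (seq nat)) := all (all (fun n => n <= C)) X.

Lemma bounded_sub C X Y : {subset Y <= X} -> bounded C X -> bounded C Y.
Proof. by move=> s /allP h; apply/allP => x /s /h. Qed.

Lemma mem_zip (A B : eqType) (u : seq A) (v : seq B) p :
  p \in zip u v -> p.1 \in u /\ p.2 \in v.
Proof.
elim: u v => [|x u IH] [|y v] //=; rewrite !inE => /orP[/eqP->|/IH[-> ->]].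
  by rewrite !eqxx.
by rewrite !orbT.
Qed.

Lemma bounded_meet k C X Y : sized k X -> sized k Y ->
  bounded C X -> bounded C Y -> bounded C (meetM X Y).1.
Proof.
move=> sX sY bX bY; have [_ _ s _] := meetMP sX sY; apply: bounded_sub s _.
apply/allP => z /allpairsP[[x y] /= [/(allP bX) bx /(allP bY) by_ ->]].
rewrite vmax1 all_map; apply/allP => p pp /=; rewrite geq_max.
by have [px py] := mem_zip pp; rewrite (allP bx) ?(allP by_).
Qed.

Lemma bounded_fold_meet k C X Ys : sized k X -> all (sized k) Ys ->
  bounded C X -> all (bounded C) Ys -> bounded C (foldM meetM X Ys).1.
Proof.
rewrite foldM1; elim: Ys X => //= Y Ys IH X sX /andP[sY sYs] bX /andP[bY bYs].
by apply: IH => //; [have [] := meetMP sX sY | apply: (bounded_meet sX)].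
Qed.

Lemma leqv_bounded k C u v : size u = k -> size v = k -> leqv u v ->
  all (fun n => n <= C) v -> all (fun n => n <= C) u.
Proof.
move=> su sv /(leqvP su sv) h /all_nthP hv; apply/(all_nthP 0) => i; rewrite su => ik.
by apply: leq_trans (h i ik) _; apply: hv; rewrite sv.
Qed.

Lemma all_flatten (A : Type) (p : pred A) (ss : seq (seq A)) :
  all p (flatten ss) = all (all p) ss.
Proof. by elim: ss => //= s ss IH; rewrite all_cat IH. Qed.

Lemma has_flatten (A : Type) (p : pred A) (ss : seq (seq A)) :
  has p (flatten ss) = has (has p) ss.
Proof. by elim: ss => //= s ss IH; rewrite has_cat IH. Qed.

(** * The symbolic computation of the greatest fixed point *)

Section Symbolic.
Variables (G : game) (C : nat).
Local Notation k := (wdim G).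
Local Notation elt := (G * seq nat)%type.
Local Notation le_C := (all (fun n => n <= C)).

Definition wlist (s s' : G) : seq int := [seq weight s s' 0%R j | j <- enum 'I_k].

Lemma size_wlist s s' : size (wlist s s') = k.
Proof. by rewrite size_map size_enum_ord. Qed.

Lemma nth_wlist s s' (j : 'I_k) : nth 0%R (wlist s s') j = weight s s' 0%R j.
Proof. by rewrite (nth_map j) ?size_enum_ord // nth_ord_enum. Qed.

Lemma mem_tedges (a : G * G * seq int) :
  (a \in tedges (encode G)) = edge a.1.1 a.1.2 && (a.2 == wlist a.1.1 a.1.2).
Proof.
apply/mapP/andP => [[[s s']]|[h /eqP e]].
  by rewrite mem_filter => /andP[/= h _] ->.
exists a.1; first by rewrite mem_filter h mem_enum.
by rewrite -/(wlist _ _) -e -surjective_pairing; case: a {h e} => [[]].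
Qed.

Lemma out_edges1 s : (out_edges (encode G) s).1 = [seq a <- tedges (encode G) | a.1.1
  == s].
Proof. by rewrite /out_edges filterM1. Qed.

Definition vector (e : seq nat) := (size e == k) && le_C e.

Definition lst (x : config G C) : seq nat := (listing x).2.

Lemma size_lst x : size (lst x) = k.
Proof. by rewrite size_map size_enum_ord. Qed.

Lemma nth_lst x (j : 'I_k) : nth 0 (lst x) j = x.2 j.
Proof. by rewrite (nth_map j) ?size_enum_ord // nth_ord_enum. Qed.

Lemma vector_lst x : vector (lst x).
Proof.
rewrite /vector size_lst eqxx; apply/allP => n /mapP[j _ ->]; by rewrite -ltnS ltn_ord.
Qed.

Lemma vector_config (y : elt) : vector y.2 -> exists x : config G C, listing x = y.
Proof.
case: y => s e /andP[/eqP /= se /(all_nthP 0) h].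
exists (s, [ffun j : 'I_k => inord (nth 0 e j)]); rewrite /listing /=; congr pair.
apply: (@eq_from_nth _ 0) => [|i]; rewrite size_map size_enum_ord // => ik.
rewrite (nth_map (Ordinal ik)) ?size_enum_ord // ffunE.
by rewrite (nth_ord_enum _ (Ordinal ik)) /= inordK // ltnS h // se.
Qed.

Lemma listing_inj : injective (@listing G C).
Proof.
move=> x y e; have e1 : x.1 = y.1 := congr1 fst e.
have e2 : x.2 = y.2 by apply/ffunP => j; apply: val_inj; rewrite /= -!nth_lst /lst e.
by rewrite (surjective_pairing x) e1 e2 -surjective_pairing.
Qed.

Lemma config_leE (x y : config G C) : config_le x y = (x.1 == y.1) && leqv (lst x)
  (lst y).
Proof.
congr andb; apply/forallP/(leqvP (size_lst x) (size_lst y)) => [h i ik|h j].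
  by have := h (Ordinal ik); rewrite -!nth_lst.
by rewrite -!nth_lst; apply: h.
Qed.

Lemma coversE (x y : config G C) :
  covers x y = affords (lst y) (lst x) (wlist x.1 y.1).
Proof.
apply/forallP/(affordsP (size_lst y) (size_lst x) (size_wlist _ _)) => [h i ik|h j].
  by have := h (Ordinal ik); rewrite -!nth_lst -nth_wlist.
by rewrite -!nth_lst -nth_wlist; apply: h.
Qed.

Definition well_formed (V : seq elt) := all (fun y => vector y.2) V.

Lemma vector_of V y : well_formed V -> y \in V -> size y.2 = k /\ le_C y.2.
Proof. by move=> /allP h /h /andP[/eqP]. Qed.

(** Discarding the vectors that exceed [C] loses nothing: a vector below one with entries at most
    [C] has such entries itself. *)
Lemma pre_edgeP V (a : G * G * seq int) : well_formed V -> size a.2 = k ->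
  let Y := (pre_edge C V a).1 in
  [/\ sized k Y, bounded C Y & forall e, vector e -> upset Y e =
     has (fun x => (x.1 == a.1.2) && affords x.2 e a.2) V].
Proof.
move=> wV sa Y.
have eY : Y = [seq u <- [seq (least_before x.2 a.2).1 | x <- V &
  x.1 == a.1.2] | le_C u].
  rewrite -[LHS]/(filterM (allM (fun n => nleq n C)) (mapM (fun x =>
    least_before x.2 a.2)
     (filterM (fun x => eq_state x.1 a.1.2) V).1).1).1.
  by rewrite filterM1 mapM1 filterM1; apply: eq_filter => u; exact: allM1.
have mY u : reflect (exists2 x, (x \in V) && (x.1 == a.1.2) &
     u = (least_before x.2 a.2).1 /\ le_C u) (u \in Y).
  rewrite eY mem_filter; apply: (iffP andP) => [[Cu /mapP[x]]|[x /andP[xV xa] [-> Cu]]].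
    by rewrite mem_filter => /andP[xa xV] e; exists x; rewrite ?xV.
  by split=> //; apply: map_f; rewrite mem_filter xa.
split.
- apply/allP => u /mY[x /andP[/(vector_of wV)[sx _] _] [-> _]].
  by rewrite (size_least_before sx).
- by apply/allP => u /mY[x _ [_]].
- move=> e /andP[/eqP se Ce];
    apply/hasP/hasP => [[u /mY[x /andP[xV xa] [-> _]]]|[x xV /andP[xa le]]].
    have [sx _] := vector_of wV xV; rewrite (least_before_le sx se sa) => le.
    by exists x; rewrite ?xa.
  have [sx _] := vector_of wV xV; rewrite -(least_before_le sx se sa) in le.
  exists (least_before x.2 a.2).1 => //; apply/mY; exists x; rewrite ?xV //.
  by split=> //; apply: leqv_bounded le Ce; rewrite ?(size_least_before sx).
Qed.

Definition covered (V : seq elt) (s : G) (e : seq nat) (s' : G) :=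
  has (fun y : elt => (y.1 == s') && affords y.2 e (wlist s s')) V.

(** The condition of [Cpre], read off a list of minimal elements. *)
Definition controlled (V : seq elt) (s : G) (e : seq nat) :=
  if s \in pl1 G then [exists s', edge s s' && covered V s e s']
  else [forall s', edge s s' ==> covered V s e s'].

Lemma cpre_stateP V s : well_formed V ->
  exists es, [/\ (cpre_state (encode G) C V (s, s \in pl1 G)).1 = [seq (s,
    e) | e <- es],
    incomparable es, sized k es, bounded C es
    & forall e, vector e -> upset es e = controlled V s e].
Proof.
move=> wV; set A := [seq a <- tedges (encode G) | a.1.1 == s].
pose Xs := [seq (pre_edge C V a).1 | a <- A].
have -> : (cpre_state (encode G) C V (s, s \in pl1 G)).1 = [seq (s, e) | e <-
    if s \in pl1 G then (minimalM (flatten Xs)).1 else (foldM meetM [:: nseq k 0]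
      Xs).1].
  by rewrite /Xs /A -out_edges1 -mapM1 /cpre_state 2!bind1 bind1 mapM1;
    case: (s \in pl1 G).
have mA a : a \in A -> [/\ a.1.1 = s, edge s a.1.2 & a.2 = wlist s a.1.2].
  by rewrite mem_filter mem_tedges => /andP[/eqP <- /andP[-> /eqP]].
have Ain s' : edge s s' -> (s, s', wlist s s') \in A.
  by move=> h; rewrite mem_filter mem_tedges /= !eqxx h.
have PE a : a \in A -> let Y := (pre_edge C V a).1 in
   [/\ sized k Y, bounded C Y & forall e, vector e -> upset Y e = covered V s e a.1.2].
  move=> /mA[h1 h2 h3]; have := @pre_edgeP V a wV; rewrite h3 size_wlist.
  exact.
have sXs : all (sized k) Xs by rewrite all_map; apply/allP => a /PE[].
have bXs : all (bounded C) Xs by rewrite all_map; apply/allP => a /PE[].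
rewrite /controlled; case: ifP => sp.
  have sF : sized k (flatten Xs) by rewrite /sized all_flatten.
  have [h1 h2 h3 h4] := minimalMP sF.
  exists (minimalM (flatten Xs)).1; split=> //.
    by apply: bounded_sub h3 _; rewrite /bounded all_flatten.
  move=> e ve; have /andP[/eqP se _] := ve; rewrite h4 //.
  rewrite /upset has_flatten has_map; apply/hasP/existsP.
    move=> [a aA]; have [_ _ /(_ e ve)] := PE a aA; rewrite /upset /= => -> cv.
    by exists a.1.2; rewrite cv; have [_ -> _] := mA a aA.
  move=> [s' /andP[es cv]]; exists (s, s', wlist s s'); first exact: Ain.
  by have [_ _ /(_ e ve)] := PE _ (Ain _ es); rewrite /upset /= => ->.
(* The zero vector generates all vectors, so the fold of intersections starts from the full set. *)
have s0 : sized k [:: nseq k 0] by rewrite /sized /= size_nseq eqxx.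
have i0 : incomparable [:: nseq k 0].
  by split=> // x y; rewrite !inE => /eqP -> /eqP ->.
have b0 : bounded C [:: nseq k 0] by rewrite /bounded /= all_nseq orbT.
have [h1 h2 h3] := fold_meetMP s0 i0 sXs.
exists (foldM meetM [:: nseq k 0] Xs).1; split=> //;
  first exact: (bounded_fold_meet s0).
move=> e ve; have /andP[/eqP se _] := ve; rewrite h3 // /upset /= orbF.
have -> : leqv (nseq k 0) e.
  apply/(leqvP (size_nseq _ _) se) => i ik; by rewrite nth_nseq ik.
rewrite all_map; apply/allP/forallP => [h s'|h a aA].
  apply/implyP => es; have := h _ (Ain _ es).
  by have [_ _ /(_ e ve)] := PE _ (Ain _ es); rewrite /upset /= => ->.
have [_ _ /(_ e ve)] := PE a aA; rewrite /upset /= => ->.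
by have [_ ea _] := mA a aA; exact: (implyP (h a.1.2)).
Qed.

Definition upV (V : seq elt) s e := has (fun y : elt => (y.1 == s) && leqv y.2 e) V.

Definition antichain_rep (V : seq elt) := [/\ uniq V, well_formed V
  & {in V &, forall x y : elt, x.1 = y.1 -> leqv x.2 y.2 -> x = y}].

Definition represents (V : seq elt) (U : {set config G C}) :=
  antichain_rep V /\ forall x, (x \in U) = upV V x.1 (lst x).

Lemma listing_in V U (x : config G C) : represents V U -> listing x \in V -> x \in U.
Proof.
move=> [_ ->] h; apply/hasP; exists (listing x) => //=; by rewrite eqxx leqv_refl.
Qed.

(** An element of [U] below an entry of [V] lies itself above some entry of [V], which by
    incomparability is the same one. *)
Lemma represents_minimal V U : represents V U -> forall y, y \in V <->
  exists2 x : config G C, minimal_in U x & y = listing x.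
Proof.
move=> rVU; have [[uV wV aV] hU] := rVU; move=> y;
  split=> [yV|[x /andP[xU /forallP mx] ->]].
  have [x xy] := vector_config (allP wV y yV); exists x => //.
  rewrite /minimal_in (listing_in rVU) ?xy //=; apply/forallP => z; apply/implyP => zU.
  apply/implyP; rewrite config_leE => /andP[/eqP z1 zx].
  move: zU; rewrite hU => /hasP[t tV /andP[/eqP t1 tz]].
  have [st _] := vector_of wV tV.
  have ty : t = y.
    apply: aV => //; first by rewrite t1 z1 -xy.
    rewrite -xy; apply: leqv_trans tz zx; by rewrite ?st !size_lst.
  apply/eqP/listing_inj; rewrite /listing z1; congr pair; apply: leqv_anti zx _.
    by rewrite !size_lst.
  by rewrite /lst xy -ty.
move: (xU); rewrite hU => /hasP[t tV /andP[/eqP t1 tx]].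
have [z zt] := vector_config (allP wV t tV).
have zU : z \in U by apply: (listing_in rVU); rewrite zt.
have /implyP/(_ zU)/implyP := mx z; rewrite config_leE /lst zt.
have -> : z.1 = t.1 by rewrite -zt.
by rewrite t1 eqxx tx => /(_ isT) /eqP <-; rewrite zt.
Qed.

(** This justifies the stopping test: comparing antichains as sets amounts to comparing the sets
    that they represent. *)
Lemma represents_eq V U V' U' : represents V U -> represents V' U' ->
  V =i V' <-> U = U'.
Proof.
move=> r r'; split=> [e|e y]; last first.
  apply/idP/idP => [/(represents_minimal r)|/(represents_minimal r')] h.
    by apply/(represents_minimal r'); rewrite -e.
  by apply/(represents_minimal r); rewrite e.
have [_ h] := r; have [_ h'] := r'; apply/setP => x; rewrite h h'.
by apply/hasP/hasP => -[y yV hy]; exists y => //; rewrite ?e // -e.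
Qed.

Lemma Cpre_mono : {homo @Cpre G C : U V / U \subset V}.
Proof.
move=> U V /subsetP UV; apply/subsetP => x; rewrite !inE; case: ifP => _.
  case/existsP => y /andP[yU h]; apply/existsP; exists y.
  by rewrite UV.
move=> /forallP h; apply/forallP => s'; apply/implyP => es.
have /existsP[y /andP[yU hy]] := implyP (h s') es; apply/existsP; exists y.
by rewrite UV.
Qed.

Lemma covered_covers V U (x : config G C) s' : represents V U ->
  covered V x.1 (lst x) s' = [exists y in U, (y.1 == s') && covers x y].
Proof.
move=> r; have [[_ wV _] hU] := r; apply/hasP/existsP => [[y yV /andP[/eqP y1 ya]]|].
  have [z zy] := vector_config (allP wV y yV); exists z.
  rewrite (listing_in r) ?zy //= coversE.
  have z1 : z.1 = y.1 by rewrite -zy.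
  by rewrite z1 y1 eqxx /lst zy.
move=> [z /andP[zU /andP[/eqP z1 zc]]].
move: zU; rewrite hU => /hasP[y yV /andP[/eqP y1 yz]]; exists y => //.
rewrite y1 z1 eqxx /=; have [sy _] := vector_of wV yV.
apply: (affords_trans sy (size_lst z) (size_lst x) (size_lst x) (size_wlist _ _) yz _
  (leqv_refl _)).
by rewrite -z1 -coversE.
Qed.

Lemma cpre_represents V U : represents V U ->
  represents (cpreM (encode G) C V).1 (Cpre U).
Proof.
move=> r; have [[_ wV _] hU] := r.
have [es hes] : exists es : G -> seq (seq nat), forall s,
   [/\ (cpre_state (encode G) C V (s, s \in pl1 G)).1 = [seq (s, e) | e <- es s],
    incomparable (es s), sized k (es s), bounded C (es s)
    & forall e, vector e -> upset (es s) e = controlled V s e].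
  exact: (fin_all_exists (fun s => cpre_stateP s wV)).
have -> : (cpreM (encode G) C V).1 = [seq (s, e) | s <- enum G, e <- es s].
  rewrite -[LHS]/(flatten (mapM (cpre_state (encode G) C V) (tstates (encode G))).1).
  rewrite mapM1 -map_comp; congr flatten; apply: eq_map => s.
  by have [e _ _ _ _] := hes s; exact: e.
have mV (y : elt) : (y \in [seq (s, e) | s <- enum G, e <- es s]) = (y.2 \in es y.1).
  apply/allpairsPdep/idP => [[s [e [_ h ->]]]//|h].
  by exists y.1, y.2; rewrite mem_enum; split=> //; case: (y).
split; last first.
  move=> x; have [_ _ _ _ hx] := hes x.1.
  transitivity (upset (es x.1) (lst x)); last first.
    apply/hasP/hasP => [[e eE le]|[y]].
      by exists (x.1, e); rewrite ?mV //= eqxx.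
    by rewrite mV => yE /andP[/eqP y1 le]; exists y.2 => //; rewrite -y1.
  rewrite hx ?vector_lst // inE /controlled; case: ifP => _.
    apply/existsP/existsP => [[y /andP[yU /andP[ey cy]]]|[s' /andP[es' ]]].
      exists y.1; rewrite ey (covered_covers _ _ r); apply/existsP; exists y.
      by rewrite yU eqxx.
    rewrite (covered_covers _ _ r) => /existsP[y /andP[yU /andP[/eqP y1 yc]]].
    by exists y; rewrite yU yc y1 es'.
  by apply: eq_forallb => s'; rewrite (covered_covers _ _ r).
split.
- apply: allpairs_uniq_dep; rewrite ?enum_uniq //.
    by move=> s _; have [_ [u _] _ _ _] := hes s.
  by move=> [s e] [s' e'] _ _ /= [-> ->].
- apply/allP => y; rewrite mV => h; have [_ _ /allP s /allP b _] := hes y.1.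
  by rewrite /vector s // b.
- move=> [s e] [s' e']; rewrite !mV /= => h h' ss; move: h'; rewrite -ss => h' le.
  by congr pair; have [_ [_ a] _ _ _] := hes s; apply: a.
Qed.

Lemma full_represents : represents (full_antichain (encode G)).1 setT.
Proof.
have -> : (full_antichain (encode G)).1 = [seq (s, nseq k 0) | s <- enum G].
  by rewrite /full_antichain mapM1 -map_comp.
split; last first.
  move=> x; rewrite inE; apply/esym/hasP; exists (x.1, nseq k 0).
    by apply: map_f; rewrite mem_enum.
  rewrite eqxx /=; apply/(leqvP (size_nseq _ _) (size_lst _)) => i ik.
  by rewrite nth_nseq ik.
split.
- by rewrite map_inj_uniq ?enum_uniq // => s s' [].
- by apply/allP => y /mapP[s _ ->]; rewrite /vector size_nseq eqxx all_nseq orbT.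
- by move=> x y /mapP[s _ ->] /mapP[s' _ ->] /= ->.
Qed.

Lemma same_antichainP V V' : well_formed V -> well_formed V' ->
  reflect (V =i V') (same_antichain V V').1.
Proof.
move=> w w'; have eqE (x y : elt) : vector x.2 -> vector y.2 ->
  (eq_elt x y).1 = (x == y).
  move=> /andP[/eqP sx _] /andP[/eqP sy _].
  have -> : (eq_elt x y).1 = if x.1 == y.1 then (veq x.2 y.2).1 else false.
    by rewrite /eq_elt /=; case: (x.1 == y.1).
  rewrite veq1 ?sx ?sy //; case: x y {sx sy} => [s e] [s' e'] /=.
have inE' W W' : well_formed W -> well_formed W' ->
    (allM (fun x => hasM (eq_elt x) W') W).1 = all (fun x => x \in W') W.
  move=> wW wW'; rewrite allM1; apply: eq_in_all => x xW; rewrite hasM1.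
  rewrite -has_pred1; apply: eq_in_has => y yW'.
  by rewrite eqE; [apply: eq_sym | apply: (allP wW) | apply: (allP wW')].
have -> : (same_antichain V V').1 = all (fun x => x \in V') V && all (fun x =>
  x \in V) V'.
  rewrite /same_antichain bind1 inE' //; case: ifP => // _; exact: inE'.
apply: (iffP andP) => [[/allP h /allP h'] x|e]; first by apply/idP/idP => [/h|/h'].
by split; apply/allP => x; rewrite e.
Qed.

Definition chain i : {set config G C} := iter i (@Cpre G C) setT.

Lemma chain_decr i : chain i.+1 \subset chain i.
Proof. by elim: i => [|i IH]; [apply: subsetT | apply: Cpre_mono]. Qed.

(** [cofixset] is the complement of an iteration from the empty set; complementation turns that
    iteration into the descending chain. *)
Lemma Cpre_star_chain : Cpre_star G C = chain #|config G C|.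
Proof.
rewrite /Cpre_star /cofixset /fixset /chain; set n := #|_|.
elim: n => [|n IH]; first by rewrite setC0.
by rewrite !iterS /= -IH /funsetC setCK.
Qed.

Lemma chain_stable i : chain i.+1 = chain i -> Cpre_star G C = chain i.
Proof.
move=> e; have st n : i <= n -> chain n = chain i.
  elim: n => [|n IH]; first by rewrite leqn0 => /eqP ->.
  rewrite leq_eqVlt => /orP[/eqP <- //|/IH {}IH].
  by rewrite -e /chain iterS -/(chain n) IH.
have fx : chain #|config G C|.+1 = chain #|config G C|.
  by rewrite /chain iterS -/(chain _) -Cpre_star_chain cofixsetK //; apply: Cpre_mono.
(* The chain may be known to stop before or after the index at which [cofixset] stops iterating. *)
have [le|lt] := leqP i #|config G C|; first by rewrite Cpre_star_chain st.
rewrite Cpre_star_chain;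
  have st' n : #|config G C| <= n -> chain n = chain #|config G C|.
  elim: n => [|n IH]; first by rewrite leqn0 => /eqP ->.
  rewrite leq_eqVlt => /orP[/eqP <- //|/IH {}IH].
  by rewrite -fx /chain iterS -/(chain n) IH.
by rewrite st' // ltnW.
Qed.

(** A step that is not stable makes the set strictly smaller, so fuel above its cardinality never
    runs out. *)
Lemma descend_represents fuel i V : represents V (chain i) -> #|chain i| < fuel ->
  represents (descend fuel (encode G) C V).1 (Cpre_star G C).
Proof.
elim: fuel i V => // fuel IH i V r; rewrite ltnS => hf.
have r' := cpre_represents r.
have [[_ w _] _] := r; have [[_ w' _] _] := r'.
rewrite /descend -/descend bind1 bind1.
case: (same_antichainP w w') => [/(represents_eq r r') e|ne].
  by rewrite (chain_stable (esym e)).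
apply: (IH i.+1) => //; apply: leq_trans hf; apply: proper_card.
rewrite properEneq chain_decr andbT; apply/negP => /eqP e; apply: ne.
by apply/(represents_eq r r'); exact: (esym e).
Qed.

Lemma card_config : #|config G C| = #|G| * C.+1 ^ k.
Proof. by rewrite card_prod card_ffun !card_ord. Qed.

Lemma cpre_fixpoint_represents :
  represents (cpre_fixpoint (encode G) C).1 (Cpre_star G C).
Proof.
rewrite /cpre_fixpoint bind1.
apply: (@descend_represents _ 0); first exact: full_represents.
by rewrite ltnS /chain cardsT card_config size_map -cardE.
Qed.

Lemma Cpre_star_fix : Cpre (Cpre_star G C) = Cpre_star G C.
Proof. by apply: cofixsetK; apply: Cpre_mono. Qed.

Lemma sub_Cpre_star (V : {set config G C}) : V \subset Cpre V ->
  V \subset Cpre_star G C.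
Proof.
move=> h; rewrite Cpre_star_chain; elim: #|_| => [|n IH]; first exact: subsetT.
exact: subset_trans h (Cpre_mono IH).
Qed.

End Symbolic.

Lemma ohead_filterP (A : eqType) (p : pred A) (s : seq A) :
  if ohead [seq x <- s | p x] is Some x then x \in s /\ p x else ~~ has p s.
Proof.
elim: s => //= x s IH; case: ifPn => /= [px|npx]; first by rewrite mem_head.
by case: ohead IH => [y [ys py]|//]; rewrite inE ys orbT.
Qed.

Lemma assoc_map (A : eqType) (B : Type) (d : B) (h : A -> B) (keys : seq A) x :
  x \in keys -> assoc d [seq (y, h y) | y <- keys] x = h x.
Proof.
move=> xk; rewrite /assoc /unzip1 /unzip2 -!map_comp map_id.
by rewrite (nth_map x) ?nth_index // index_mem.
Qed.

Lemma tabulate1 (T : finType) (B : Type) (f : T * seq nat -> T -> timed B) V Q :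
  (tabulate f V Q).1 = [seq (y, (f y.1 y.2).1) | y <- [seq (x, sb.1) | x <- V,
    sb <- Q]].
Proof.
rewrite -[LHS]/(flatten (mapM (fun x => mapM (fun sb : T * bool =>
  let! y := f x sb.1 in ret ((x, sb.1), y)) Q) V).1).
rewrite mapM1 map_flatten -map_comp; congr flatten; apply: eq_map => x.
by rewrite mapM1 /= -map_comp.
Qed.

(** * The extracted machine *)

Section Machine.
Variables (G : game) (C : nat).
Local Notation k := (wdim G).
Local Notation elt := (G * seq nat)%type.
Variables (V : seq elt) (x0 : elt).
Hypotheses (rV : represents V (Cpre_star G C)) (x0V : x0 \in V).

Let wV : well_formed C V. Proof. by case: rV => -[]. Qed.

Lemma controlledV (y : elt) : y \in V -> controlled V y.1 y.2.
Proof.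
move=> yV; have [x xy] := vector_config (allP wV y yV).
have xU : x \in Cpre_star G C by apply: (listing_in rV); rewrite xy.
move: xU; rewrite -Cpre_star_fix inE /controlled -xy.
case: ifP => _.
  move=> /existsP[z /andP[zU /andP[ez cz]]]; apply/existsP; exists z.1.
  rewrite ez -/(lst x) (covered_covers _ _ rV); apply/existsP; exists z.
  by rewrite zU eqxx.
move=> /forallP h; apply/forallP => s'.
by rewrite -/(lst x) (covered_covers _ _ rV).
Qed.

Definition edge_entry (s s' : G) : G * G * seq int := (s, s', wlist s s').

Lemma supports1 (a : G * G * seq int) e (y : elt) :
  (supports a e y).1 = (y.1 == a.1.2) && affords y.2 e a.2.
Proof. by rewrite -affordable1 /supports /=; case: (y.1 == a.1.2). Qed.

Lemma upd_entry1 (x : elt) (s' : G) : (upd_entry (encode G) V x s').1 =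
  if edge x.1 s' then
    odflt x (ohead [seq y <- V | (y.1 == s') && affords y.2 x.2 (wlist x.1 s')])
  else x.
Proof.
pose p (a : G * G * seq int) := (a.1.1 == x.1) && (a.1.2 == s').
have -> : (upd_entry (encode G) V x s').1 =
   if ohead [seq a <- tedges (encode G) | p a] is Some a then
     odflt x (ohead [seq y <- V | (supports a x.2 y).1]) else x.
  rewrite /upd_entry bind1 findM1.
  rewrite (@eq_filter _ _ p) => [|a]; last by rewrite /p /=; case: (a.1.1 == x.1).
  by case: ohead => [a|//]; rewrite bind1 findM1.
have := ohead_filterP p (tedges (encode G)); case: ohead => [a|].
  rewrite mem_tedges => -[/andP[ea /eqP wa] /andP[/eqP a1 /eqP a2]].
  rewrite a1 a2 in ea wa; rewrite ea; congr odflt; congr ohead; apply: eq_filter => y.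
  by rewrite supports1 a2 wa.
case: ifP => // es /hasPn /(_ (edge_entry x.1 s')).
by rewrite mem_tedges /= /p /= es !eqxx => /(_ isT).
Qed.

Lemma upd_entry_in (x : elt) s' : x \in V -> (upd_entry (encode G) V x s').1 \in V.
Proof.
move=> xV; rewrite upd_entry1; case: ifP => // _.
have := ohead_filterP (fun y : elt => (y.1 == s') && affords y.2 x.2 (wlist x.1 s')) V.
by case: ohead => [y []|].
Qed.

Lemma upd_entryP (x : elt) s' : edge x.1 s' -> covered V x.1 x.2 s' ->
  let y := (upd_entry (encode G) V x s').1 in
  [/\ y \in V, y.1 = s' & affords y.2 x.2 (wlist x.1 s')].
Proof.
move=> es cv y; rewrite {}/y upd_entry1 es.
have := ohead_filterP (fun y : elt => (y.1 == s') && affords y.2 x.2 (wlist x.1 s')) V.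
by case: ohead => [y [yV /andP[/eqP ? ?]]|/negP/(_ cv)//]; split.
Qed.

(** The first part holds for every memory element, which makes the decoded machine play legal moves
    on all prefixes, even inconsistent ones. *)
Lemma next_entryP (x : elt) s' : let t := (next_entry (encode G) V x s').1 in
  edge s' t /\ (x \in V -> x.1 = s' -> s' \in pl1 G -> covered V s' x.2 t).
Proof.
pose A := [seq a <- tedges (encode G) | a.1.1 == s'].
pose p (a : G * G * seq int) := has (fun y => (supports a x.2 y).1) V.
have -> : (next_entry (encode G) V x s').1 =
    if (if x.1 == s' then ohead [seq a <- A | p a] else None) is Some a then a.1.2
    else if ohead A is Some a then a.1.2 else s'.
  rewrite /A -out_edges1.
  have -> : ohead [seq a <- (out_edges (encode G) s').1 | p a] =
      (findM (fun a => hasM (supports a x.2) V) (out_edges (encode G) s').1).1.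
    by rewrite findM1; congr ohead; apply: eq_filter => a; rewrite hasM1.
  have -> : ohead (out_edges (encode G) s').1 =
      (findM (fun _ => ret true) (out_edges (encode G) s').1).1.
    by rewrite findM1 filter_predT.
  rewrite /next_entry bind1; move: (out_edges (encode G) s').1 => A'.
  rewrite /bind /eq_state /=; case: (x.1 == s') => /=; last by case: (findM _ A').1.
  by case: (findM (fun a => hasM (supports a x.2) V) A').1 => //=; case: (findM _ A').1.
have mA a : a \in A -> edge s' a.1.2 /\ a.2 = wlist s' a.1.2.
  by rewrite mem_filter mem_tedges => /andP[/eqP <- /andP[-> /eqP]].
have pA a : a \in A -> p a = covered V s' x.2 a.1.2.
  by move=> aA; apply: eq_has => y; rewrite supports1; have [_ ->] := mA a aA.
have Ain t : edge s' t -> edge_entry s' t \in A.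
  by move=> e; rewrite mem_filter mem_tedges /= e !eqxx.
have eA : edge s' (if ohead A is Some a then a.1.2 else s').
  have [t /Ain] := edge_total s'; case: (A) mA => // a l h _;
    by have [] := h a (mem_head _ _).
case: eqP => [xs|ne]; last by split.
have := ohead_filterP p A; case: ohead => [a [aA pa]|/hasPn np].
  by split; [have [] := mA a aA | rewrite -pA].
(* The search for a supported edge cannot fail on an element of [V], which lies in a fixed point of
   [Cpre]. *)
split=> // xV _ sp; exfalso; have := controlledV xV; rewrite /controlled xs sp.
by move=> /existsP[t /andP[est cv]]; have := np _ (Ain t est); rewrite pA ?Ain //= cv.
Qed.

Let m : machine G := (extract (encode G) V x0).1.

Lemma extractE : [/\ x_states m = V, x_start m = x0,
  forall x s, x \in V -> assoc x0 (x_upd m) (x, s) = (upd_entry (encode G) V x s).1 &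
  forall x s, x \in V -> s \in pl1 G ->
    assoc s (x_next m) (x, s) = (next_entry (encode G) V x s).1].
Proof.
split=> // [x s xV|x s xV sp].
  have -> : x_upd m = (tabulate (upd_entry (encode G) V) V (tstates (encode G))).1 by
    [].
  rewrite tabulate1 (assoc_map _ (fun y => (upd_entry (encode G) V y.1 y.2).1)) //.
  apply/allpairsP; exists (x, (s, s \in pl1 G)); split=> //=.
  by apply/mapP; exists s; rewrite ?mem_enum.
have -> : x_next m = (tabulate (next_entry (encode G) V) V
   (filterM (fun sb : G * bool => ret sb.2) (tstates (encode G))).1).1 by [].
rewrite tabulate1 (assoc_map _ (fun y => (next_entry (encode G) V y.1 y.2).1)) //.
apply/allpairsP; exists (x, (s, s \in pl1 G)); split=> //=.
rewrite filterM1 mem_filter /= sp; apply/mapP; exists s; rewrite ?mem_enum //.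
by rewrite sp.
Qed.

Let M := decode_machine m.

Lemma decoded_mem_in (x : mstate M) : ssval x \in V.
Proof.
have h : ssval x \in x0 :: V := ssvalP x.
by move: h; rewrite inE => /orP[/eqP->|].
Qed.

(** The default of [insubd] is never taken, since [upd_entry] does not leave [V]. *)
Lemma mupd_val (x : mstate M) s : ssval (mupd x s) = (upd_entry (encode G) V (ssval
  x) s).1.
Proof.
have xV := decoded_mem_in x; have [sV s0 hu _] := extractE.
have -> : mupd x s = insubd (decoded_start m) (assoc x0 (x_upd m) (ssval x, s)) by [].
have h : (upd_entry (encode G) V (ssval x) s).1 \in x0 :: V.
  by rewrite inE upd_entry_in ?orbT.
rewrite hu //; exact: (insubdK (decoded_start m) h).
Qed.

Lemma mnext_val (x : mstate M) s : s \in pl1 G ->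
  mnext x s = (next_entry (encode G) V (ssval x) s).1.
Proof.
move=> sp; have [_ _ _ hn] := extractE.
by rewrite -[RHS]hn //; apply: decoded_mem_in.
Qed.

Lemma machine_is_strategy : is_strategy (moore_strategy M).
Proof.
move=> rho _ lp; rewrite /moore_strategy mnext_val //.
by have [] := next_entryP (ssval (foldl (mupd (m:=M)) (m0 M) (behead (init G ::
  rho)))) (last (init G) rho).
Qed.

Lemma machine_card : #|mstate M| <= (size V).+1.
Proof.
have u : uniq [seq ssval x | x <- enum (mstate M)].
  by rewrite map_inj_uniq ?enum_uniq //; apply: val_inj.
have sub : {subset [seq ssval x | x <- enum (mstate M)] <= x0 :: V}.
  by move=> y /mapP[x _ ->]; exact: (ssvalP x).
by have := uniq_leq_size u sub; rewrite size_map -cardE.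
Qed.

Hypothesis x0_init : x0.1 = init G.

Lemma machine_safe (pi : nat -> G) : consistent (moore_strategy M) pi ->
  forall n (j : 'I_k), (0 <= Posz (nth 0 x0.2 j) + EL pi n 0 j :> int)%R.
Proof.
move=> [[pi0 hE] hs].
pose mem n := foldl (mupd (m:=M)) (m0 M) [seq pi i | i <- iota 1 n].
have memS n : mem n.+1 = mupd (mem n) (pi n.+1).
  by rewrite /mem -[n.+1]addn1 iotaD map_cat foldl_cat add1n addn1.
have inv n : (ssval (mem n)).1 = pi n /\ forall j : 'I_k,
    (Posz (nth 0 (ssval (mem n)).2 j) <= Posz (nth 0 x0.2 j) + EL pi n 0 j :> int)%R.
  elim: n => [|n [m1 m2]].
    rewrite pi0; split=> [|j]; first exact: x0_init.
    by rewrite /EL big_ord0 mxE addr0; apply: lexx.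
  have xV := decoded_mem_in (mem n).
  have cv : covered V (ssval (mem n)).1 (ssval (mem n)).2 (pi n.+1).
    have := controlledV xV; rewrite /controlled m1;
      case: ifP => [pp _|_ /forallP/(_ (pi n.+1))].
      have [_ /(_ xV m1 pp)] := next_entryP (ssval (mem n)) (pi n).
      suff -> : (next_entry (encode G) V (ssval (mem n)) (pi n)).1 = pi n.+1 by [].
      rewrite hs // -mnext_val // /moore_strategy; congr mnext.
      by rewrite /prefix_of mkseqS last_rcons.
    by rewrite hE.
  have [|yV y1 ya] := upd_entryP _ cv; first by rewrite m1.
  rewrite memS mupd_val y1; split=> // j.
  have [sy _] := vector_of wV yV; have [sx _] := vector_of wV xV.
  have := affordsP sy sx (size_wlist _ _) ya j (ltn_ord j).
  rewrite nth_wlist m1 /EL big_ord_recr /= mxE -/(EL pi n).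
  by have := m2 j; rewrite addrA; move=> h1 h2; apply: le_trans h2 _; rewrite lerD2r.
move=> n j; have [_ /(_ j)] := inv n; apply: le_trans.
exact: isT.
Qed.

End Machine.

(** * Sufficiency of the bound on the constant *)

(** The secured predicate, restricted to U(C), is a set contained in its own [Cpre], hence in the
    greatest fixed point. *)
Lemma secured_Cpre_star (G : game) (X : {set G}) C0 C :
  secured (pl1 G) X (@weight G) (@edge G) C0 -> C0 <= C -> init G \in X ->
  exists2 x, x \in Cpre_star G C & x.1 = init G.
Proof.
move=> [V hV fV] CC iX.
pose U := [set x : config G C | `[< V x.1 (fun j => x.2 j : nat) >]].
have cfg s e : V s e -> exists2 x, x \in U & x.1 = s /\ forall j, x.2 j = e j :> nat.
  move=> ve; have [_ eC _] := hV _ _ ve.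
  exists (s, [ffun j => inord (e j)]).
    rewrite inE; apply/asboolP => /=; congr (V s _): ve; apply/funext => j.
    by rewrite ffunE inordK // ltnS; apply: leq_trans (eC j) CC.
  by split=> // j; rewrite ffunE inordK // ltnS; apply: leq_trans (eC j) CC.
have cov (x : config G C) s' : reaches (@weight G) V (fun j => x.2 j : nat) x.1 s' ->
    exists2 y, y \in U & y.1 = s' /\ covers x y.
  move=> [e' /cfg[y yU [y1 y2]] le]; exists y => //; split=> //.
  by apply/forallP => j; rewrite y2 y1; apply: le.
have [e /cfg[x xU [x1 _]]] := fV _ iX; exists x => //.
suff H : U \subset Cpre_star G C by apply: (subsetP H).
apply: sub_Cpre_star.
apply/subsetP => y; rewrite inE => /asboolP vy; have [_ _] := hV _ _ vy.
rewrite inE; case: ifP => _.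
  move=> [s' ys' /cov[z zU [z1 zc]]]; apply/existsP; exists z.
  by rewrite zU z1 ys'.
move=> h; apply/forallP => s'; apply/implyP => /h /cov[z zU [z1 zc]].
by apply/existsP; exists z; rewrite zU z1 eqxx.
Qed.

Lemma search1 n (G : game) C : (search n (encode G) C).1 =
  if n is n'.+1 then
    if [seq x <- (cpre_fixpoint (encode G) C).1 | x.1 == init G] is x :: _
    then Some (extract (encode G) (cpre_fixpoint (encode G) C).1 x).1
    else (search n' (encode G) C.+1).1
  else None.
Proof.
case: n => // n.
rewrite -[LHS]/((if (findM (fun x =>
  eq_state x.1 (init G)) (cpre_fixpoint (encode G) C).1).1
   is Some x then let! m :=
     extract (encode G) (cpre_fixpoint (encode G) C).1 x in ret (Some m)
   else let! C' := nadd C 1 in let! m := npred n.+1 in search n (encode G) C').1).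
rewrite findM1; case: [seq x <- _ | _] => [|x s] //=.
by rewrite addn1.
Qed.

Lemma search_some n (G : game) C m : (search n (encode G) C).1 = Some m ->
  exists C' x, [/\ C' < C + n, x \in (cpre_fixpoint (encode G) C').1, x.1 = init G
    & m = (extract (encode G) (cpre_fixpoint (encode G) C').1 x).1].
Proof.
elim: n C => // n IH C; rewrite search1.
have hin x : x \in [seq x <- (cpre_fixpoint (encode G) C).1 | x.1 == init G] ->
   x \in (cpre_fixpoint (encode G) C).1 /\ x.1 = init G.
  by rewrite mem_filter => /andP[/eqP ? ?].
case: [seq x <- _ | _] hin => [_ /IH[C' [x []]]|x s hin [<-]].
  by rewrite addSnnS => *; exists C', x.
exists C, x; have [] := hin x (mem_head _ _); split=> //.
by rewrite -addSnnS leq_addr.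
Qed.

(** The search may succeed before it reaches the constant [C']; only the existence of a result is
    claimed. *)
Lemma search_complete n (G : game) C : 
  (exists C' x, [/\ C <= C' < C + n, x \in (cpre_fixpoint (encode G) C').1 &
    x.1 = init G]) ->
  exists m, (search n (encode G) C).1 = Some m.
Proof.
elim: n C => [|n IH] C [C' [x [/andP[h1 h2] xV x1]]].
  by rewrite addn0 ltnNge h1 in h2.
rewrite search1; case e: [seq x <- _ | _] => [|y s]; last by eexists.
apply: IH; exists C', x; split=> //; rewrite addSnnS h2 andbT ltn_neqAle h1 andbT.
apply/eqP => CC; move: e; rewrite CC => e.
have : x \in [seq x <- (cpre_fixpoint (encode G) C').1 | x.1 == init G].
  by rewrite mem_filter x1 eqxx.
by rewrite e.
Qed.

Lemma npow1 x n : (npow x n).1 = x ^ n.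
Proof.
by elim: n => //= n ->; rewrite expnS.
Qed.

Section TableQuantities.
Variable G : game.
Local Notation k := (wdim G).
Local Notation t := (encode G).

Lemma foldl_maxn (A : Type) (f : A -> nat) r s :
  foldl (fun r x => maxn r (f x)) r s = maxn r (\max_(x <- s) f x).
Proof. by elim: s r => [|x s IH] r /=;
  rewrite ?big_nil ?maxn0 // IH big_cons maxnA. Qed.

Lemma max_weight1 : (max_weight t).1 = \max_(a <- tedges t) \max_(z <- a.2) `|z|%N.
Proof.
rewrite /max_weight foldM1 -[RHS]max0n -foldl_maxn.
have H r : forall s : seq (G * G * seq int),
    foldl (fun b x => (foldM (fun r' z => nmax r' `|z|%N) b x.2).1) r s =
    foldl (fun r x => maxn r (\max_(z <- x.2) `|z|%N)) r s.
  move=> s; elim: s r => //= a s IH r; rewrite IH foldM1; congr foldl.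
  exact: (foldl_maxn (fun z : int => `|z|%N)).
exact: H.
Qed.

Lemma weight_max s s' (j : 'I_k) : edge s s' ->
  (`|weight s s' 0 j| <= Posz (max_weight t).1)%R.
Proof.
move=> es; rewrite -abszE lez_nat max_weight1.
have aE : (s, s', wlist s s') \in tedges t by rewrite mem_tedges /= es eqxx.
apply: leq_trans (leq_bigmax_seq (F := fun a : G * G * seq int =>
  \max_(z <- a.2) `|z|%N) _ aE isT).
apply: (leq_bigmax_seq (F := fun z : int => `|z|%N)) => //.
by apply: map_f; rewrite mem_enum.
Qed.

Lemma max_weight_le B :
  (forall s s' (j : 'I_k), edge s s' -> `|weight s s' 0%R j|%N <= B) ->
  (max_weight t).1 <= B.
Proof.
move=> h; rewrite max_weight1; apply/bigmax_leqP_seq => a.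
rewrite mem_tedges => /andP[ea /eqP ->] _; apply/bigmax_leqP_seq => z /mapP[j _ ->] _.
exact: h.
Qed.

Lemma size_out_edges s : size (out_edges t s).1 = #|edge s|.
Proof.
rewrite out_edges1 /= -(size_map (fun a : G * G * seq int => a.1.2)) cardE.
apply/perm_size/uniq_perm; rewrite ?enum_uniq //.
  rewrite map_inj_in_uniq.
    apply: filter_uniq; rewrite map_inj_in_uniq.
      exact: filter_uniq (enum_uniq _).
    by move=> [a b] [c d] _ _ /= [-> ->].
  move=> [[a b] c] [[a' b'] c']; rewrite !mem_filter !mem_tedges /=.
  by move=> /andP[/eqP -> /andP[_ /eqP ->]] /andP[/eqP -> /andP[_ /eqP ->]] ->.
move=> s'; rewrite mem_enum -[RHS]/(edge s s'); apply/mapP/idP => [[a]|e].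
  by rewrite mem_filter mem_tedges => /andP[/eqP <- /andP[e _]] ->.
by exists (s, s', wlist s s') => //; rewrite mem_filter mem_tedges /= e !eqxx.
Qed.

Lemma max_outdegree1 : (max_outdegree t).1 = \max_(s : G) #|edge s|.
Proof.
rewrite /max_outdegree foldM1 -[RHS]max0n -[in RHS]big_enum -(foldl_maxn (fun s =>
  #|edge s|)) /=.
have H r : forall l : seq G, foldl (fun b sb => (let! A := out_edges t sb.1 in
      let! d := lengthM A in nmax b d).1) r [seq (s, s \in pl1 G) | s <- l] =
    foldl (fun r s => maxn r #|edge s|) r l.
  move=> l; elim: l r => //= s l IH r; rewrite IH; congr foldl.
  by rewrite -size_out_edges.
exact: H.
Qed.

Lemma depth_bound1 c : (depth_bound c t).1 =
  2 ^ ((\max_(s : G) #|edge s|).-1 * #|G|) *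
  (maxn 1 (max_weight t).1 * #|G| + 1) ^ (c * (maxn 1 k * maxn 1 k)).
Proof.
rewrite -max_outdegree1 /depth_bound -!npow1 cardE -(size_map (fun s =>
  (s, s \in pl1 G))).
by [].
Qed.

(** Compares the exponent of [secured_positional] with that of the depth bound. *)
Lemma sum_outdegree_le (A : {set G}) :
  \sum_(s in A) (#|edge s|.-1) <= (\max_(s : G) #|edge s|).-1 * #|G|.
Proof.
apply: (@leq_trans (\sum_(s : G) (\max_(s : G) #|edge s|).-1)).
  apply: (@leq_trans (\sum_(s : G) (#|edge s|.-1))).
    by rewrite [X in _ <= X](bigID (fun s => s \in A)) leq_addr.
  by apply: leq_sum => s _; rewrite -!subn1 leq_sub2r // leq_bigmax.
by rewrite sum_nat_const mulnC cardE.
Qed.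

End TableQuantities.

Lemma fact_leq_exp2 k : k`! <= 2 ^ (k * k).
Proof.
elim: k => // k IH; rewrite factS (_ : k.+1 * k.+1 = (k + k).+1 + k * k); last lia.
rewrite expnD; apply: leq_mul IH; apply: (@leq_trans (2 ^ k.+1));
  first exact/ltnW/ltn_expl.
by rewrite leq_exp2l // ltnS leq_addr.
Qed.

(** With Y = W n + 1, the factors n and n W are at most Y, k! is at most Y ^ (k ^ 2), and k and (n
    W) ^ k are at most Y ^ k. The products and sums stay below Y ^ (k ^ 2 + 2 k + 5), and this
    exponent is at most 8 times the square of max(1, k), with equality for k = 1: this is the origin
    of the constant 8. *)
Lemma walk_bound_le k n W : 0 < n -> 0 < W ->
  n + walk_bound k n W <= (W * n + 1) ^ (8 * (maxn 1 k * maxn 1 k)).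
Proof.
move=> n0 W0; set Y := W * n + 1.
have Y2 : 2 <= Y by rewrite /Y addn1 ltnS muln_gt0 W0.
have Y0 : 0 < Y by apply: ltnW.
have Yn : n <= Y ^ 1 by rewrite /Y expn1 addn1; apply: leqW; rewrite leq_pmull.
have YnW : n * W <= Y ^ 1 by rewrite expn1 mulnC /Y addn1.
have Y2e e : 2 ^ e <= Y ^ e by case: e => // e; rewrite leq_exp2r.
have Yk : k <= Y ^ k by apply: leq_trans (ltnW (ltn_expl k (isT : 1 < 2))) (Y2e k).
have Yf : k`! <= Y ^ (k * k) by apply: leq_trans (fact_leq_exp2 k) (Y2e _).
have YnWk : (n * W) ^ k <= Y ^ k by case: (k) => // k'; rewrite leq_exp2r // -[Y]expn1.
have mulY a b x y : a <= Y ^ x -> b <= Y ^ y -> a * b <= Y ^ (x + y).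
  by move=> *; rewrite expnD leq_mul.
have h1 : walk_bound k n W <= Y ^ (k * k + k + 2) + Y ^ (k * k + 2 * k + 3).
  have -> : walk_bound k n W = k`! * (n * W) ^ k * (n * n) +
      n * k * (k`! * (n * W) ^ k * (n * (n * W))).
    by rewrite /walk_bound -!mulnA.
  apply: leq_add.
    exact: (mulY _ _ _ _ (mulY _ _ _ _ Yf YnWk) (mulY _ _ _ _ Yn Yn)).
  have -> : k * k + 2 * k + 3 = 1 + k + (k * k + k + (1 + 1)) by lia.
  exact: (mulY _ _ _ _ (mulY _ _ _ _ Yn Yk)
            (mulY _ _ _ _ (mulY _ _ _ _ Yf YnWk) (mulY _ _ _ _ Yn YnW))).
set K := maxn 1 k; have [K1 kK] : 1 <= K /\ k <= K by rewrite /K leq_maxl leq_maxr.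
have kkKK : k * k <= K * K by apply: leq_mul.
have KKK : K <= K * K by apply: leq_pmulr.
have mono x y : x <= y -> Y ^ x <= Y ^ y by move=> ?; rewrite leq_exp2l.
have dbl x : Y ^ x + Y ^ x <= Y ^ x.+1 by rewrite addnn -mul2n expnS leq_mul2r Y2 orbT.
apply: (@leq_trans (Y ^ (k * k + 2 * k + 5))); last by apply: mono; lia.
have -> : k * k + 2 * k + 5 = (k * k + 2 * k + 4).+1 by lia.
apply: leq_trans (dbl _); apply: leq_add; first by apply: leq_trans Yn _;
  apply: mono; lia.
apply: leq_trans h1 _; have -> : k * k + 2 * k + 4 = (k * k + 2 * k + 3).+1 by lia.
by apply: leq_trans (dbl _); apply: leq_add; apply: mono; lia.
Qed.

(** Its states are definitionally those of [G], so that plays and strategies of the two games are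
    the same objects. *)
Definition ext_game (G : pgame) (l : nat) (qs : seq nat) : game :=
  Game (pl1 G) (init G) (@edge_total G)
    (parity_ext (@weight G) (@prio G) l qs).

Lemma wlist_ext (G : pgame) l qs (s s' : G) :
  @wlist (ext_game G l qs) s s' =
  wlist s s' ++ [seq (parity_weight l (prio s) q).1 | q <- qs].
Proof.
have sz : size (wlist s s') = wdim G by apply: size_wlist.
apply: (@eq_from_nth _ 0%R) => [|i].
  by rewrite size_wlist size_cat sz size_map.
rewrite size_wlist => ik; rewrite -[i]/(val (Ordinal ik)) nth_wlist /= mxE nth_cat sz.
case: splitP => j /= ij.
  by rewrite ij ltn_ord nth_wlist.
by rewrite ij ltnNge leq_addr /= addKn mxE (nth_map 0).
Qed.

Lemma lookup_prio1 (G : pgame) (s : G) : (lookup_prio (encode_prio G) s).1 = prio s.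
Proof.
rewrite -[LHS]/(if (findM (fun x : G * nat =>
  eq_state x.1 s) (encode_prio G)).1 is Some x
  then x.2 else 0) findM1.
have := ohead_filterP (fun x : G * nat => (x.1 == s)) (encode_prio G).
case: ohead => [x [/mapP[s' _ ->] /= /eqP ->]//|/hasPn /(_ (s, prio s))] /=.
by rewrite eqxx => H; have := H (map_f _ (mem_enum _ s)).
Qed.

Definition odd_prios (G : pgame) : seq nat := (odd_priorities (encode_prio G)).1.

Lemma odd_priosP (G : pgame) : [/\ uniq (odd_prios G), all odd (odd_prios G),
  {subset odd_prios G <= [seq prio s | s <- enum G]} & forall s : G, odd (prio s) ->
    prio s \in odd_prios G].
Proof.
rewrite /odd_prios /odd_priorities foldM1 /encode_prio.
set f := (fun b x => _).
have fE qs (x : G * nat) : f qs x = if odd x.2 then if x.2 \in qs then qs else x.2 ::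
  qs else qs.
  rewrite /f; case: (odd x.2) => //.
  have -> : (x.2 \in qs) = (hasM (neq x.2) qs).1.
    by rewrite hasM1 -has_pred1; apply: eq_has => q; rewrite /= eq_sym.
  by rewrite bind1; case: (hasM _ _).1.
suff H l qs : uniq qs -> all odd qs ->
   let r := foldl f qs [seq (s, prio s) | s <- l] in
   [/\ uniq r, all odd r, {subset qs <= r}, {subset r <= qs ++ [seq prio s | s <- l]}
     & forall s, s \in l -> odd (prio s) -> prio s \in r].
  have [h1 h2 _ h3 h4] := H (enum G) [::] isT isT; split=> // s.
  by apply: h4; rewrite mem_enum.
elim: l qs => [|s l IH] qs uq oq /=; first by split=> // q; rewrite cats0.
have [uq' oq'] : uniq (f qs (s, prio s)) /\ all odd (f qs (s, prio s)).
  rewrite fE /=; case: ifP => // os; case: ifPn => // h; rewrite /= h os; by split.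
have sub : {subset qs <= f qs (s, prio s)}.
  move=> q qq; rewrite fE /=; case: ifP => // _; case: ifP => // _.
  by rewrite inE qq orbT.
have [h1 h2 h3 h4 h5] := IH _ uq' oq'; split=> //.
- by move=> q /sub /h3.
- move=> q /h4; rewrite !mem_cat inE fE /=; case: ifP => _; last by case/orP => ->;
    rewrite ?orbT.
  case: ifP => _; first by case/orP => ->; rewrite ?orbT.
  by rewrite inE -orbA orbCA.
- move=> s'; rewrite inE => /orP[/eqP->|]; last exact: h5.
  by move=> os; apply: h3; rewrite fE /= os; case: ifP => // _; rewrite mem_head.
Qed.

(** The table that the algorithm computes is thus the encoding of a game, to which the results on
    energy games apply. *)
Lemma remove_parity1 c (G : pgame) : (remove_parity c (encode G) (encode_prio G)).1 =
  encode (ext_game G (depth_bound c (encode G)).1 (odd_prios G)).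
Proof.
set l := (depth_bound c (encode G)).1.
have -> : (remove_parity c (encode G) (encode_prio G)).1 =
   Table (tstates (encode G)) (tinit (encode G)) (wdim G + size (odd_prios G))
     (mapM (fun a : G * G * seq int =>
              let! p := lookup_prio (encode_prio G) a.1.1 in
              let! u := mapM (parity_weight l p) (odd_prios G) in
              let! w := catM a.2 u in
              ret (a.1, w)) (tedges (encode G))).1 by [].
rewrite mapM1 /encode; congr Table; rewrite -map_comp; apply: eq_map => a.
transitivity (a.1, a.2, wlist a.1 a.2 ++
  (mapM (parity_weight l (lookup_prio (encode_prio G) a.1).1) (odd_prios G)).1);
    first by [].
by rewrite lookup_prio1 mapM1 -wlist_ext.
Qed.

(** * Soundness and completeness for energy parity games *)

Section EnergyParity.
Variable G : pgame.
Let l := (depth_bound 8 (encode G)).1.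
Let H := ext_game G l (odd_prios G).
Let cap := 2 * (depth_bound 8 (encode H)).1 * (max_weight (encode H)).1.

Lemma CpreFP1 : (CpreFP_energy_parity 8 (encode G) (encode_prio G)).1 =
  (search cap.+1 (encode H) 0).1.
Proof.
have -> : (CpreFP_energy_parity 8 (encode G) (encode_prio G)).1 =
  (CpreFP_energy 8 (remove_parity 8 (encode G) (encode_prio G)).1).1 by [].
by rewrite remove_parity1.
Qed.

Lemma EL_ext_l (pi : nat -> G) n (j : 'I_(wdim G)) :
  EL (G := H) pi n 0%R (lshift _ j) = EL (G := G) pi n 0%R j.
Proof.
by rewrite /EL !summxE; apply: eq_bigr => i _; rewrite row_mxEl.
Qed.

Lemma EL_ext_r (pi : nat -> G) n (j : 'I_(size (odd_prios G))) :
  EL (G := H) pi n 0%R (rshift _ j) =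
  (\sum_(i < n) (parity_weight l (prio (pi i)) (nth 0 (odd_prios G) j)).1)%R.
Proof.
by rewrite /EL summxE; apply: eq_bigr => i _; rewrite row_mxEr mxE.
Qed.

Lemma par_exists (pi : nat -> G) : exists q, is_Par pi q.
Proof.
have [s [_ infs]] : exists s : G, True /\ forall N, exists2 n, N <= n & pi n = s.
  by apply: (@recurrent_state _ pi (fun _ => True)) => N; exists N.
have ex : exists q, `[< inf_often pi q >].
  exists (prio s); apply/asboolP => N; have [n Nn e] := infs N.
  by exists n; rewrite ?e.
case: (ex_minnP ex) => q /asboolP iq mq; exists q; split=> // q' iq'.
by apply: mq; apply/asboolP.
Qed.

Lemma eventually_ge (pi : nat -> G) q : is_Par pi q ->
  exists N, forall n, N <= n -> q <= prio (pi n).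
Proof.
move=> [_ mq]; have [N hN] : exists N, forall n, N <= n -> ~ prio (pi n) < q.
  apply: (@eventually_avoids _ pi (fun s => prio s < q)) => s lt.
  apply: contrapT => nN; have : q <= prio s; last by rewrite leqNgt lt.
  apply: mq => M; apply: contrapT => nn; apply: nN; exists M => n Mn e.
  by apply: nn; exists n; rewrite ?e.
by exists N => n /hN /negP; rewrite -leqNgt.
Qed.

(** If the least recurrent priority [q] were odd, no smaller priority would occur from some point
    on: the dimension of [q] would never gain again, yet lose 1 at each of infinitely many
    visits. *)
Lemma energy_par_even (pi : nat -> G) (e : nat -> nat) :
  (forall n (j : 'I_(wdim H)), (0 <= Posz (e j) + EL (G := H) pi n 0 j)%R) ->
    Par_even pi.
Proof.
move=> safe; have [q Pq] := par_exists pi; exists q => //; apply/negP => oq.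
have [N hN] := eventually_ge Pq; have [iq _] := Pq.
have qin : q \in odd_prios G.
  have [_ _ _ h] := odd_priosP G; have [n _ e1] := iq 0.
  by rewrite -e1; apply: h; rewrite e1.
pose j := Ordinal (etrans (index_mem q (odd_prios G)) qin).
have qj : nth 0 (odd_prios G) j = q by rewrite nth_index.
pose w (s : G) := (parity_weight l (prio s) q).1.
pose f n : int := (\sum_(i < n) w (pi i))%R.
have safe' n : (- Posz (e (rshift (wdim G) j)) <= f n)%R.
  have := safe n (rshift (wdim G) j); rewrite EL_ext_r qj.
  by rewrite -[X in (_ + X)%R]/(f n) addrC -lerBlDr sub0r.
have fS n : f n.+1 = (f n + w (pi n))%R by rewrite /f big_ord_recr.
have w_le n : N <= n -> (w (pi n) <= 0)%R /\ (prio (pi n) = q -> w (pi n) = -1)%R.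
  move=> /hN h; rewrite /w /=; case: eqP => // ne; split=> //.
  by rewrite leqNgt ltn_neqAle h andbT eq_sym; case: eqP.
have dec n m : N <= n -> (f (n + m)%N <= f n)%R.
  move=> Nn; elim: m => [|m IH]; first by rewrite addn0.
  rewrite addnS fS; apply: le_trans IH; rewrite gerDl.
  by have [] := w_le (n + m) (leq_trans Nn (leq_addr _ _)).
have drop m : exists2 n, N <= n & (f n <= f N - Posz m)%R.
  elim: m => [|m [n Nn fn]]; first by exists N; rewrite ?subr0.
  have [n' nn' e1] := iq n; exists n'.+1; first by apply: leqW; apply: leq_trans nn'.
  have [_ /(_ e1) wn] := w_le n' (leq_trans Nn nn').
  have := dec n (n' - n) Nn; rewrite subnKC // fS wn => d; lia.
have [n _] := drop (`|f N| + e (rshift (wdim G) j)).+1%N.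
have := safe' n; lia.
Qed.

Lemma size_antichain (K : game) C (V : seq (K * seq nat)) :
  antichain_rep (G := K) C V -> size V <= #|K| * C.+1 ^ wdim K.
Proof.
move=> [uV wV _]; rewrite -(card_config K C) cardE -(size_map (@listing K C)).
apply: uniq_leq_size => // y yV; have [x <-] := vector_config (allP wV y yV).
by apply: map_f; rewrite mem_enum.
Qed.

Lemma CpreFP_sound (m : machine G) :
  (CpreFP_energy_parity 8 (encode G) (encode_prio G)).1 = Some m ->
  [/\ is_strategy (G := G) (moore_strategy (decode_machine m)),
      #|mstate (decode_machine m)| <= (#|G| * cap.+1 ^ (wdim G + size (odd_prios G))).+1
    & forall pi, consistent (G := G) (moore_strategy (decode_machine m)) pi ->
        energy_safe (decode_credit m) pi /\ Par_even pi].
Proof.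
rewrite CpreFP1 => hm; have [C [x [Ccap xV x1 em]]] := @search_some cap.+1 H 0 m hm.
have rV := cpre_fixpoint_represents H C.
have := machine_is_strategy rV xV; have := machine_safe rV xV x1.
have := machine_card (cpre_fixpoint (encode H) C).1 x.
rewrite -em => card safe strat; have ex : x = x_start m by rewrite em.
split.
- exact: strat.
- apply: leq_trans card _.
  rewrite ltnS; apply: leq_trans (size_antichain rV.1) _; rewrite leq_mul2l.
  apply/orP; right; move: Ccap; rewrite add0n.
  rewrite [wdim _]/=; case: (wdim G + _) => // k' Ccap; by rewrite leq_exp2r.
- move=> pi cpi; have {}safe := safe pi cpi.
  split; last exact: energy_par_even safe.
  by move=> n j; have := safe n (lshift _ j); rewrite EL_ext_l mxE ex.
Qed.

(** The power of 2 in the depth bound pays for the splitting of states, the other factor for the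
    length of the lassos. That length is bounded with the weights and the dimension of [G], which
    are then compared with the larger ones of [H]. *)
Lemma cap_ge (A : {set G}) (W := maxn 1 (max_weight (encode G)).1) :
  2 ^ (\sum_(s in A) (#|edge s|.-1)) *
    (2 * ((#|G| + walk_bound (wdim G) #|G| W) * (max_weight (encode H)).1)) <= cap.
Proof.
rewrite /cap mulnCA -[X in _ <= X]mulnA leq_pmul2l // mulnA; apply: leq_mul => //.
rewrite depth_bound1; apply: leq_mul.
  by rewrite leq_exp2l //; apply: sum_outdegree_le.
have n0 : 0 < #|G| by apply/card_gt0P; exists (init G).
have W0 : 0 < W by rewrite leq_maxl.
apply: leq_trans (walk_bound_le _ n0 W0) _; rewrite -[#|H|]/(#|G|).
set W' := maxn 1 (max_weight (encode H)).1.
have WW : W <= W'.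
  rewrite geq_max leq_maxl /=; apply: leq_trans (leq_maxr _ _).
  apply: max_weight_le => s s' j es; rewrite -lez_nat abszE.
  by have := @weight_max H s s' (lshift _ j) es; rewrite row_mxEl.
have KK : maxn 1 (wdim G) <= maxn 1 (wdim H).
  by rewrite geq_max leq_maxl /=; apply: leq_trans (leq_maxr _ _); apply: leq_addr.
apply: (@leq_trans ((W' * #|G| + 1) ^ (8 * (maxn 1 (wdim G) * maxn 1 (wdim G))))).
  set e := _ * (_ * _); case: e => // e;
    rewrite leq_exp2r // leq_add2r leq_mul2r WW orbT //.
by apply: leq_pexp2l; [rewrite addn1 | rewrite leq_mul2l /= leq_mul].
Qed.

Lemma CpreFP_complete (X : {set G}) : init G \in X ->
  (forall tau : G -> G, {in X, forall s, s \notin pl1 G -> edge s (tau s)} ->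
     {in X, forall s, exists pi : nat -> G, [/\ pi 0 = s,
       forall n, positional (pl1 G) (@edge G) tau (pi n) (pi n.+1), forall n, pi n \in X
       & even_loop (@weight G) (@prio G) pi 0]}) ->
  exists m, (CpreFP_energy_parity 8 (encode G) (encode_prio G)).1 = Some m.
Proof.
move=> iX hX; pose W := maxn 1 (max_weight (encode G)).1.
have W0 : 0 < W by rewrite leq_maxl.
have n0 : 0 < #|G| by apply/card_gt0P; exists (init G).
have [_ oq _ _] := odd_priosP G.
have hl : walk_bound (wdim G) #|G| W <= l.
  apply: leq_trans (leq_addl #|G| _) _; apply: leq_trans (walk_bound_le _ n0 W0) _.
  by rewrite /l depth_bound1 leq_pmull // expn_gt0.
have hW s s' (j : 'I_(wdim G)) : edge s s' -> (`|weight s s' 0 j| <= W%:Z)%R.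
  move=> es; apply: le_trans (weight_max j es) _; by rewrite lez_nat leq_maxr.
have sec := secured_parity W0 oq hW (fun s s' j => @weight_max H s s' j) hl
  (fun s _ _ => edge_total s) hX.
have [x xU x1] := @secured_Cpre_star H X _ cap sec (cap_ge _) iX.
have [_ hU] := cpre_fixpoint_represents H cap.
move: xU; rewrite hU => /hasP[y yV /andP[/eqP y1 _]].
have [|m hm] := @search_complete cap.+1 H 0; last by exists m; rewrite CpreFP1;
  exact: hm.
by exists cap, y; split=> //; [rewrite add0n ltnS leqnn | rewrite y1].
Qed.

End EnergyParity.

(** * Plays against an opponent who becomes positional *)

Section Reached.
Variables (G : game) (sigma : seq G -> G).
Hypothesis strat : is_strategy sigma.

(** A finite prefix is kept as a full sequence, of which only the values up to [n] matter. *)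
Definition consistent_until (pi : nat -> G) (n : nat) : Prop :=
  pi 0 = init G /\ forall m, m < n ->
    edge (pi m) (pi m.+1) /\ (pi m \in pl1 G -> pi m.+1 = sigma (prefix_of pi m)).

Definition reached : {set G} :=
  [set s | `[< exists pi n, consistent_until pi n /\ pi n = s >]].

Lemma init_reached : init G \in reached.
Proof. by rewrite inE; apply/asboolP; exists (fun _ => init G), 0; split. Qed.

Lemma prefix_path pi n : consistent_until pi n ->
  exists2 rho, prefix_of pi n = init G :: rho &
    path (@edge G) (init G) rho /\ last (init G) rho = pi n.
Proof.
move=> [pi0 h]; exists [seq pi i | i <- iota 1 n];
  first by rewrite /prefix_of /mkseq /= pi0.
have : forall m, m <= n -> path (@edge G) (pi 0) [seq pi i | i <- iota 1 m] /\
     last (pi 0) [seq pi i | i <- iota 1 m] = pi m.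
  elim=> [//|m IH] mn; have [p1 p2] := IH (ltnW mn).
  rewrite -[m.+1]addn1 iotaD map_cat cat_path last_cat p1 p2 /= add1n andbT.
  by rewrite addn1; have [] := h m mn.
by rewrite -pi0; apply.
Qed.

(** The play follows a consistent prefix up to [s], and only then does player 2 switch to [tau]. So
    the whole play is consistent with [sigma], and its tail from [N] on is a play from [s] inside
    [reached] in the positional game. *)
Lemma positional_play (tau : G -> G) s :
  {in reached, forall s, s \notin pl1 G -> edge s (tau s)} -> s \in reached ->
  exists pi N, [/\ consistent sigma pi, pi N = s, forall n, pi n \in reached
    & forall n, N <= n -> pi n \notin pl1 G -> pi n.+1 = tau (pi n)].
Proof.
move=> htau; rewrite inE => /asboolP[pi0 [N [[i0 c0] sN]]].
pose nx (R : seq G) := if last (init G) R \in pl1 G then sigma R else tau (last (init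
  G) R).
(* The recursion builds prefixes instead of states, because [sigma] reads the whole history. *)
pose fix R n := if n is n'.+1 then rcons (R n') (if n' < N then pi0 n'.+1 else nx (R
  n'))
                else [:: init G].
pose pi n := last (init G) (R n).
have Rpi n : R n = prefix_of pi n.
  by elim: n => // n IH;
    rewrite /prefix_of mkseqS -/(prefix_of pi n) -IH /pi /= last_rcons.
have piS n : pi n.+1 = if n < N then pi0 n.+1 else nx (R n) by rewrite /pi /=
  last_rcons.
have pie n : n <= N -> pi n = pi0 n.
  by case: n => [|n nN]; [rewrite i0 | rewrite piS nN].
have pre n : n <= N -> prefix_of pi n = prefix_of pi0 n.
  move=> nN; apply: (@eq_from_nth _ (init G)); rewrite !size_mkseq // => i iN.
  by rewrite !nth_mkseq // pie //; apply: leq_trans nN.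
have cu n : consistent_until pi n.
  split=> [//|]; elim: n => // n IH m; rewrite ltnS leq_eqVlt => /orP[/eqP->|];
    last exact: IH.
  have [lt|ge] := ltnP n N.
    have [e1 e2] := c0 n lt; rewrite pie 1?ltnW // pie // pre 1?ltnW //.
  have cn : consistent_until pi n by split.
  have rn : pi n \in reached by rewrite inE; apply/asboolP; exists pi, n.
  rewrite piS ltnNge ge /= /nx -/(pi n); case: ifPn => pp; last by split=> //;
    apply: htau.
  split; last by rewrite -Rpi.
  have [rho e1 [p1 p2]] := prefix_path cn.
  by rewrite Rpi e1 -p2; apply: strat => //; rewrite p2.
exists pi, N; split.
- by split=> [|n pp]; [split=> // n|];
    have [_ /(_ n (ltnSn n)) []] := cu n.+1 => // _; exact.
- by rewrite pie.
- by move=> n; rewrite inE; apply/asboolP; exists pi, n.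
- by move=> n Nn np; rewrite piS ltnNge Nn /= /nx -/(pi n) (negPf np).
Qed.

End Reached.

Lemma even_loop_shift (S : finType) k (w : S -> S -> 'rV[int]_k) (prio : S ->
  nat) pi N :
  even_loop w prio pi N -> even_loop w prio (fun n => pi (N + n)) 0.
Proof.
move=> [i [j [/andP[Ni ij] eij w0 ev mi]]].
have Nj : N <= j by apply: leq_trans (ltnW ij).
exists (i - N), (j - N); rewrite !subnKC //; split=> //.
- by rewrite leq0n ltn_sub2r // (leq_ltn_trans Ni).
- move=> r; have := w0 r; rewrite -{1}(subnK Ni) big_addn.
  rewrite (eq_bigr (fun t => w (pi (N + t)) (pi (N + t.+1)))) // => t _.
  by rewrite addnS addnC.
- by move=> t h; apply: mi; lia.
Qed.

(** The criterion shared by the two objectives: it suffices to find an even loop in the tail of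
    every consistent play on which player 2 has become positional. *)
Lemma CpreFP_complete_strategy (G : pgame) (sigma : seq G -> G) : is_strategy sigma ->
  (forall pi N (tau : G -> G), consistent sigma pi ->
     (forall n, N <= n -> pi n \notin pl1 G -> pi n.+1 = tau (pi n)) ->
     even_loop (@weight G) (@prio G) pi N) ->
  exists m, (CpreFP_energy_parity 8 (encode G) (encode_prio G)).1 = Some m.
Proof.
move=> strat H; apply: (@CpreFP_complete G (reached sigma)); first exact: init_reached.
move=> tau htau s sX; have [pi [N [cpi piN piX pit]]] := positional_play strat htau sX.
exists (fun n => pi (N + n)); split=> //.
- by rewrite addn0.
- move=> n; rewrite /positional /= addnS; have [[_ -> //] _] := cpi.
  by case: (boolP (pi (N + n) \in pl1 G)) => //= np; rewrite pit // leq_addr.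
- exact: even_loop_shift (H _ _ _ cpi pit).
Qed.

Lemma energy_complete (G : pgame) sigma v0 : energy_parity_winning (G := G) sigma v0 ->
  exists m, (CpreFP_energy_parity 8 (encode G) (encode_prio G)).1 = Some m.
Proof.
move=> [strat win]; apply: (CpreFP_complete_strategy strat) => pi N tau cpi _.
have [safe [q [iq mq] ev]] := win _ cpi.
apply: (@energy_even_loop _ _ _ _ pi v0 q N) => // n j.
by have := safe n j; rewrite /EL big_mkord.
Qed.

(** * Mean payoff *)

Section InferiorLimit.
Import classical_sets topology.

Lemma limn_einf_geP (R : realType) (u : nat -> R) (v : R) :
  (v%:E <= limn_einf (fun n => (u n)%:E))%E <->
  forall e, (0 < e)%R -> exists n, forall m, n <= m -> (v - e <= u m)%R.
Proof.
rewrite limn_einf_lim.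
have -> : limn (einfs (fun n => (u n)%:E)) = ereal_sup (range (einfs (fun n =>
  (u n)%:E))).
  by apply/cvg_lim => //; apply: cvg_einfs_sup.
split=> [h e e0|h].
  have : ((v - e)%:E < ereal_sup (range (einfs (fun n => (u n)%:E))))%E.
    by apply: lt_le_trans h; rewrite lte_fin ltrBlDr ltrDl.
  move=> /ereal_sup_gt[_ [n _ <-]] lt; exists n => m nm.
  rewrite -lee_fin; apply: le_trans (ltW lt) _; apply: ereal_inf_lbound.
  by exists m.
apply/lee_addgt0Pr => e e0; have [n hn] := h e e0.
rewrite -leeBlDr //; apply: le_trans (ereal_sup_ubound _); last by exists n.
by apply: le_ereal_inf_tmp => _ [m /= nm <-]; rewrite -EFinB lee_fin hn.
Qed.

End InferiorLimit.

Section MeanPayoff.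
Variables (R : realType) (x y : nat -> int) (b bv : int) (v : rat).
Hypotheses (b0 : (0 < b)%R) (bvE : (bv%:~R = b%:~R * v :> rat)%R).
Hypothesis yE : forall n, (y n = b * x n - n%:Z * bv)%R.

Let yR n : ((y n)%:~R = b%:~R * ((x n)%:~R - n%:R * ratr v) :> R)%R.
Proof.
rewrite yE rmorphB !rmorphM /= -(ratr_int R bv) bvE rmorphM /= ratr_int -pmulrn.
ring.
Qed.

Let bR0 : (0 < b%:~R :> R)%R. Proof. by rewrite ltr0z. Qed.

(** The bound on [y n] says that x n / n is at least v - c / (b n), and the last term falls below
    any [e]. *)
Lemma mean_payoff_ge (c : nat) : (forall n, - c%:Z <= y n)%R ->
  ((ratr v)%:E <= limn_einf (fun n => (((x n)%:~R / n%:R)%R : R)%:E))%E.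
Proof.
move=> yc; apply/limn_einf_geP => e e0.
exists (Num.truncn (c%:R / (b%:~R * e) : R)).+1 => m nm.
have m0 : (0 < m%:R :> R)%R by rewrite ltr0n; apply: leq_trans nm.
have be0 : (0 < b%:~R * e :> R)%R by apply: mulr_gt0.
rewrite ler_pdivlMr // -(ler_pM2l bR0).
have h1 : (- c%:R <= (y m)%:~R :> R)%R by have := yc m; rewrite -(ler_int R) mulrNz.
have h2 : (c%:R <= m%:R * (b%:~R * e) :> R)%R.
  rewrite -ler_pdivrMr //;
    apply: le_trans (_ : (Num.truncn (c%:R / (b%:~R * e) : R)).+1%:R <= _)%R.
    by rewrite ltW // truncnS_gt.
  by rewrite ler_nat.
move: h1; rewrite yR; move: (b%:~R)%R (x m)%:~R%R (ratr v) (m%:R)%R (c%:R)%R h2 => *;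
  nra.
Qed.

(** A negative integral drift is at most -1 for each period of [p] steps, which keeps the averages
    of [x] below [v] by about 1 / (b p) along the subsequence. *)
Lemma mean_payoff_drift (n0 p : nat) (d : int) : 0 < p ->
  (forall i, y (n0 + i * p) = y n0 + i%:Z * d)%R ->
  ((ratr v)%:E <= limn_einf (fun n => (((x n)%:~R / n%:R)%R : R)%:E))%E -> (0 <= d)%R.
Proof.
move=> p0 hy /limn_einf_geP H; rewrite leNgt; apply/negP => d0.
(* Half of the gap 1 / (b p); the other half makes up for the initial segment. *)
pose e : R := ((2 * p)%:R * b%:~R)^-1%R.
have e0 : (0 < e)%R by rewrite invr_gt0 mulr_gt0 // ltr0n muln_gt0.
have [m0 hm] := H e e0.
(* Enough periods to outweigh [y n0] and the [n0] initial steps, and to pass [m0]. *)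
pose i := (2 * (`|y n0| + n0) + m0).+1%N; pose m := n0 + i * p.
have mm : m0 <= m.
  by apply: leq_trans (leq_addl _ _); apply: (@leq_trans i); [rewrite /i;
    lia|rewrite leq_pmulr].
have mp : 0 < m by rewrite /m addn_gt0 muln_gt0 p0 orbT.
have mR : (0 < m%:R :> R)%R by rewrite ltr0n.
have := hm m mm; rewrite ler_pdivlMr // => h.
have h2 : (- m%:Z <= (2 * p)%N%:Z * y m)%R.
  rewrite -(ler_int R) mulrNz intrM yR -!pmulrn.
  have pe : ((2 * p)%:R * (b%:~R * e) = 1 :> R)%R.
    by rewrite mulrA mulfV // gt_eqF // mulr_gt0 // ltr0n muln_gt0.
  have P0 : (0 < (2 * p)%:R * b%:~R :> R)%R by rewrite mulr_gt0 // ltr0n muln_gt0.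
  have := ler_wpM2l (ltW P0) h.
  have -> : ((2 * p)%:R * b%:~R * ((ratr v - e) * m%:R) =
     (2 * p)%:R * b%:~R * (ratr v * m%:R) - (2 * p)%:R * (b%:~R * e) * m%:R :> R)%R
       by ring.
  by rewrite pe; move: (2 * p)%:R%R (b%:~R)%R (x m)%:~R%R (ratr v) (m%:R)%R => *; lra.
have {}h2 : (- m%:Z <= (2 * p)%N%:Z * (y n0 + i%:Z * d))%R by rewrite -hy.
have id : (i%:Z * d <= - i%:Z)%R.
  rewrite -[leRHS]mulrN1; apply: ler_wpM2l => //; lia.
have h3 : ((2 * p)%N%:Z * (y n0 + i%:Z * d) <= (2 * p)%N%:Z * (`|y n0|%N%:Z - i%:Z))%R.
  by apply: ler_wpM2l => //; lia.
have contra (a n i' : nat) : 2 * (a + n) < i' ->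
    ((2 * p)%N%:Z * (a%:Z - i'%:Z) < - (n + i' * p)%N%:Z)%R by nia.
have := contra `|y n0|%N n0 i; rewrite /i ltnS leq_addr => /(_ isT).
by rewrite ltNge (le_trans h2 h3).
Qed.

End MeanPayoff.

(** * Reduction of the mean-payoff threshold to energy *)

Section Threshold.
Variables (G : pgame) (v : 'rV[rat]_(wdim G)).
Local Notation k := (wdim G).

Definition common_den : int := (\prod_(j < k) denq (v 0 j))%R.

Definition scaled_threshold (j : 'I_k) : int :=
  ((numq (v 0%R j) * common_den)%R %/ denq (v 0%R j))%Z.

Definition threshold_weight (s s' : G) : 'rV[int]_k :=
  (\row_j (common_den * weight s s' 0 j - scaled_threshold j))%R.

Definition threshold_game : pgame :=
  PGame (arena := Game (pl1 G) (init G) (@edge_total G) threshold_weight) (@prio G).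

Lemma common_den_gt0 : (0 < common_den)%R.
Proof. by apply: prodr_gt0 => j _; apply: denq_gt0. Qed.

Lemma scaled_thresholdE j : ((scaled_threshold j)%:~R = common_den%:~R * v 0 j :>
  rat)%R.
Proof.
have d0 : denq (v 0%R j) != 0%R by apply: denq_neq0.
have dvd : (denq (v 0%R j) %| (numq (v 0%R j) * common_den)%R)%Z.
  by rewrite /common_den (bigD1 j) //= mulrCA dvdz_mulr.
apply: (@mulIf _ (denq (v 0 j))%:~R%R); first by rewrite intr_eq0.
rewrite -rmorphM /= divzK // rmorphM /= numqE; ring.
Qed.

Lemma common_den1 :
  (foldM (fun r (x : int * int) => zmul r x.2) 1%R (encode_rat v)).1 = common_den.
Proof.
rewrite foldM1 /common_den -big_enum /= /encode_rat.
have H (l : seq 'I_k) r : foldl (fun r (x : int * int) => (zmul r x.2).1) r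
    [seq (numq (v 0%R j), denq (v 0%R j)) | j <- l] =
    (r * \prod_(j <- l) denq (v 0 j))%R.
  by elim: l r => [|j l IH] r /=; rewrite ?big_nil ?mulr1 // IH big_cons mulrA.
by rewrite H mul1r.
Qed.

Lemma remove_threshold1 : (remove_threshold (encode G) (encode_rat v)).1 = encode
  threshold_game.
Proof.
have bvE : (mapM (fun x : int * int => let! y := zmul x.1 common_den in zdiv y x.2)
    (encode_rat v)).1 = [seq scaled_threshold j | j <- enum 'I_k].
  by rewrite mapM1 -map_comp.
have -> : (remove_threshold (encode G) (encode_rat v)).1 =
   Table (tstates (encode G)) (tinit (encode G)) k
     (mapM (fun a : G * G * seq int =>
        let! w := zipM (fun x y => let! z := zmul common_den x in zsub z y) a.2
          [seq scaled_threshold j | j <- enum 'I_k] in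
        ret (a.1, w)) (tedges (encode G))).1 by rewrite -bvE -common_den1.
rewrite mapM1 /encode; congr Table; rewrite -map_comp; apply: eq_map => a.
transitivity (a.1, a.2, (zipM (fun x y => let! z := zmul common_den x in zsub z y)
   (wlist a.1 a.2) [seq scaled_threshold j | j <- enum 'I_k]).1); first by [].
congr pair; rewrite zipM1 zip_map -map_comp; apply: eq_map => j /=.
by rewrite mxE.
Qed.

Lemma EL_threshold (pi : nat -> G) n j :
  (EL (G := threshold_game) pi n 0 j =
   common_den * EL (G := G) pi n 0 j - n%:Z * scaled_threshold j)%R.
Proof.
elim: n => [|n IH]; first by rewrite /EL !big_ord0 !mxE mulr0 mul0r subr0.
rewrite /EL !big_ord_recr /= mxE [in RHS]mxE -/(EL (G := threshold_game) pi n) IH.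
rewrite -/(EL (G := G) pi n) mxE -[n.+1]addn1 PoszD; ring.
Qed.

Lemma threshold_mp (R : realType) (pi : nat -> G) (c : 'I_k -> nat) :
  (forall n (j : 'I_k), (0 <= Posz (c j) + EL (G := threshold_game) pi n 0 j)%R) ->
  forall j, ((ratr (v 0%R j))%:E <= MP R pi j)%E.
Proof.
move=> safe j.
have h n : (- (c j)%:Z <= EL (G := threshold_game) pi n 0 j)%R by have := safe n j; lia.
exact: (mean_payoff_ge R common_den_gt0 (scaled_thresholdE j) (fun n =>
  EL_threshold pi n j) h).
Qed.

End Threshold.

Lemma finite_orbit (T : finType) (z : nat -> T) (F : T -> T) :
  (forall n, z n.+1 = F (z n)) -> exists i p, 0 < p /\ forall n, i <= n ->
    z (n + p) = z n.
Proof.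
move=> zF; have [i [j [ij zij]]] : exists i j, i < j /\ z i = z j.
  apply: contrapT => no.
  have inj : injective (fun i : 'I_(#|T|.+1) => z i).
    move=> i j zij; apply: val_inj; have [lt|lt|//] := ltngtP i j.
      by case: no; exists i, j.
    by case: no; exists j, i.
  by have := leq_card _ inj; rewrite card_ord ltnn.
exists i, (j - i); rewrite subn_gt0; split=> // n.
elim: n => [|n IH].
  by rewrite leqn0 => /eqP i0; move: zij; rewrite i0 subn0.
rewrite leq_eqVlt => /orP[/eqP <-|/IH e]; first by rewrite subnKC 1?ltnW.
by rewrite addSn !zF e.
Qed.

(** Once player 2 is positional, the pair of state and memory evolves by a function on a finite set,
    so the play is ultimately periodic. One period, taken from a visit to the least recurrent
    priority, is the loop: its weight is the drift of the scaled energy, which is nonnegative by the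
    mean-payoff condition. *)
Lemma moore_even_loop (R : realType) (G : pgame) (v : 'rV[rat]_(wdim G)) (M : moore G)
    (pi : nat -> G) N (tau : G -> G) :
  consistent (moore_strategy M) pi ->
  (forall j, ((ratr (v 0%R j))%:E <= MP R pi j)%E) -> Par_even pi ->
  (forall n, N <= n -> pi n \notin pl1 G -> pi n.+1 = tau (pi n)) ->
  even_loop (@weight (threshold_game v)) (@prio G) pi N.
Proof.
move=> [[pi0 hE] cs] hmp [q [iq mq] ev] ht.
pose mem n := foldl (mupd (m:=M)) (m0 M) [seq pi i | i <- iota 1 n].
have memS n : mem n.+1 = mupd (mem n) (pi n.+1).
  by rewrite /mem -[n.+1]addn1 iotaD map_cat foldl_cat add1n addn1.
have csM n : pi n \in pl1 G -> pi n.+1 = mnext (mem n) (pi n).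
  by move=> /cs ->; rewrite /moore_strategy /prefix_of mkseqS last_rcons -mkseqS.
pose F (z : G * mstate M) := let s :=
  if z.1 \in pl1 G then mnext z.2 z.1 else tau z.1 in
  (s, mupd z.2 s).
have zF n : (pi (N + n.+1), mem (N + n.+1)) = F (pi (N + n), mem (N + n)).
  rewrite addnS memS /F /=; case: ifPn => pp; first by rewrite -csM.
  by rewrite -ht // leq_addr.
have [i0 [p [p0 per]]] := finite_orbit (z := fun n => (pi (N + n), mem (N + n))) zF.
have perN n : N + i0 <= n -> pi (n + p) = pi n.
  move=> h; have Nn : N <= n by apply: leq_trans h; apply: leq_addr.
  have := per (n - N); rewrite leq_subRL // h => /(_ isT) [].
  by rewrite addnA subnKC.
have perm n i : N + i0 <= n -> pi (n + i * p) = pi n.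
  move=> h; elim: i => [|i IH]; first by rewrite mul0n addn0.
  by rewrite mulSn [(p + _)%N]addnC addnA perN // (leq_trans h) // leq_addr.
have [N1 hN1] := eventually_ge (G := G) (conj iq mq).
(* By periodicity every state seen from here on is seen arbitrarily late, so its priority is at
   least [q]. *)
have hge n : N + i0 <= n -> q <= prio (pi n).
  move=> h; rewrite -(perm n N1) //; apply: hN1.
  by apply: leq_trans (leq_addl _ _); rewrite leq_pmulr.
have [n0 hn0 pn0] := iq (N + i0).
pose Gv := threshold_game v.
pose y j n : int := EL (G := Gv) pi n 0%R j.
have EL_D j n m : (y j (n + m)%N = y j n +
    (\sum_(n <= t < n + m) @weight Gv (pi t) (pi t.+1)) 0 j)%R.
  rewrite /y /EL -!(big_mkord predT (fun t => @weight Gv (pi t) (pi t.+1))).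
  by rewrite (big_cat_nat (n := n)) ?leq_addr //= mxE.
pose d j := ((\sum_(n0 <= t < n0 + p) @weight Gv (pi t) (pi t.+1)) 0 j)%R.
have yd j i : (y j (n0 + i * p)%N = y j n0 + i%:Z * d j)%R.
  elim: i => [|i IH]; first by rewrite mul0n addn0 mul0r addr0.
  rewrite mulSn [(p + _)%N]addnC addnA EL_D IH -[i.+1]addn1 PoszD mulrDl mul1r addrA;
    congr (_ + _)%R.
  rewrite /d; congr (fun_of_matrix _ 0%R j).
  rewrite -addnA [(i * p + p)%N]addnC addnA big_addn.
  rewrite addnK; apply: eq_big_nat => t /andP[h1 h2].
  by rewrite -addSn !perm // (leq_trans hn0) // leqW.
exists n0, (n0 + p); split.
- by rewrite (leq_trans _ hn0) ?leq_addr //= -[X in X < _]addn0 ltn_add2l.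
- by rewrite perN.
- move=> j.
  exact: (mean_payoff_drift (R :=
    R) (common_den_gt0 v) (scaled_thresholdE v j) (fun n =>
      EL_threshold pi n j) p0 (yd j) (hmp j)).
- by rewrite pn0.
- by move=> t /andP[h _]; rewrite pn0 hge // (leq_trans hn0).
Qed.

Lemma mp_complete (R : realType) (G : pgame) (v : 'rV[rat]_(wdim G)) (M : moore G) :
  mp_parity_winning (G := G) R v (moore_strategy M) ->
  exists m, (CpreFP_mp_parity 8 (encode G) (encode_prio G) (encode_rat v)).1 = Some m.
Proof.
move=> [strat win].
have [m hm] := @CpreFP_complete_strategy (threshold_game v) (moore_strategy M) strat
  (fun pi N tau cpi ht =>
    let: conj h1 h2 := win pi cpi in @moore_even_loop R G v M pi N tau cpi h1 h2 ht).
exists m; rewrite -[LHS]/(CpreFP_energy_parity 8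
  (remove_threshold (encode G) (encode_rat v)).1 (encode_prio G)).1.
by rewrite remove_threshold1.
Qed.

(** * Running time *)

Lemma bits_leS n : bits n <= n.+1.
Proof.
rewrite /bits ltnS; case: n => [|n]; first by rewrite trunc_log0.
by apply/ltnW; apply: leq_trans (ltn_expl _ _) (trunc_logP _ _).
Qed.

Lemma bind2 (A B : Type) (m : timed A) (f : A -> timed B) :
  (bind m f).2 = m.2 + (f m.1).2.
Proof. by []. Qed.

(* The suffix 2 marks the cost of a timed function, and the suffix K a bound by
   a power of a number K that exceeds all numbers and list sizes in the
   computation. *)
Section Powers.
Variable K : nat.
Hypothesis K2 : 2 <= K.

Lemma K_gt0 : 0 < K. Proof. exact: ltnW. Qed.

Lemma powK_le a b : a <= b -> K ^ a <= K ^ b.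
Proof. by move=> h; rewrite leq_exp2l. Qed.

Lemma weakenK a b x : x <= K ^ a -> a <= b -> x <= K ^ b.
Proof. by move=> h /powK_le; apply: leq_trans. Qed.

Lemma addK a b c x y : x <= K ^ a -> y <= K ^ b -> maxn a b < c -> x + y <= K ^ c.
Proof.
move=> hx hy h; apply: (@leq_trans (K ^ (maxn a b) + K ^ (maxn a b))).
  by apply: leq_add; [apply: weakenK hx _; rewrite leq_maxl | apply: weakenK hy _;
    rewrite leq_maxr].
apply: leq_trans (powK_le h); rewrite expnS addnn -mul2n leq_mul2r K2 orbT //.
Qed.

Lemma mulK a b c x y : x <= K ^ a -> y <= K ^ b -> a + b <= c -> x * y <= K ^ c.
Proof.
by move=> hx hy h; apply: leq_trans (powK_le h); rewrite expnD leq_mul.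
Qed.

Lemma succK a c x : x <= K ^ a -> a < c -> x.+1 <= K ^ c.
Proof.
move=> hx h; rewrite -addn1; apply: (addK hx (b := 0)); rewrite ?maxn0 //.
Qed.

Lemma bitsK a c x : x <= K ^ a -> a < c -> bits x <= K ^ c.
Proof. by move=> hx h; apply: leq_trans (bits_leS x) (succK hx h). Qed.

Lemma zbitsK a c (x : int) : `|x|%N <= K ^ a -> a.+1 < c -> zbits x <= K ^ c.
Proof. by move=> hx; apply: succK; apply: bitsK hx _. Qed.

(** The shape on the left is the cost of traversing a list of [m] cells with cost at most [t] for
    each cell. *)
Lemma iterK a b c m t : m <= K ^ a -> t <= K ^ b -> a + b + 1 < c ->
  (m * t.+1).+1 <= K ^ c.
Proof.
move=> hm ht h; apply: (@succK (a + b.+1)); last by rewrite addnS -addn1.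
by apply: mulK hm _ (leqnn _); apply: succK ht _.
Qed.

Section Lists.
Variables (A B : eqType) (D : Type).

Lemma mapM2 (f : A -> timed D) s t : {in s, forall x, (f x).2 <= t} ->
  (mapM f s).2 <= (size s * t.+1).+1.
Proof.
elim: s => //= x s IH h; rewrite addn1 mulSn.
have := h x (mem_head _ _); have := IH (fun y ys => h y (mem_behead (s := x :: s) ys)).
move: (f x).2 (mapM f s).2 (size s * t.+1); lia.
Qed.

Lemma filterM2 (f : A -> timed bool) s t : {in s, forall x, (f x).2 <= t} ->
  (filterM f s).2 <= (size s * t.+1).+1.
Proof.
elim: s => //= x s IH h; rewrite addn1 mulSn.
have := h x (mem_head _ _); have := IH (fun y ys => h y (mem_behead (s := x :: s) ys)).
move: (f x).2 (filterM f s).2 (size s * t.+1); lia.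
Qed.

Lemma findM2 (f : A -> timed bool) s t : {in s, forall x, (f x).2 <= t} ->
  (findM f s).2 <= (size s * t.+1).+1.
Proof.
elim: s => //= x s IH h; rewrite mulSn.
have := h x (mem_head _ _); have := IH (fun y ys => h y (mem_behead (s := x :: s) ys)).
by case: (f x).1 => /=; move: (f x).2 (findM f s).2 (size s * t.+1); lia.
Qed.

Lemma zipM2 (f : A -> B -> timed D) u v t :
  {in u & v, forall x y, (f x y).2 <= t} -> (zipM f u v).2 <= (size u * t.+1).+1.
Proof.
elim: u v => [|x u IH] [|y v] //= h; rewrite addn1 mulSn.
have := h x y (mem_head _ _) (mem_head _ _).
have /IH : {in u & v, forall x y, (f x y).2 <= t}.
  by move=> x' y' hx hy; apply: h; rewrite inE ?hx ?hy orbT.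
move: (f x y).2 (zipM f u v).2 (size u * t.+1); lia.
Qed.

(** The invariant [P] bounds the size of the accumulator, on which the cost of each step depends. *)
Lemma foldM2 (f : D -> A -> timed D) (P : D -> Prop) b s t : P b ->
  (forall b, P b -> {in s, forall x, (f b x).2 <= t /\ P (f b x).1}) ->
  (foldM f b s).2 <= (size s * t.+1).+1.
Proof.
elim: s b => //= x s IH b Pb h; rewrite addn1 mulSn.
have [h1 h2] := h b Pb x (mem_head _ _).
have := IH _ h2 (fun b Pb y ys => h b Pb y (mem_behead (s := x :: s) ys)).
move: h1; move: (f b x).2 (foldM f _ s).2 (size s * t.+1); lia.
Qed.

Variables (a b c : nat).
Hypothesis abc : a + b + 1 < c.

Lemma mapMK (f : A -> timed D) s : size s <= K ^ a ->
  {in s, forall x, (f x).2 <= K ^ b} -> (mapM f s).2 <= K ^ c.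
Proof. by move=> sa /mapM2 h; apply: leq_trans h (iterK sa (leqnn _) abc). Qed.

Lemma filterMK (f : A -> timed bool) s : size s <= K ^ a ->
  {in s, forall x, (f x).2 <= K ^ b} -> (filterM f s).2 <= K ^ c.
Proof. by move=> sa /filterM2 h; apply: leq_trans h (iterK sa (leqnn _) abc). Qed.

Lemma findMK (f : A -> timed bool) s : size s <= K ^ a ->
  {in s, forall x, (f x).2 <= K ^ b} -> (findM f s).2 <= K ^ c.
Proof. by move=> sa /findM2 h; apply: leq_trans h (iterK sa (leqnn _) abc). Qed.

Lemma hasMK (f : A -> timed bool) s : size s <= K ^ a ->
  {in s, forall x, (f x).2 <= K ^ b} -> (hasM f s).2 <= K ^ c.
Proof. by move=> sa h; rewrite bind2 addn0; apply: findMK. Qed.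

Lemma allMK (f : A -> timed bool) s : size s <= K ^ a ->
  {in s, forall x, (f x).2 <= K ^ b} -> (allM f s).2 <= K ^ c.
Proof.
move=> sa h; rewrite /allM /negM 2!bind2 !addn0; apply: findMK => // x xs.
by rewrite bind2 addn0; apply: h.
Qed.

Lemma zipMK (f : A -> B -> timed D) u v : size u <= K ^ a ->
  {in u & v, forall x y, (f x y).2 <= K ^ b} -> (zipM f u v).2 <= K ^ c.
Proof. by move=> sa /zipM2 h; apply: leq_trans h (iterK sa (leqnn _) abc). Qed.

Lemma foldMK (f : D -> A -> timed D) (P : D -> Prop) z s : size s <= K ^ a -> P z ->
  (forall z, P z -> {in s, forall x, (f z x).2 <= K ^ b /\ P (f z x).1}) ->
  (foldM f z s).2 <= K ^ c.
Proof. by move=> sa Pz h; apply: leq_trans (foldM2 Pz h) (iterK sa (leqnn _) abc). Qed.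

End Lists.

Lemma vall2K (A B : eqType) a b c (r : A -> B -> timed bool) u v : size u <= K ^ a ->
  {in u & v, forall x y, (r x y).2 <= K ^ b} -> a + b + 2 < c ->
    (vall2 r u v).2 <= K ^ c.
Proof.
move=> su h abc; rewrite /vall2 bind2.
apply: (@addK (a + b + 2) (a + 2)) => //; last by rewrite gtn_max abc; lia.
  by apply: (zipMK (b := b)) su h; rewrite addn2 addn1.
apply: (allMK (a := a) (b := 0)) => //; first by lia.
by rewrite zipM1 size_map size_zip geq_min su.
Qed.

Lemma nleqK a c x y : x <= K ^ a -> y <= K ^ a -> a.+1 < c -> bits x + bits y <= K ^ c.
Proof. by move=> hx hy h; apply: (addK (bitsK hx (ltnSn a)) (bitsK hy (ltnSn a)));
  rewrite maxnn. Qed.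

Lemma zaddK a c (x y : int) : `|x|%N <= K ^ a -> `|y|%N <= K ^ a -> a.+2 < c ->
  zbits x + zbits y <= K ^ c.
Proof. by move=> hx hy h; apply: (addK (zbitsK hx (ltnSn _)) (zbitsK hy (ltnSn _)));
  rewrite maxnn. Qed.

End Powers.

Lemma eq_stateK (T : finType) K (s s' : T) : 2 <= K -> #|T| < K ->
  (eq_state s s').2 <= K ^ 2.
Proof.
move=> K2 TK; apply: (mulK K2 (a := 1) (b := 1)); rewrite ?expn1 //.
exact: leq_trans (bits_leS _) TK.
Qed.

(** * Cost of the fixed point and of the extraction *)

Section CpreCost.
Variables (G : game) (K C : nat).
Hypothesis K2 : 2 <= K.
Local Notation k := (wdim G).
Local Notation t := (encode G).
Local Notation elt := (G * seq nat)%type.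
Hypotheses (hC : C < K) (hk : k < K) (hE : size (tedges t) <= K).
Hypothesis hw : forall s s' (j : 'I_k), edge s s' -> `|weight s s' 0%R j|%N <= K.
Hypothesis hcfg : #|G| * C.+1 ^ k < K.

Let n0 : 0 < #|G|. Proof. by apply/card_gt0P; exists (init G). Qed.

Let hn : #|G| < K.
Proof. by apply: leq_ltn_trans hcfg; rewrite leq_pmulr // expn_gt0. Qed.

Definition vec (e : seq nat) := size e = k /\ {in e, forall x, x <= C}.

Lemma vector_vec e : vector G C e -> vec e.
Proof. by move=> /andP[/eqP ? /allP]. Qed.

Lemma size_vec e : vec e -> size e <= K ^ 1.
Proof. by move=> [-> _]; rewrite expn1 ltnW. Qed.

Lemma vec_le e x : vec e -> x \in e -> x <= K ^ 1.
Proof. by move=> [_ h] /h xC; rewrite expn1; apply: leq_trans xC (ltnW hC). Qed.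

Lemma tdimK : k <= K ^ 1. Proof. by rewrite expn1 ltnW. Qed.

Lemma vleqK x e : vec x -> vec e -> (vleq x e).2 <= K ^ 7.
Proof.
move=> vx ve; apply: (vall2K K2 (a := 1) (b := 3)) => //; first exact: size_vec.
by move=> a b ax be; apply: (nleqK K2 (vec_le vx ax) (vec_le ve be)).
Qed.

Lemma veqK x e : vec x -> vec e -> (veq x e).2 <= K ^ 7.
Proof.
move=> vx ve; apply: (vall2K K2 (a := 1) (b := 3)) => //; first exact: size_vec.
by move=> a b ax be; apply: (nleqK K2 (vec_le vx ax) (vec_le ve be)).
Qed.

Lemma vmaxK x e : vec x -> vec e -> (vmax x e).2 <= K ^ 7.
Proof.
move=> vx ve; apply: (zipMK K2 (a := 1) (b := 3)) => //; first exact: size_vec.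
by move=> a b ax be; apply: (nleqK K2 (vec_le vx ax) (vec_le ve be)).
Qed.

Definition wvec (w : seq int) := size w = k /\ {in w, forall z, `|z|%N <= K}.

Lemma tedges_wvec a : a \in tedges t -> wvec a.2.
Proof.
rewrite mem_tedges => /andP[ea /eqP ->]; split; first exact: size_wlist.
by move=> z /mapP[j _ ->]; apply: hw.
Qed.

Lemma least_beforeK e w : vec e -> wvec w -> (least_before e w).2 <= K ^ 8.
Proof.
move=> ve [_ hz]; apply: (zipMK K2 (a := 1) (b := 5)) => //; first exact: size_vec.
move=> x y xe yw; have xK := vec_le ve xe;
  have yK : `|y|%N <= K ^ 1 by rewrite expn1 hz.
rewrite bind2; apply: (addK K2 (a := 4) (b := 4)) => //.
  exact: (zaddK K2 (x := Posz x) xK yK).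
apply: (zbitsK K2 (a := 2)) => //=.
apply: leq_trans (_ : x + `|y|%N <= _); first by lia.
exact: (addK K2 xK yK).
Qed.

Lemma least_before_valK e w x : vec e -> wvec w -> x \in (least_before e w).1 ->
  x <= K ^ 2.
Proof.
move=> ve [_ hz]; rewrite least_before1 => /mapP[[p q] /mem_zip[/= pe qw] ->].
apply: leq_trans (_ : p + `|q|%N <= _); first by lia.
by apply: (addK K2 (vec_le ve pe) (b := 1)) => //; rewrite expn1 hz.
Qed.

Lemma affordableK e' e w : vec e' -> vec e -> wvec w -> (affordable e' e w).2 <= K ^ 10.
Proof.
move=> ve' ve [sw hz]; rewrite bind2; apply: (addK K2 (a := 8) (b := 9)) => //.
  apply: (zipMK K2 (a := 1) (b := 4)) => //; first exact: size_vec.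
  move=> x y xe yw; apply: (zaddK K2 (a := 1) (x := Posz x)) => //;
    first exact: (vec_le ve).
  by rewrite expn1 hz.
apply: (vall2K K2 (a := 1) (b := 5)) => //; first exact: size_vec.
move=> x y xe; rewrite zipM1 => /mapP[[p q] /mem_zip[/= pe qw] ->].
apply: (zaddK K2 (a := 2) (x := Posz x)) => //.
  exact: (weakenK K2 (vec_le ve' xe)).
apply: leq_trans (_ : p + `|q|%N <= _); first by lia.
by apply: (addK K2 (vec_le ve pe) (b := 1)) => //; rewrite expn1 hz.
Qed.

Definition vecs (X : seq (seq nat)) := sized k X && bounded C X.

Lemma vecsP X : vecs X -> {in X, forall x, vec x}.
Proof.
by move=> /andP[/allP sX /allP bX] x xX; split; [apply/eqP/sX | apply/allP/bX].
Qed.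

(** Paired with the initial state, distinct vectors become distinct configurations, of which there
    are fewer than [K]. This keeps every list of minimal elements below [K], however many elements
    it was computed from. *)
Lemma card_vecs X : uniq X -> vecs X -> size X <= K ^ 1.
Proof.
move=> uX /andP[/allP sX /allP bX]; rewrite expn1; apply: leq_trans (ltnW hcfg).
rewrite -(card_config G C) cardE -(size_map (@listing G C)) -(size_map (fun x =>
  (init G, x))).
apply: uniq_leq_size; first by rewrite map_inj_uniq // => x y [].
move=> y /mapP[x xX ->]; have [|z <-] := @vector_config G C (init G, x).
  by rewrite /vector /= sX // bX.
by apply: map_f; rewrite mem_enum.
Qed.

(** The bound K ^ 2 on the input fits its two uses: the joins of all pairs from two antichains, and
    the concatenation of at most [K] lists of length at most [K]. *)
Lemma minimalMK X : vecs X -> size X <= K ^ 2 -> (minimalM X).2 <= K ^ 17.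
Proof.
move=> vX sz; have /andP[sX _] := vX.
apply: (foldMK K2 (a := 2) (b := 13) (c := 17) isT
  (P := fun Y => incomparable Y /\ {subset Y <= X})) => // Y [iY YX] e eX.
have sY : sized k Y by apply/allP => y /YX /(allP sX).
have szY : size Y <= K ^ 2 by apply: leq_trans sz; apply: uniq_leq_size => //; case: iY.
have [_ iZ ZX _] := add_minimalP sY (eqP (allP sX e eX)) iY.
split; last first.
  split=> // y /ZX; rewrite inE => /orP[/eqP->//|/YX//].
rewrite bind2; apply: (addK K2 (a := 11) (b := 12)) => //.
  apply: (hasMK K2 (a := 2) (b := 7)) => // y yY;
    exact: vleqK (vecsP vX (YX _ yY)) (vecsP vX eX).
case: ifP => _; first by [].
rewrite bind2; apply: (addK K2 (a := 11) (b := 0)) => //.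
apply: (filterMK K2 (a := 2) (b := 7)) => // y yY.
by rewrite bind2 addn0; apply: vleqK (vecsP vX eX) (vecsP vX (YX _ yY)).
Qed.

Lemma flattenMK (A : Type) (ss : seq (seq A)) a : size ss <= K ^ a ->
  size (flatten ss) <= K ^ a -> (flattenM ss).2 <= K ^ a.+2.
Proof. by move=> h1 h2; apply: (succK K2 (a := a.+1)) => //; apply: (addK K2 h1 h2);
  rewrite maxnn. Qed.

Lemma size_flattenK (A : eqType) (ss : seq (seq A)) a b : size ss <= K ^ a ->
  {in ss, forall s, size s <= K ^ b} -> size (flatten ss) <= K ^ (a + b).
Proof.
move=> sa h; apply: (@leq_trans (size ss * K ^ b));
  last by rewrite expnD leq_mul2r sa orbT.
elim: ss h {sa} => //= s ss IH h; rewrite size_cat mulSn leq_add ?h ?mem_head //.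
by apply: IH => x xs; apply: h; rewrite inE xs orbT.
Qed.

Lemma meetMK X Y : vecs X -> vecs Y -> size X <= K ^ 1 -> size Y <= K ^ 1 ->
  (meetM X Y).2 <= K ^ 19.
Proof.
move=> vX vY zX zY; rewrite 2!bind2.
have /andP[sX bX] := vX; have /andP[sY bY] := vY.
have eZ : (mapM (fun x =>
  mapM (vmax x) Y) X).1 = [seq [seq (vmax x y).1 | y <- Y] | x <- X].
  by rewrite mapM1; apply: eq_map => x; rewrite mapM1.
have zin : {in (mapM (fun x =>
  mapM (vmax x) Y) X).1, forall s : seq (seq nat), size s <= K ^ 1}.
  by rewrite eZ => s /mapP[x _ ->]; rewrite size_map.
have zs : size (mapM (fun x => mapM (vmax x) Y) X).1 <= K ^ 1 by rewrite mapM1 size_map.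
have zf := size_flattenK zs zin.
apply: (addK K2 (a := 13) (b := 18)) => //.
  apply: (mapMK K2 (a := 1) (b := 10)) => // x xX.
  apply: (mapMK K2 (a := 1) (b := 7)) => // y yY;
    exact: vmaxK (vecsP vX xX) (vecsP vY yY).
apply: (addK K2 (a := 4) (b := 17)) => //.
  by apply: (flattenMK (a := 2)) => //; exact: (weakenK K2 zs).
apply: minimalMK => //; rewrite /vecs eZ.
apply/andP; split; apply/allP => z /allpairsP[[x y] /= [xX yY ->]].
  by rewrite vmax1 size_map size_zip (eqP (allP sX _ xX)) (eqP (allP sY _ yY)) minnn.
rewrite vmax1 all_map; apply/allP => p pp /=; rewrite geq_max.
by have [px py] := mem_zip pp; rewrite (allP (allP bX _ xX)) ?(allP (allP bY _ yY)).
Qed.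

Lemma out_edgesK s : (out_edges t s).2 <= K ^ 6.
Proof.
apply: (filterMK K2 (a := 1) (b := 2)) => //.
by move=> a _; apply: eq_stateK.
Qed.

Lemma mem_out_edges s a : a \in (out_edges t s).1 -> a \in tedges t.
Proof. by rewrite out_edges1 mem_filter => /andP[]. Qed.

Lemma size_out_edgesK s : size (out_edges t s).1 <= K ^ 1.
Proof.
by rewrite out_edges1 expn1; apply: leq_trans hE; rewrite size_filter count_size.
Qed.

Lemma antichain_rep_vec (V : seq elt) x : antichain_rep C V -> x \in V -> vec x.2.
Proof. by move=> [_ wV _] xV; apply: vector_vec (allP wV x xV). Qed.

Lemma size_antichain_rep (V : seq elt) : antichain_rep C V -> size V <= K ^ 1.
Proof. by move=> /size_antichain h; rewrite expn1; apply: leq_trans h (ltnW hcfg). Qed.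

Section Antichain.
Variables (V : seq elt).
Hypotheses (gV : antichain_rep C V).

Let wV : well_formed C V. Proof. by case: gV. Qed.
Let zV : size V <= K ^ 1. Proof. exact: size_antichain_rep. Qed.
Let elt_vec x : x \in V -> vec x.2. Proof. exact: antichain_rep_vec. Qed.

Lemma pre_edgeK a : a \in tedges t -> (pre_edge C V a).2 <= K ^ 14.
Proof.
move=> aE; rewrite 2!bind2.
have wa := tedges_wvec aE.
have z1 : size (filterM (fun x : elt => eq_state x.1 a.1.2) V).1 <= K ^ 1.
  by rewrite filterM1; apply: leq_trans zV; rewrite size_filter count_size.
apply: (addK K2 (a := 6) (b := 13)) => //.
  by apply: (filterMK K2 (a := 1) (b := 2)) => // x _; apply: eq_stateK.
apply: (addK K2 (a := 11) (b := 12)) => //.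
  apply: (mapMK K2 (a := 1) (b := 8)) => // x;
    rewrite filterM1 mem_filter => /andP[_ xV].
  exact: least_beforeK (elt_vec xV) wa.
apply: (filterMK K2 (a := 1) (b := 9)) => //; first by rewrite mapM1 size_map.
rewrite mapM1 filterM1 => y /mapP[x]; rewrite mem_filter => /andP[_ xV] ->.
have vx := elt_vec xV.
apply: (allMK K2 (a := 1) (b := 5)) => //.
  by rewrite (size_least_before (k := k)) ?tdimK //; [case: vx | case: wa].
move=> n nY; apply: (nleqK K2 (a := 2)) => //; first exact: least_before_valK nY.
by apply: (@leq_trans K); [apply: ltnW | rewrite -{1}(expn1 K) powK_le].
Qed.

Lemma size_pre_edge a : size (pre_edge C V a).1 <= K ^ 1.
Proof.
rewrite -[(pre_edge C V a).1]/(filterM (allM (fun n => nleq n C)) (mapM (fun x =>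
  least_before x.2 a.2)
     (filterM (fun x => eq_state x.1 a.1.2) V).1).1).1.
rewrite filterM1 mapM1 filterM1 size_filter; apply: leq_trans (count_size _ _) _.
by rewrite size_map size_filter; apply: leq_trans (count_size _ _) zV.
Qed.

Lemma cpre_stateK s : (cpre_state t C V (s, s \in pl1 G)).2 <= K ^ 26.
Proof.
have zA := size_out_edgesK s.
have [es [ees ies ses bes _]] := @cpre_stateP G C V s wV.
have zes : size es <= K ^ 1 by apply: card_vecs; [case: ies | apply/andP].
move: ees; rewrite /cpre_state bind1 bind1 bind1 mapM1 => /(congr1 size);
  rewrite !size_map => ees.
rewrite bind2 bind2 bind2; apply: (addK K2 (a := 6) (b := 25)) => //;
  first exact: out_edgesK.
have aE a : a \in (out_edges t s).1 -> a \in tedges t by apply: mem_out_edges.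
have pv : all vecs (mapM (pre_edge C V) (out_edges t s).1).1.
  rewrite mapM1 all_map; apply/allP => a aA; have [sw _] := tedges_wvec (aE a aA).
  by have [h1 h2 _] := pre_edgeP wV sw; apply/andP.
have zX : size (mapM (pre_edge C V) (out_edges t s).1).1 <= K ^ 1 by rewrite mapM1
  size_map.
have zX1 : {in (mapM (pre_edge C V) (out_edges t s).1).1,
    forall X : seq (seq nat), size X <= K ^ 1}.
  by rewrite mapM1 => X /mapP[a _ ->]; apply: size_pre_edge.
apply: (addK K2 (a := 17) (b := 24)) => //.
  by apply: (mapMK K2 (a := 1) (b := 14)) => // a /aE; apply: pre_edgeK.
apply: (addK K2 (a := 23) (b := 4)) => //; last first.
  by apply: (mapMK K2 (a := 1) (b := 0)) => //; rewrite [X in X <= _]ees.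
move: pv zX zX1; move: (mapM (pre_edge C V) _).1 => Xs pv zX zX1.
rewrite [(s, s \in pl1 G).2]/=; case: ifP => _.
  rewrite bind2; apply: (addK K2 (a := 4) (b := 17)) => //.
    apply: (flattenMK (a := 2)); first exact: (weakenK K2 zX).
    exact: (size_flattenK zX zX1).
  apply: minimalMK; last exact: (size_flattenK zX zX1).
  rewrite /vecs /sized /bounded !all_flatten.
  by apply/andP; split; apply/allP => X /(allP pv) /andP[].
rewrite bind2; apply: (addK K2 (a := 1) (b := 22)) => //.
(* Each intersection is reduced to an antichain again, so its size stays below [K] instead of being
   multiplied at every step. *)
apply: (foldMK K2 (a := 1) (b := 19) (c := 22) isT
  (P := fun X => vecs X /\ size X <= K ^ 1)) => //.
  split; last by rewrite expn1; apply: ltnW.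
  by rewrite /vecs /sized /bounded /= size_nseq eqxx all_nseq orbT.
move=> X [vX sX] Y YXs; have vY := allP pv Y YXs; split;
  first exact: (meetMK vX vY sX (zX1 Y YXs)).
have /andP[sdX bX] := vX; have /andP[sdY bY] := vY.
have [h1 [h2 _] _ _] := meetMP sdX sdY.
have v : vecs (meetM X Y).1 by apply/andP; split=> //; apply: (bounded_meet sdX).
by split=> //; apply: card_vecs.
Qed.

Lemma same_antichainK (V' : seq elt) : antichain_rep C V' ->
  (same_antichain V V').2 <= K ^ 18.
Proof.
move=> gV'.
have zV' := size_antichain_rep gV';
  have v' x : x \in V' -> vec x.2 by apply: antichain_rep_vec.
have eqK (x y : elt) : vec x.2 -> vec y.2 -> (eq_elt x y).2 <= K ^ 8.
  move=> vx vy; rewrite bind2; apply: (addK K2 (a := 2) (b := 7)) => //;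
    first exact: eq_stateK.
  by case: ifP => _ //; apply: veqK.
rewrite bind2; apply: (addK K2 (a := 17) (b := 17)) => //.
  apply: (allMK K2 (a := 1) (b := 14)) => // x xV.
  by apply: (hasMK K2 (a := 1) (b := 8)) => // y /v'; apply: eqK; apply: elt_vec.
case: ifP => _ //; apply: (allMK K2 (a := 1) (b := 14)) => // x xV.
by apply: (hasMK K2 (a := 1) (b := 8)) => // y /elt_vec; apply: eqK; apply: v'.
Qed.

Lemma cpreMK : (cpreM t C V).2 <= K ^ 31.
Proof.
have zQ : size (tstates t) <= K ^ 1 by rewrite expn1 size_map -cardE ltnW.
rewrite bind2; apply: (addK K2 (a := 29) (b := 4)) => //.
  apply: (mapMK K2 (a := 1) (b := 26)) => // sb /mapP[s _ ->]; exact: cpre_stateK.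
apply: (flattenMK (a := 2)).
  by rewrite mapM1 size_map; apply: (weakenK K2 zQ).
apply: (size_flattenK (a := 1) (b := 1)); first by rewrite mapM1 size_map.
rewrite mapM1 => X /mapP[sb /mapP[s _ ->] ->].
have [es [-> ies ses bes _]] := @cpre_stateP G C V s wV.
by rewrite size_map; apply: card_vecs; [case: ies | apply/andP].
Qed.

Lemma supportsK a e (y : elt) : a \in tedges t -> vec e -> y \in V ->
  (supports a e y).2 <= K ^ 11.
Proof.
move=> aE ve yV; rewrite bind2; apply: (addK K2 (a := 2) (b := 10)) => //.
  exact: eq_stateK.
by case: ifP => _ //; apply: affordableK => //; [apply: elt_vec | apply: tedges_wvec].
Qed.

Lemma upd_entryK (x : elt) s : x \in V -> (upd_entry t V x s).2 <= K ^ 15.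
Proof.
move=> xV; rewrite bind2; apply: (addK K2 (a := 6) (b := 14)) => //.
  apply: (findMK K2 (a := 1) (b := 3)) => // a _.
  rewrite bind2; apply: (addK K2 (a := 2) (b := 2)) => //; first exact: eq_stateK.
  by case: ifP => _ //; apply: eq_stateK.
rewrite findM1; have := ohead_filterP (fun a : G * G * seq int =>
  (let! b := eq_state a.1.1 x.1 in if b then eq_state a.1.2 s else ret false).1)
    (tedges t).
case: ohead => [a [aE _]|_ //]; rewrite bind2 addn0.
by apply: (findMK K2 (a := 1) (b := 11)) => // y yV; apply: supportsK => //;
  apply: elt_vec.
Qed.

Lemma next_entryK (x : elt) s : x \in V -> (next_entry t V x s).2 <= K ^ 20.
Proof.
move=> xV; have zA := size_out_edgesK s.
rewrite bind2; apply: (addK K2 (a := 6) (b := 19)) => //; first exact: out_edgesK.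
rewrite bind2; apply: (addK K2 (a := 2) (b := 18)) => //; first exact: eq_stateK.
rewrite bind2; apply: (addK K2 (a := 17) (b := 4)) => //.
  case: ifP => _ //; apply: (findMK K2 (a := 1) (b := 14)) => // a aA.
  apply: (hasMK K2 (a := 1) (b := 11)) => // y yV; apply: supportsK => //.
    exact: mem_out_edges aA.
  exact: elt_vec.
case: (X in match X with Some _ => _ | None => _ end) => [a|]; first by [].
rewrite bind2 addn0; exact: (findMK K2 (a := 1) (b := 0)).
Qed.

Lemma tabulateK (B : Type) (f : elt -> G -> timed B) Q : size Q <= K ^ 1 ->
  {in V, forall x s, (f x s).2 <= K ^ 20} -> (tabulate f V Q).2 <= K ^ 28.
Proof.
move=> zQ h; rewrite bind2; apply: (addK K2 (a := 27) (b := 4)) => //.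
  apply: (mapMK K2 (a := 1) (b := 24)) => // x xV;
    apply: (mapMK K2 (a := 1) (b := 20)) => // sb _.
  by rewrite bind2 addn0; apply: h.
apply: (flattenMK (a := 2)); first by rewrite mapM1 size_map; apply: (weakenK K2 zV).
rewrite mapM1 size_flatten /shape -map_comp sumnE big_map.
rewrite (eq_bigr (fun _ => size Q)) => [|x _]; last by rewrite /= mapM1 size_map.
by rewrite big_const_seq count_predT iter_addn_0 mulnC; apply: (mulK K2 zV zQ).
Qed.

Lemma extractK (x : elt) : (extract t V x).2 <= K ^ 31.
Proof.
have zQ : size (tstates t) <= K ^ 1 by rewrite expn1 size_map -cardE ltnW.
rewrite bind2; apply: (addK K2 (a := 28) (b := 30)) => //.
  by apply: tabulateK => // y yV s; apply: (weakenK K2 (upd_entryK s yV)).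
rewrite bind2; apply: (addK K2 (a := 3) (b := 29)) => //.
  exact: (filterMK K2 (a := 1) (b := 0)).
rewrite bind2; apply: (addK K2 (a := 28) (b := 0)) => //.
apply: tabulateK => [|y yV s]; last exact: next_entryK.
by rewrite filterM1; apply: leq_trans zQ; rewrite size_filter count_size.
Qed.

End Antichain.

Lemma descendK fuel i V : represents V (chain G C i) ->
  (descend fuel t C V).2 <= fuel * K ^ 33.
Proof.
elim: fuel i V => // fuel IH i V rV.
have r' := cpre_represents rV; have [gV _] := rV; have [gV' _] := r'.
rewrite /descend -/descend bind2 bind2 mulSn addnA.
apply: leq_add.
  exact: (addK K2 (cpreMK gV) (same_antichainK gV gV')).
by case: ifP => _ //; apply: (IH i.+1).
Qed.

Lemma cpre_fixpointK : (cpre_fixpoint t C).2 <= K ^ 36.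
Proof.
have zQ : size (tstates t) <= K ^ 1 by rewrite expn1 size_map -cardE ltnW.
rewrite bind2; apply: (addK K2 (a := 4) (b := 35)) => //.
  apply: (mapMK K2 (a := 1) (b := 1)) => // sb _.
  by rewrite bind2 addn0 expn1.
apply: leq_trans (descendK (i := 0) _ _) _; first exact: full_represents.
apply: (mulK K2 (a := 1) (b := 33)) => //.
by rewrite expn1 size_map -cardE.
Qed.

End CpreCost.

Section SearchCost.
Variables (G : game) (K cap : nat).
Hypothesis K2 : 2 <= K.
Local Notation k := (wdim G).
Local Notation t := (encode G).
Hypotheses (hC : cap < K) (hk : k < K) (hE : size (tedges t) <= K).
Hypothesis hw : forall s s' (j : 'I_k), edge s s' -> `|weight s s' 0%R j|%N <= K.
Hypothesis hcfg : #|G| * cap.+1 ^ k < K.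

Lemma searchK n C : C + n <= cap.+1 -> (search n t C).2 <= n * K ^ 40.
Proof.
elim: n C => // n IH C hn.
have Ccap : C <= cap by rewrite -ltnS (leq_trans _ hn) // -addSnnS leq_addr.
have CK : C < K by apply: leq_ltn_trans hC.
(* A smaller constant has no more configurations, so one [K] serves all the values tried. *)
have hcfg' : #|G| * C.+1 ^ k < K.
  apply: leq_ltn_trans hcfg; rewrite leq_mul2l; apply/orP; right.
  by case: (wdim G) => // k'; rewrite leq_exp2r.
have rV := cpre_fixpoint_represents G C; have [gV _] := rV.
have nK : n.+1 <= K ^ 1.
  by rewrite expn1 (leq_trans _ hC) // (leq_trans _ hn) // leq_addl.
rewrite /search -/search bind2 bind2 mulSn addnA -[X in _ <= X]addn0.
set V := (cpre_fixpoint t C).1 in gV *.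
have h1 : (cpre_fixpoint t C).2 + (findM (fun x =>
  eq_state x.1 (tinit t)) V).2 <= K ^ 38.
  apply: (addK K2 (a := 36) (b := 5)) => //; first exact: cpre_fixpointK.
  apply: (findMK K2 (a := 1) (b := 2)) => //;
    first exact: (size_antichain_rep hcfg' gV).
  move=> x _; apply: eq_stateK => //; apply: leq_ltn_trans hcfg.
  by rewrite leq_pmulr // expn_gt0.
rewrite addn0; case: (findM _ V).1 => [x|].
  rewrite bind2 addn0; apply: leq_trans (leq_addr _ _).
  by apply: (addK K2 h1 (b := 31)) => //; apply: (extractK (C := C)).
rewrite bind2 bind2 addnA addnA; apply: leq_add.
  apply: (addK K2 (a := 39) (b := 2)) => //; last exact: (bitsK K2 nK).
  apply: (addK K2 h1 (b := 3)) => //.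
  apply: (nleqK K2 (a := 1)) => //; rewrite expn1; [exact: ltnW | exact: ltnW].
apply: IH; change (C + 1 + n <= cap.+1); by rewrite addn1 addSnnS.
Qed.

End SearchCost.

(** * Cost of the depth bound and of the reductions *)

Section DepthCost.
Variables (G : game) (K c : nat).
Hypothesis K2 : 2 <= K.
Local Notation k := (wdim G).
Local Notation t := (encode G).
Hypotheses (hk : k < K) (hE : size (tedges t) <= K) (hn : #|G| < K).
Hypothesis hw : forall s s' (j : 'I_k), edge s s' -> `|weight s s' 0%R j|%N <= K.

Lemma max_weight_leK : (max_weight t).1 <= K.
Proof. exact: max_weight_le hw. Qed.

Lemma max_weightK : (max_weight t).2 <= K ^ 10.
Proof.
have hwz a : a \in tedges t ->
  size a.2 <= K ^ 1 /\ {in a.2, forall z : int, `|z|%N <= K ^ 1}.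
  rewrite mem_tedges => /andP[ea /eqP ->]; rewrite size_wlist expn1 ltnW //; split=> //.
  by move=> z /mapP[j _ ->]; apply: hw.
apply: (foldMK K2 (a := 1) (b := 7) (c := 10) isT (P := fun r => r <= K ^ 1)) =>
  // r rK a /hwz[za ha].
split.
  apply: (foldMK K2 (a := 1) (b := 3) (c := 7) isT (P := fun r => r <= K ^ 1)) =>
    // r' r'K z /ha zK.
  by split; [apply: (nleqK K2 r'K zK) | rewrite /= geq_max r'K].
rewrite foldM1 (foldl_maxn (fun z : int => `|z|%N)) geq_max rK.
by apply/bigmax_leqP_seq => z /ha.
Qed.

Lemma max_outdegreeK : (max_outdegree t).2 <= K ^ 12.
Proof.
have zQ : size (tstates t) <= K ^ 1 by rewrite expn1 size_map -cardE ltnW.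
apply: (foldMK K2 (a := 1) (b := 9) (c := 12) isT (P := fun r => r <= K ^ 1)) =>
  // r rK sb _.
have zA : size (out_edges t sb.1).1 <= K ^ 1 by apply: size_out_edgesK.
split; last by rewrite /= geq_max rK.
rewrite bind2; apply: (addK K2 (a := 6) (b := 8)) => //.
  apply: (filterMK K2 (a := 1) (b := 2)) => // a _; exact: eq_stateK.
rewrite bind2; apply: (addK K2 (a := 5) (b := 3)) => //.
  apply: (mulK K2 (a := 2) (b := 2)) => //; first exact: (succK K2 zA).
  exact: (bitsK K2 zA).
exact: (nleqK K2 (a := 1)).
Qed.

(** [npow] takes as many multiplications as its exponent says, so the exponent itself, not only its
    length, has to be bounded by [K]. *)
Lemma npowK x n : 0 < x -> n <= K ^ 1 -> x ^ n <= K ^ 1 -> (npow x n).2 <= K ^ 8.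
Proof.
move=> x0 nK; suff H m : m <= n -> x ^ n <= K ^ 1 -> (npow x m).2 <= (m * (K ^ 6)).+1.
  by move=> /(H n (leqnn _)) h; apply: leq_trans h _;
    apply: (succK K2 (a := 7)) => //; apply: (mulK K2 nK (leqnn _)).
move=> mn xK; elim: m mn => // m IH mn; rewrite /npow -/npow bind2 bind2 npow1.
have xm y : y <= n -> x ^ y <= K ^ 1.
  by move=> yn; apply: leq_trans xK; apply: leq_pexp2l.
have xK1 : 0 < n -> x <= K ^ 1 by move=> n0; rewrite -[x]expn1; apply: xm.
have h1 : bits m.+1 <= K ^ 2 by apply: (bitsK K2 (a := 1)) => //;
  apply: leq_trans mn nK.
have h2 : bits x * bits (x ^ m) <= K ^ 4.
  apply: (mulK K2 (a := 2) (b := 2)) => //; apply: (bitsK K2 (a := 1)) => //.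
    by apply: xK1; apply: leq_trans mn.
  by apply: xm; apply: ltnW.
have h3 := IH (ltnW mn).
have h4 : bits m.+1 + bits x * bits (x ^ m) <= K ^ 6 by apply: (addK K2 h1 h2).
rewrite mulSn /npred /nmul /tick /=; move: h3 h4.
by move: (npow x m).2 (bits m.+1) (bits x * _) (K ^ 6) (m * _); lia.
Qed.

(** All intermediate values are at most [K]: the two powers are positive factors of the result, each
    exponent is below its power, and the remaining values are below an exponent, a base or a
    parameter of the game. *)
Lemma depth_boundK : 0 < c -> (depth_bound c t).1 <= K -> (depth_bound c t).2 <= K ^ 21.
Proof.
move=> c0; rewrite depth_bound1; set d := \max_(s : G) _; set W := (max_weight t).1.
set kk := maxn 1 k * maxn 1 k; set Y := maxn 1 W * #|G| + 1 => lK.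
have n0 : 0 < #|G| by apply/card_gt0P; exists (init G).
have Y2 : 1 < Y by rewrite /Y addn1 ltnS muln_gt0 n0 leq_maxl.
have p0 : 0 < 2 ^ (d.-1 * #|G|) by rewrite expn_gt0.
have q0 : 0 < Y ^ (c * kk) by rewrite expn_gt0 ltnW.
have pK : 2 ^ (d.-1 * #|G|) <= K ^ 1 by rewrite expn1; apply: leq_trans lK;
  apply: leq_pmulr.
have qK : Y ^ (c * kk) <= K ^ 1 by rewrite expn1; apply: leq_trans lK; apply: leq_pmull.
have xK : d.-1 * #|G| <= K ^ 1 by apply: leq_trans pK; apply/ltnW/ltn_expl.
have zK : c * kk <= K ^ 1 by apply: leq_trans qK; apply/ltnW/ltn_expl.
have kk0 : 0 < kk by rewrite /kk muln_gt0 leq_maxl.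
have YK : Y <= K ^ 1.
  by apply: leq_trans qK; rewrite -{1}[Y]expn1 leq_exp2l // muln_gt0 c0.
have nK : #|G| <= K ^ 1 by rewrite expn1 ltnW.
have W1K : maxn 1 W <= K ^ 1 by rewrite expn1 geq_max ltnW //= max_weight_leK.
have k1K : maxn 1 k <= K ^ 1 by rewrite expn1 geq_max ltnW //= ltnW.
have kkK : kk <= K ^ 1 by apply: leq_trans zK; apply: leq_pmull.
have dK : d <= K ^ 1.
  apply/bigmax_leqP => s _; apply: leq_trans nK; exact: max_card.
have WK : W <= K ^ 1 by rewrite expn1 max_weight_leK.
have kK : k <= K ^ 1 by rewrite expn1 ltnW.
have oneK : 1 <= K ^ 1 by rewrite expn1 ltnW.
have twoK : 2 <= K ^ 1 by rewrite expn1.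
have cK : c <= K ^ 1 by apply: leq_trans zK; apply: leq_pmulr.
have d1K : d.-1 <= K ^ 1 by apply: leq_trans dK; apply: leq_pred.
have WnK : maxn 1 W * #|G| <= K ^ 1 by apply: leq_trans YK; rewrite /Y leq_addr.
have bK x : x <= K ^ 1 -> bits x <= K ^ 2 by move=> h; apply: (bitsK K2 h).
have aK x y : x <= K ^ 1 -> y <= K ^ 1 -> bits x + bits y <= K ^ 3.
  by move=> hx hy; apply: (addK K2 (bK _ hx) (bK _ hy)).
have mK x y : x <= K ^ 1 -> y <= K ^ 1 -> bits x * bits y <= K ^ 4.
  by move=> hx hy; apply: (mulK K2 (bK _ hx) (bK _ hy)).
have zQ : size (tstates t) = #|G| by rewrite size_map -cardE.
rewrite /depth_bound bind2; apply: (addK K2 (a := 5) (b := 20)) => //.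
  rewrite /lengthM zQ; apply: (mulK K2 (a := 2) (b := 2)) => //; last exact: bK.
  exact: (succK K2 nK).
rewrite bind2; apply: (addK K2 (a := 12) (b := 19)) => //; first exact: max_outdegreeK.
rewrite max_outdegree1 -/d [(lengthM _).1]/= zQ.
rewrite bind2; apply: (addK K2 (a := 10) (b := 18)) => //; first exact: max_weightK.
rewrite -/W bind2; apply: (addK K2 (a := 3) (b := 17)) => //; first exact: aK.
rewrite bind2; apply: (addK K2 (a := 3) (b := 16)) => //; first exact: aK.
rewrite bind2; apply: (addK K2 (a := 2) (b := 15)) => //; first exact: bK.
rewrite bind2; apply: (addK K2 (a := 4) (b := 14)) => //; first exact: mK.
rewrite bind2; apply: (addK K2 (a := 8) (b := 13)) => //; first exact: npowK.
rewrite npow1 bind2; apply: (addK K2 (a := 4) (b := 12)) => //; first exact: mK.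
rewrite bind2; apply: (addK K2 (a := 3) (b := 11)) => //; first exact: aK.
rewrite bind2; apply: (addK K2 (a := 4) (b := 10)) => //; first exact: mK.
rewrite bind2; apply: (addK K2 (a := 4) (b := 9)) => //; first exact: mK.
rewrite bind2; apply: (addK K2 (a := 8) (b := 4)) => //.
  by apply: npowK => //; apply: ltnW.
by rewrite npow1; apply: mK.
Qed.

End DepthCost.

Lemma CpreFP_energyK (H : game) (K c : nat) (l := (depth_bound c (encode H)).1)
    (cap := 2 * l * (max_weight (encode H)).1) : 2 <= K -> 0 < c ->
  cap < K -> wdim H < K -> size (tedges (encode H)) <= K ->
  (forall s s' (j : 'I_(wdim H)), edge s s' -> `|weight s s' 0%R j|%N <= K) ->
  #|H| * cap.+1 ^ wdim H < K -> l <= K ->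
  (CpreFP_energy c (encode H)).2 <= K ^ 48.
Proof.
move=> K2 c0 hC hk hE hw hcfg lK.
have hn : #|H| < K by apply: leq_ltn_trans hcfg; rewrite leq_pmulr // expn_gt0.
have WK := max_weight_leK hw.
rewrite bind2; apply: (addK K2 (a := 21) (b := 47)) => //.
  exact: (depth_boundK K2 hk hE hn hw c0).
rewrite bind2; apply: (addK K2 (a := 10) (b := 46)) => //; first exact: max_weightK.
rewrite bind2; apply: (addK K2 (a := 4) (b := 45)) => //.
  by apply: (mulK K2 (a := 2) (b := 2)) => //; apply: (bitsK K2 (a := 1)).
rewrite bind2; apply: (addK K2 (a := 5) (b := 44)) => //.
  apply: (mulK K2 (a := 3) (b := 2)) => //; last exact: (bitsK K2 (a := 1)).
  by apply: (bitsK K2 (a := 2)) => //; apply: (mulK K2 (a := 1) (b := 1)).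
apply: leq_trans (searchK K2 hC hk hE hw hcfg _) _; first by rewrite add0n.
by apply: (mulK K2 (a := 1) (b := 40)) => //; rewrite expn1.
Qed.

Lemma remove_parityK (G : pgame) (K c : nat) : 2 <= K -> 0 < c ->
  wdim G < K -> size (tedges (encode G)) <= K -> #|G| < K ->
  (forall s s' (j : 'I_(wdim G)), edge s s' -> `|weight s s' 0%R j|%N <= K) ->
  (forall s : G, prio s <= K) -> (depth_bound c (encode G)).1 <= K ->
  (remove_parity c (encode G) (encode_prio G)).2 <= K ^ 24.
Proof.
move=> K2 c0 hk hE hn hw hp lK.
have zps : size (encode_prio G) <= K ^ 1 by rewrite size_map -cardE expn1 ltnW.
have [uqs _ sqs _] := odd_priosP G.
have zq : size (odd_prios G) <= K ^ 1.
  apply: leq_trans zps; have := uniq_leq_size uqs sqs.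
  by rewrite !size_map.
have qK q : q \in odd_prios G -> q <= K ^ 1.
  by move=> /sqs /mapP[s _ ->]; rewrite expn1.
have nl x y : x <= K ^ 1 -> y <= K ^ 1 -> bits x + bits y <= K ^ 3.
  by move=> hx hy; apply: (nleqK K2 hx hy).
rewrite bind2; apply: (addK K2 (a := 21) (b := 23)) => //.
  exact: (depth_boundK K2 hk hE hn hw c0).
rewrite bind2 -[(odd_priorities _).1]/(odd_prios G);
  apply: (addK K2 (a := 10) (b := 22)) => //.
  (* The odd priorities collected so far are distinct priorities of states, hence no more numerous
     than the states. *)
  apply: (foldMK K2 (a := 1) (b := 7) (c := 10) isT
    (P := fun qs => uniq qs /\ {subset qs <= [seq x.2 | x <- encode_prio G]})) =>
      // qs [uq sq] x xin.
  have zqs : size qs <= K ^ 1.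
    by apply: leq_trans zps; have := uniq_leq_size uq sq; rewrite size_map.
  have qsK q : q \in qs -> q <= K ^ 1.
    by move=> /sq /mapP[y /mapP[s _ ->] ->]; rewrite expn1; apply: hp.
  have xK : x.2 <= K ^ 1 by move: xin => /mapP[s _ ->]; rewrite expn1; apply: hp.
  case: (odd x.2); last by split=> //; rewrite /= expn_gt0 K_gt0.
  have hE' : (hasM (neq x.2) qs).1 = (x.2 \in qs).
    by rewrite hasM1 -has_pred1; apply: eq_has => q; rewrite /= eq_sym.
  split.
    rewrite bind2; apply: (addK K2 (a := 6) (b := 0)) => //.
      by apply: (hasMK K2 (a := 1) (b := 3)) => // q /qsK; apply: nl.
    by case: ifP.
  have -> : (let! b := hasM (neq x.2) qs in
      if b then ret qs else tick 1 (x.2 :: qs)).1 = if x.2 \in qs then qs else x.2 ::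
        qs.
    by rewrite -hE' bind1; case: (hasM _ _).1.
  case: ifPn => // xqs; split; first by rewrite /= xqs.
  move=> q; rewrite inE => /orP[/eqP->|/sq//]; exact: map_f.
rewrite bind2; apply: (addK K2 (a := 4) (b := 21)) => //.
  by apply: (mulK K2 (a := 2) (b := 2)) => //;
    [apply: (succK K2 zq) | apply: (bitsK K2 zq)].
rewrite bind2; apply: (addK K2 (a := 3) (b := 20)) => //.
  by apply: nl => //; rewrite expn1 ltnW.
rewrite bind2 addn0; apply: (mapMK K2 (a := 1) (b := 16)) => // a aE.
rewrite bind2; apply: (addK K2 (a := 7) (b := 15)) => //.
  rewrite bind2 addn0; apply: (findMK K2 (a := 1) (b := 2)) => // x _.
  exact: eq_stateK.
rewrite lookup_prio1 bind2; apply: (addK K2 (a := 10) (b := 3)) => //.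
  apply: (mapMK K2 (a := 1) (b := 6)) => // q qin.
  rewrite bind2; apply: (addK K2 (a := 3) (b := 5)) => //.
    by apply: nl; [rewrite expn1 | apply: qK].
  rewrite bind2; apply: (addK K2 (a := 3) (b := 3)) => //.
    by apply: nl; [rewrite expn1 | apply: qK].
  by apply: (bitsK K2 (a := 1)); rewrite ?expn1.
rewrite bind2 addn0; apply: (succK K2 (a := 1)) => //.
have := aE; rewrite mem_tedges => /andP[_ /eqP ->].
by rewrite size_wlist expn1 ltnW.
Qed.

Lemma absz_scaled_threshold (G : pgame) (v : 'rV[rat]_(wdim G)) j :
  `|scaled_threshold v j|%N <= `|(numq (v 0%R j) * common_den v)%R|%N.
Proof.
rewrite /scaled_threshold; set x := (_ * _)%R; set d := denq _.
have d0 : (0 < d)%R by apply: denq_gt0.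
have := ltz_pmod x d0; have := modz_ge0 x (lt0r_neq0 d0); have := divz_eq x d.
move: (x %/ d)%Z (x %% d)%Z; clearbody x d; nia.
Qed.

Lemma remove_thresholdK (G : pgame) (v : 'rV[rat]_(wdim G)) (K : nat) : 2 <= K ->
  wdim G < K -> size (tedges (encode G)) <= K ->
  (forall s s' (j : 'I_(wdim G)), edge s s' -> `|weight s s' 0%R j|%N <= K) ->
  (forall j, `|numq (v 0%R j)|%N <= K /\ `|denq (v 0%R j)|%N <= K) ->
  `|common_den v|%N <= K ->
  (remove_threshold (encode G) (encode_rat v)).2 <= K ^ 20.
Proof.
move=> K2 hk hE hw hv hb.
have zv : size (encode_rat v) <= K ^ 1 by rewrite size_map size_enum_ord expn1 ltnW.
have zm (x y : int) a : `|x|%N <= K ^ a -> `|y|%N <= K ^ 1 ->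
    zbits x * zbits y <= K ^ (a.+2 + 3).
  by move=> hx hy; apply: (mulK K2 (zbitsK K2 hx (ltnSn _)) (zbitsK K2 hy (ltnSn _))).
rewrite bind2; apply: (addK K2 (a := 9) (b := 19)) => //.
  (* The partial product [r] divides the common denominator, so it is bounded by it; the hypothesis
     therefore speaks of [r] times the remaining factors. *)
  have H (l : seq 'I_(wdim G)) (r : int) : (`|(r * \prod_(j <- l) denq (v 0 j))%R| <=
    K)%N ->
     (foldM (fun r (x : int * int) => zmul r x.2) r
      [seq (numq (v 0%R j), denq (v 0%R j)) | j <- l]).2 <= (size l * (K ^ 6).+1).+1.
    elim: l r => [//|j l IH] r; rewrite big_cons => h.
    rewrite [size _]/= mulSn /foldM -/foldM bind2 bind2.
    have d1 (l' : seq 'I_(wdim G)) : 0 < `|(\prod_(j <- l') denq (v 0%R j))%R|%N.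
      rewrite absz_gt0; apply: lt0r_neq0; apply: prodr_gt0 => i _; exact: denq_gt0.
    have dj : 0 < `|denq (v 0%R j)|%N by rewrite absz_gt0 denq_neq0.
    have rK : `|r|%N <= K ^ 1.
      rewrite expn1; apply: leq_trans h; rewrite !abszM leq_pmulr //.
      by rewrite muln_gt0 dj d1.
    have h1 : (zmul r (denq (v 0%R j))).2 <= K ^ 6 by apply: (zm _ _ 1) => //;
      have [] := hv j.
    have h2 := IH (r * denq (v 0%R j))%R; rewrite -mulrA in h2.
    move: h1 (h2 h); rewrite /= ;
      move: (zbits r * _) (foldM _ _ _).2 (K ^ 6) (size l * _); lia.
  apply: leq_trans (H (enum 'I_(wdim G)) 1%R _) _.
    by rewrite mul1r big_enum.
  apply: (iterK K2 (a := 1) (b := 6)) => //.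
  by rewrite size_enum_ord expn1 ltnW.
rewrite common_den1 bind2; apply: (addK K2 (a := 16) (b := 18)) => //.
  apply: (mapMK K2 (a := 1) (b := 12)) => // x /mapP[j _ ->].
  have [h1 h2] := hv j.
  rewrite bind2; apply: (addK K2 (a := 6) (b := 7)) => //;
    first by apply: (zm _ _ 1); rewrite expn1.
  apply: (zm _ _ 2); last by rewrite expn1.
  by rewrite abszM; apply: (mulK K2 (a := 1) (b := 1)); rewrite ?expn1.
rewrite bind2 addn0; apply: (mapMK K2 (a := 1) (b := 13)) => // a aE.
rewrite bind2 addn0; apply: (zipMK K2 (a := 1) (b := 8)) => //.
  by have := aE; rewrite mem_tedges => /andP[_ /eqP ->]; rewrite size_wlist expn1 ltnW.
have aw z : z \in a.2 -> `|z|%N <= K ^ 1.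
  have := aE; rewrite mem_tedges => /andP[ea /eqP ->] /mapP[j _ ->].
  by rewrite expn1; apply: hw.
move=> x y /aw xK; rewrite mapM1 -map_comp => /mapP[j _ ->].
have [h1 h2] := hv j.
rewrite bind2; apply: (addK K2 (a := 6) (b := 7)) => //; first by apply: (zm _ _ 1);
  rewrite ?expn1.
apply: (zaddK K2 (a := 4)) => //.
  by rewrite abszM; apply: (mulK K2 (a := 1) (b := 1)); rewrite ?expn1.
rewrite [X in `|X|%N](_ : _ = scaled_threshold v j) //.
apply: leq_trans (_ : `|(numq (v 0 j) * common_den v)%R|%N <= _).
  exact: absz_scaled_threshold.
by rewrite abszM; apply: (mulK K2 (a := 1) (b := 1)); rewrite ?expn1.
Qed.

(** * Exponential bounds on the quantities of the algorithm *)

Lemma le_exp2 a b : a <= b -> 2 ^ a <= 2 ^ b.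
Proof. by move=> h; rewrite leq_exp2l. Qed.

Lemma mul_exp2 x y a b c : x <= 2 ^ a -> y <= 2 ^ b -> a + b <= c -> x * y <= 2 ^ c.
Proof. by move=> hx hy /le_exp2; apply: leq_trans; rewrite expnD leq_mul. Qed.

Lemma pow_exp2 x a n c : x <= 2 ^ a -> a * n <= c -> x ^ n <= 2 ^ c.
Proof.
move=> hx /le_exp2; apply: leq_trans; rewrite expnM.
by case: n => // n; rewrite leq_exp2r.
Qed.

(** The bit length [e] of the weights is a parameter because the estimate is used twice: for the
    original weights, and for the extended ones, whose size comes from the first use. *)
Lemma depth_bound_exp (G : game) N e : 0 < N -> #|G| <= N ->
  (max_weight (encode G)).1 <= 2 ^ e ->
  (depth_bound 8 (encode G)).1 <=
    2 ^ (N * N + (e + N) * (8 * (maxn 1 (wdim G) * maxn 1 (wdim G)))).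
Proof.
move=> N0 nN We; rewrite depth_bound1; apply: mul_exp2 (leqnn _); last first.
  have W1 : maxn 1 (max_weight (encode G)).1 <= 2 ^ e by rewrite geq_max expn_gt0.
  apply: pow_exp2 (leqnn _).
  apply: (@leq_trans (maxn 1 (max_weight (encode G)).1 * (#|G|).+1)).
    by rewrite mulnS addnC leq_add2r leq_maxl.
  by apply: mul_exp2 W1 (ltn_expl _ _) _ => //; rewrite leq_add2l.
rewrite leq_exp2l //; apply: leq_mul => //; apply: leq_trans (leq_pred _) _.
by apply/bigmax_leqP => s _; apply: leq_trans nN; apply: max_card.
Qed.

Section Exponential.
Variables (G : pgame) (N : nat).
Hypotheses (N0 : 0 < N) (nN : #|G| <= N) (kN : wdim G <= N).
Hypothesis EN : size (tedges (encode G)) <= N.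
Hypothesis wN : forall s s' (j : 'I_(wdim G)), edge s s' ->
  `|weight s s' 0%R j|%N <= 2 ^ (3 * N).
Hypothesis pN : forall s : G, prio s <= 2 ^ N.

Let l := (depth_bound 8 (encode G)).1.
Let H := ext_game G l (odd_prios G).
Let l' := (depth_bound 8 (encode H)).1.
Let cap := 2 * l' * (max_weight (encode H)).1.
(** The exponents grow as follows. For [l] it is about N * k ^ 2, of order N ^ 3. As [l] is a weight
    of [H], the exponent of [l'] is of order N ^ 3 * N ^ 2, and so is that of [cap]. The number of
    configurations raises [cap.+1] to the dimension of [H], at most 2 * N, which gives N ^ 6. The
    coefficients 33, 1100, 1135, 2300 and 2400 follow this computation, rounded up to absorb lower
    terms. *)
Let K := 2 ^ (2400 * N ^ 6).

Let pow_mono a b : a <= b -> N ^ a <= N ^ b.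
Proof. by move=> h; apply: leq_pexp2l. Qed.

Let l_le : l <= 2 ^ (33 * N ^ 3).
Proof.
apply: leq_trans (depth_bound_exp N0 nN (max_weight_le wN)) (le_exp2 _).
have kk : maxn 1 (wdim G) * maxn 1 (wdim G) <= N ^ 2.
  by rewrite expnS expn1 leq_mul // geq_max N0.
have e3 : (3 * N + N) * (8 * N ^ 2) = 32 * N ^ 3 by rewrite !expnS expn0; lia.
apply: (@leq_trans (N ^ 2 + (3 * N + N) * (8 * N ^ 2))).
  by rewrite -mulnn leq_add2l leq_mul2l leq_mul2l kk !orbT.
rewrite e3; have := pow_mono (isT : 2 <= 3); lia.
Qed.

Let W'_le : (max_weight (encode H)).1 <= 2 ^ (33 * N ^ 3).
Proof.
apply: max_weight_le => s s' j es; rewrite mxE; case: splitP => j' _.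
  apply: leq_trans (wN j' es) (le_exp2 _); have := pow_mono (isT : 1 <= 3);
    rewrite expn1; lia.
rewrite mxE /=; case: ifP => _; first by rewrite expn_gt0.
by case: ifP => _ //; apply: l_le.
Qed.

Let k'_le : wdim H <= 2 * N.
Proof.
rewrite mul2n -addnn; apply: leq_add => //.
have [uq _ sq _] := odd_priosP G; have := uniq_leq_size uq sq.
by rewrite size_map -cardE => h; apply: leq_trans nN.
Qed.

Let l'_le : l' <= 2 ^ (1100 * N ^ 5).
Proof.
apply: leq_trans (@depth_bound_exp H N _ N0 nN W'_le) (le_exp2 _).
have kk : maxn 1 (wdim H) * maxn 1 (wdim H) <= 4 * N ^ 2.
  have h : maxn 1 (wdim H) <= 2 * N by rewrite geq_max k'_le andbT muln_gt0.
  by apply: leq_trans (leq_mul h h) _; rewrite expnS expn1; lia.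
have h3 := pow_mono (isT : 1 <= 3); rewrite expn1 in h3.
have h5 := pow_mono (isT : 2 <= 5).
have e5 : N ^ 3 * N ^ 2 = N ^ 5 by rewrite -expnD.
apply: (@leq_trans (N ^ 2 + (34 * N ^ 3) * (32 * N ^ 2))).
  rewrite -mulnn leq_add2l; apply: leq_mul; first by lia.
  by apply: leq_trans (leq_mul (leqnn 8) kk) _; lia.
have -> : 34 * N ^ 3 * (32 * N ^ 2) = 1088 * N ^ 5 by rewrite -e5; lia.
lia.
Qed.

Let cap_le : cap.+1 <= 2 ^ (1135 * N ^ 5).
Proof.
have h : cap <= 2 ^ (1134 * N ^ 5).
  apply: mul_exp2 (mul_exp2 (leqnn (2 ^ 1)) l'_le (leqnn _)) W'_le _.
  have := pow_mono (isT : 3 <= 5); have := pow_mono (isT : 0 <= 5); rewrite expn0; lia.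
apply: leq_trans (_ : 2 ^ (1134 * N ^ 5) + 2 ^ (1134 * N ^ 5) <= _).
  by rewrite -addn1 leq_add // expn_gt0.
rewrite addnn -mul2n -expnS; apply: le_exp2.
by have := pow_mono (isT : 0 <= 5); rewrite expn0; lia.
Qed.

Let states_le : #|G| * cap.+1 ^ wdim H < 2 ^ (2300 * N ^ 6).
Proof.
have h : #|G| * cap.+1 ^ wdim H <= 2 ^ (N + 1135 * N ^ 5 * (2 * N)).
  apply: mul_exp2 (leqnn _).
    by apply: ltnW; apply: leq_ltn_trans nN (ltn_expl _ _).
  by apply: pow_exp2 cap_le _; rewrite leq_mul2l k'_le orbT.
apply: leq_ltn_trans h _; rewrite ltn_exp2l //.
have e6 : 1135 * N ^ 5 * (2 * N) = 2270 * N ^ 6 by rewrite [N ^ 6]expnSr; lia.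
have := pow_mono (isT : 1 <= 6); rewrite e6 expn1.
have : 0 < N ^ 6 by rewrite expn_gt0 N0.
lia.
Qed.

Lemma memory_exp : (#|G| * cap.+1 ^ (wdim G + size (odd_prios G))).+1 <= K.
Proof. by apply: leq_trans states_le (le_exp2 _); rewrite leq_mul2r orbT. Qed.

Let cap_lt : cap < K.
Proof.
apply: leq_trans cap_le (le_exp2 _); have := pow_mono (isT : 5 <= 6); lia.
Qed.

Let N6 : N <= N ^ 6. Proof. by have := pow_mono (isT : 1 <= 6); rewrite expn1. Qed.

Let N_lt : 2 * N < K.
Proof.
apply: leq_trans (ltn_expl _ (isT : 1 < 2)) (le_exp2 _); lia.
Qed.

Lemma CpreFP_exp : (CpreFP_energy_parity 8 (encode G) (encode_prio G)).2 <= K ^ 49.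
Proof.
have K2 : 2 <= K by rewrite -[2]/(2 ^ 1) le_exp2 //; lia.
have lK : l <= K.
  by apply: leq_trans l_le (le_exp2 _); have := pow_mono (isT : 3 <= 6); lia.
have N3 := pow_mono (isT : 3 <= 6).
have wK s s' (j : 'I_(wdim G)) : edge s s' -> `|weight s s' 0%R j|%N <= K.
  by move=> es; apply: leq_trans (wN j es) (le_exp2 _); lia.
have NK : N < K by lia.
have pK (s : G) : prio s <= K by apply: leq_trans (pN s) (le_exp2 _); lia.
have w'K s s' (j : 'I_(wdim H)) : edge s s' -> `|weight s s' 0%R j|%N <= K.
  move=> es; rewrite -lez_nat abszE; apply: le_trans (weight_max j es) _.
  rewrite lez_nat; apply: leq_trans W'_le (le_exp2 _); lia.
have sK : #|H| * cap.+1 ^ wdim H < K.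
  by apply: leq_trans states_le (le_exp2 _); rewrite leq_mul2r orbT.
have l'K : l' <= K.
  by apply: leq_trans l'_le (le_exp2 _); have := pow_mono (isT : 5 <= 6); lia.
have k'K := leq_ltn_trans k'_le N_lt.
have EK := leq_trans EN (ltnW NK).
have E'K : size (tedges (encode H)) <= K.
  by apply: leq_trans EK; rewrite !size_map.
have capK := cap_lt; have kK := leq_ltn_trans kN NK; have nK := leq_ltn_trans nN NK.
(* [K] becomes a variable: from here on only the collected bounds on it count. *)
move: K K2 lK wK NK pK w'K sK l'K k'K EK E'K capK kK nK =>
  B K2 lK wK NK pK w'K sK l'K k'K EK E'K capK kK nK.
rewrite bind2 remove_parity1 -/l -/H; apply: (addK K2 (a := 24) (b := 48)) => //.
  exact: (@remove_parityK G B 8 K2 isT kK EK nK wK pK lK).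
exact: (@CpreFP_energyK H B 8 K2 isT capK k'K E'K w'K sK l'K).
Qed.

End Exponential.

Lemma ltn_exp_bits n : n < 2 ^ bits n.
Proof. exact: trunc_log_ltn. Qed.

Lemma bits_exp n m : bits n <= m -> n <= 2 ^ m.
Proof. by move=> h; apply: ltnW; apply: leq_trans (ltn_exp_bits n) (le_exp2 h). Qed.

Lemma zbits_exp z m : zbits z <= m -> `|z|%N <= 2 ^ m.
Proof. by move=> h; apply: bits_exp; apply: ltnW. Qed.

Lemma leq_bigsum (I : finType) (P : pred I) (F : I -> nat) i : P i ->
  F i <= \sum_(j | P j) F j.
Proof. by move=> Pi; rewrite (bigD1 i) //= leq_addr. Qed.

(** * Quantities bounded by the size of the input *)

Section Sizes.
Variable G : pgame.

Lemma energy_parity_size_bounds : let N := energy_parity_size G in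
  [/\ 0 < N, #|G| <= N, wdim G <= N, size (tedges (encode G)) <= N
    & (forall s s' (j : 'I_(wdim G)), edge s s' -> zbits (weight s s' 0%R j) <= N) /\
      (forall s : G, bits (prio s) <= N)].
Proof.
set F := fun a : G * G =>
  2 * name_bits G + \sum_(j < wdim G) zbits (weight a.1 a.2 0%R j).
set A := \sum_(s : G) (name_bits G).+1.
set B := \sum_(a : G * G | edge a.1 a.2) F a.
set D := \sum_(s : G) (name_bits G + bits (prio s)).
have NE : energy_parity_size G = bits (wdim G) + name_bits G + A + B + D by [].
have nb : 0 < name_bits G by [].
have nA : #|G| <= A.
  by rewrite /A -[X in X <= _]sum1_card; apply: leq_sum.
have FB s s' : edge s s' -> F (s, s') <= B.
  by move=> e; apply: (leq_bigsum (P := fun a : G * G =>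
    edge a.1 a.2) F (i := (s, s'))).
(* The dimension is written in binary, but a weight vector lists all its coordinates; as at least
   one edge exists, the dimension is bounded by the size. *)
have [s' es] := edge_total (init G).
have kB : wdim G <= B.
  apply: leq_trans (FB _ _ es); apply: leq_trans (leq_addl _ _).
  by rewrite -[X in X <= _]card_ord -sum1_card; apply: leq_sum.
have EB : size (tedges (encode G)) <= B.
  rewrite size_map size_filter -sum1_count big_enum_cond /=.
  by apply: leq_sum => a _; rewrite /F mul2n -addnn -!addnA;
    apply: leq_trans (leq_addr _ _).
have ND : {in predT, forall s : G, bits (prio s) <= D}.
  move=> s _; apply: leq_trans (leq_addl (name_bits G) _) _.
  exact: (leq_bigsum (P := predT) (fun s : G => name_bits G + bits (prio s))).
rewrite NE; split; try lia; split=> [s t j e|s]; last by have := ND s isT; lia.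
have : zbits (weight s t 0%R j) <= F (s, t).
  apply: leq_trans (leq_addl _ _).
  exact: (leq_bigsum (P := predT) (fun j => zbits (weight s t 0%R j))).
by have := FB _ _ e; lia.
Qed.

Variable v : 'rV[rat]_(wdim G).

Lemma common_den_exp : `|common_den v|%N <= 2 ^ (\sum_(j < wdim G) zbits (denq (v 0%R
  j))).
Proof.
rewrite /common_den; elim/big_rec2: _ => // j m d _ IH.
by rewrite abszM expnD leq_mul //; apply: zbits_exp.
Qed.

(** A scaled weight is a difference of two terms, each bounded by a product of two numbers of at
    most 2 ^ N, which gives 2 * N + 1 and hence at most 3 * N bits. *)
Lemma threshold_size_bounds (N := mp_parity_size v) :
  [/\ `|common_den v|%N <= 2 ^ N,
      (forall j, `|numq (v 0%R j)|%N <= 2 ^ N /\ `|denq (v 0%R j)|%N <= 2 ^ N) &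
      forall s s' (j : 'I_(wdim G)), edge s s' ->
        `|threshold_weight v s s' 0%R j|%N <= 2 ^ (3 * N)].
Proof.
have SN : \sum_(j < wdim G) (zbits (numq (v 0%R j)) + zbits (denq (v 0%R j))) <= N by
  apply: leq_addl.
have jN j : zbits (numq (v 0%R j)) + zbits (denq (v 0%R j)) <= N.
  by apply: leq_trans SN;
    apply: (leq_bigsum (P := predT) (fun j =>
      zbits (numq (v 0%R j)) + zbits (denq (v 0%R j)))).
have hb : `|common_den v|%N <= 2 ^ N.
  apply: leq_trans common_den_exp (le_exp2 _); apply: leq_trans SN.
  by apply: leq_sum => j _; apply: leq_addl.
have hv j : `|numq (v 0%R j)|%N <= 2 ^ N /\ `|denq (v 0%R j)|%N <= 2 ^ N.
  by split; apply: zbits_exp; apply: leq_trans (jN j); rewrite ?leq_addl ?leq_addr.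
split=> // s s' j es; rewrite mxE.
have [N0 _ _ _ [/(_ s s' j es) wz _]] := energy_parity_size_bounds.
have wN : `|weight s s' 0%R j|%N <= 2 ^ N.
  by apply: zbits_exp; apply: leq_trans wz (leq_addr _ _).
have h1 : `|(common_den v * weight s s' 0 j)%R|%N <= 2 ^ (2 * N).
  by rewrite abszM; apply: mul_exp2 hb wN _; lia.
have h2 : `|scaled_threshold v j|%N <= 2 ^ (2 * N).
  apply: leq_trans (_ : `|(numq (v 0%R j) * common_den v)%R|%N <= _); last first.
    by rewrite abszM; apply: mul_exp2 (hv j).1 hb _; lia.
  exact: absz_scaled_threshold.
have NN : 0 < N by apply: leq_trans N0 (leq_addr _ _).
apply: (@leq_trans (2 ^ (2 * N).+1)); last by apply: le_exp2; lia.
rewrite expnS mul2n -addnn; apply: leq_trans (leq_add h1 h2); lia.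
Qed.

End Sizes.

Lemma horner_monomial (a e n : nat) : (('X^e *+ a : {poly nat}).[n] = (a * n ^ e)%N)%R.
Proof.
rewrite hornerMn hornerXn -mulr_natl natn; congr (_ * _)%N.
Qed.

Lemma exp2_mono c a b n : a <= b -> 2 ^ (c * a * n) <= 2 ^ (c * b * n).
Proof. by move=> ab; apply: le_exp2; rewrite leq_mul2r leq_mul2l ab !orbT. Qed.

(** [N] is a free parameter instead of the size of [G]: in the mean-payoff case the run is on the
    scaled game, whereas [N] is the size of the original input. *)
Lemma energy_parity_run (G : pgame) (N : nat) (run :=
  CpreFP_energy_parity 8 (encode G) (encode_prio G)) : 
  0 < N -> #|G| <= N -> wdim G <= N -> size (tedges (encode G)) <= N ->
  (forall s s' (j : 'I_(wdim G)), edge s s' -> `|weight s s' 0%R j|%N <= 2 ^ (3 * N)) ->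
  (forall s : G, prio s <= 2 ^ N) ->
  run.2 <= 2 ^ (2400 * 49 * N ^ 6) /\
  forall m : machine G, run.1 = Some m ->
    [/\ #|mstate (decode_machine m)| <= 2 ^ (2400 * 1 * N ^ 6),
      is_strategy (G := G) (moore_strategy (decode_machine m)) &
      forall pi, consistent (G := G) (moore_strategy (decode_machine m)) pi ->
        energy_safe (decode_credit m) pi /\ Par_even pi].
Proof.
move=> N0 nN kN EN wN pN; split.
  by rewrite mulnAC expnM; apply: CpreFP_exp.
move=> m /CpreFP_sound[st card win]; split=> //.
by apply: leq_trans card _; rewrite muln1; apply: memory_exp.
Qed.

Theorem theorem2 :
  exists (c : nat) (P : {poly nat}),
  [/\ (* the algorithm is symbolic: its antichains are the minimal elements of
         the greatest fixed points *)
      forall (G : game) (C : nat),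
        let V := (cpre_fixpoint (encode G) C).1 in
        uniq V /\
        forall y : G * seq nat,
          y \in V <->
          exists2 x : config G C,
            minimal_in (Cpre_star G C) x & y = listing x,
      forall G : pgame,
        let run := CpreFP_energy_parity c (encode G) (encode_prio G) in
        let bound := 2 ^ P.[energy_parity_size G]%R in
        run.2 <= bound /\
        ((exists sigma v0, energy_parity_winning (G := G) sigma v0) ->
         exists m : machine G,
           [/\ run.1 = Some m,
               #|mstate (decode_machine m)| <= bound &
               energy_parity_winning (G := G)
                 (moore_strategy (decode_machine m)) (decode_credit m)])
    &
      forall (G : pgame) (v : 'rV[rat]_(wdim G)),
        let run := CpreFP_mp_parity c (encode G) (encode_prio G)
                     (encode_rat v) in
        let bound := 2 ^ P.[mp_parity_size v]%R in
        run.2 <= bound /\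
        forall R : realType,
        ((exists M : moore G, mp_parity_winning (G := G) R v (moore_strategy M)) ->
         exists m : machine G,
           [/\ run.1 = Some m,
               #|mstate (decode_machine m)| <= bound &
               mp_parity_winning (G := G) R v
                 (moore_strategy (decode_machine m))])].
Proof.
(* The energy run takes time K ^ 49 with K = 2 ^ (2400 * N ^ 6); one more factor [K] absorbs the
   removal of the threshold. *)
exists 8, ('X^6 *+ (2400 * 50))%R; split.
- move=> G C V; have r := cpre_fixpoint_represents G C.
  by split; [have [[] //] := r | apply: represents_minimal r].
- move=> G run bound.
  have [N0 nN kN EN [wN pN]] := energy_parity_size_bounds G.
  have boundE : bound = 2 ^ (2400 * 50 * energy_parity_size G ^ 6) by rewrite /bound
    horner_monomial.
  have [|s|h1 h2] := energy_parity_run N0 nN kN EN.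
  + by move=> s s' j es; apply: zbits_exp; apply: leq_trans (wN s s' j es) _;
      rewrite leq_pmull.
  + exact: bits_exp.
  split; first by rewrite boundE; apply: leq_trans h1 (exp2_mono _ _ _).
  move=> [sigma [v0 win]]; have [m hm] := energy_complete win.
  have [h3 h4 h5] := h2 m hm; exists m; split=> //.
  by rewrite boundE; apply: leq_trans h3 (exp2_mono _ _ _).
- move=> G v run bound; pose N := mp_parity_size v.
  have [N0 nN kN EN [wN pN]] := energy_parity_size_bounds G.
  have [hb hv htw] := threshold_size_bounds v; rewrite -/N in hb hv htw.
  have boundE : bound = 2 ^ (2400 * 50 * N ^ 6) by rewrite /bound horner_monomial.
  have eN : energy_parity_size G <= N by apply: leq_addr.
  have runE : run.1 = (CpreFP_energy_parity 8 (encode (threshold_game v))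
    (encode_prio (threshold_game v))).1.
    by rewrite -remove_threshold1.
  have ET : size (tedges (encode (threshold_game v))) <= N.
    by apply: leq_trans eN; apply: leq_trans EN; rewrite !size_map.
  have [|s|h1 h2] := @energy_parity_run (threshold_game v) N (leq_trans N0 eN)
    (leq_trans nN eN) (leq_trans kN eN) ET.
  + exact: htw.
  + by apply: bits_exp; apply: leq_trans (pN s) eN.
  split.
    rewrite boundE mulnAC expnM.
    rewrite mulnAC expnM in h1; set K := 2 ^ (2400 * N ^ 6) in h1 *.
    have NK : 2 ^ N <= K.
      by apply: le_exp2; apply: leq_trans (leq_pexp2l _ (isT : 1 <= 6)) _;
        rewrite ?expn1 ?leq_pmull.
    have lt : N < K by apply: leq_trans (ltn_expl N (isT : 1 < 2)) NK.
    have K2 : 1 < K by apply: leq_trans lt; rewrite ltnS; apply: leq_trans N0 eN.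
    rewrite [X in X <= _]bind2 remove_threshold1; apply: (addK K2 _ h1 (a := 20)) => //.
    apply: (@remove_thresholdK G v K K2).
    - by apply: leq_ltn_trans (leq_trans kN eN) lt.
    - by apply: leq_trans (leq_trans EN eN) (ltnW lt).
    - move=> s s' j es; apply: leq_trans NK; apply: zbits_exp.
      by apply: leq_trans (wN s s' j es) eN.
    - by move=> j; have [n1 n2] := hv j; split;
        [apply: leq_trans n1 NK | apply: leq_trans n2 NK].
    - by apply: leq_trans hb NK.
  move=> R [M win]; have [m hm] := mp_complete win.
  have hm' := hm; rewrite -[X in X = _]/(run.1) runE in hm'.
  have [h3 h4 h5] := h2 m hm'; exists m; split=> //.
    by rewrite boundE; apply: leq_trans h3 (exp2_mono _ _ _).
  split; first exact: h4.
  move=> pi cpi; have [safe par] := h5 pi cpi; split=> //.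
  (* The credit found for the scaled game bounds the scaled energies below, which is all that the
     mean-payoff condition needs. *)
  pose c j := @decode_credit (threshold_game v) m 0%R j.
  exact: (@threshold_mp G v R pi c safe).
Qed.
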